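(* Let $c,h,h_W,\alpha,\beta\in\mathbb{C}$. The $\mathcal{L}$-module $V'_{\alpha,\beta,0}\otimes L(c,h,h_W)$ contains an irreducible (not necessarily proper) submodule with infinite-dimensional weight subspaces if and only if there exists a subsingular vector $u\in V(c,h,h_W)$ such that $\overline{u}=L_{-p}^r v$ (for some $p,r\in\mathbb{N}$ with $2h_W+\frac{p^2-1}{12}c=0$).
   Context: $\mathbb{N}=\{1,2,\dots\}$. $\mathcal{L}=W(2,2)$ is the complex Lie algebra with basis $\{W_n,L_n,C:n\in\mathbb{Z}\}$ and brackets $[L_n,L_m]=(n-m)L_{n+m}+\delta_{n,-m}\frac{n^3-n}{12}C$, $[L_n,W_m]=(n-m)W_{n+m}+\delta_{n,-m}\frac{n^3-n}{12}C$, $[W_n,W_m]=0$, $[\mathcal{L},C]=0$. Put $\mathcal{L}_{\pm}=\bigoplus_{n>0}(\mathbb{C}L_{\pm n}+\mathbb{C}W_{\pm n})$. $U(\cdot)$ denotes the universal enveloping algebra. The Verma module $V(c,h,h_W)$ is the quotient of $U(\mathcal{L})$ by the left ideal generated by $L_n,W_n$ ($n\in\mathbb{N}$), $C-c$, $L_0-h$, $W_0-h_W$; $v$ is the image of $1$. It has the PBW basis $W_{-m_s}\cdots W_{-m_1}L_{-n_t}\cdots L_{-n_1}v$ with $m_s\ge\cdots\ge m_1\ge1$, $n_t\ge\cdots\ge n_1\ge1$ ($s,t\ge0$). $V(c,h,h_W)_{h+k}$ is the $L_0$-eigenspace of eigenvalue $h+k$. $L(c,h,h_W)$ is the unique irreducible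 quotient of $V(c,h,h_W)$. Weight subspaces of a module are its $L_0$-eigenspaces. The $W$-degree of the PBW vector $W_{-m_s}\cdots W_{-m_1}L_{-n_t}\cdots L_{-n_1}v$ is $s$. For nonzero $x\in V(c,h,h_W)$, written in the PBW basis, $\overline{x}$ is its lowest nonzero homogeneous component with respect to $W$-degree. $\mathcal{W}$ is the span of the vectors $W_{-m_s}\cdots W_{-m_1}v$. A singular vector in a module is a nonzero $L_0$-eigenvector annihilated by $\mathcal{L}_+$. For $p\in\mathbb{N}$ with $2h_W+\frac{p^2-1}{12}c=0$, $u'$ denotes a singular vector in $V(c,h,h_W)_{h+p}\cap\mathcal{W}$ with $\overline{u'}=W_{-p}v$; put $L'(c,h,h_W)=V(c,h,h_W)/U(\mathcal{L})u'$. A subsingular vector is an $L_0$-eigenvector $u\in V(c,h,h_W)$ whose image in $L'(c,h,h_W)$ is a singular vector (the case that $u$ is itself singular in $V(c,h,h_W)$ is allowed). Intermediate series: $V_{\alpha,\beta,0}$ has basis $\{v_m:m\in\mathbb{Z}\}$ and action $L_nv_m=-(m+\alpha+\beta+n\beta)v_{m+n}$, $Cv_m=W_nv_m=0$. $V_{\alpha,\beta,0}\cong V_{\alpha+k,\beta,0}$ for $k\in\mathbb{Z}$ by shifting indices, so for $\alpha\in\mathbb{Z}$ one may assume $\alpha=0$. Put $V'_{0,0,0}=V_{0,0,0}/\mathbb{C}v_0$, $V'_{0,1,0}=\bigoplus_{m\ne-1}\mathbb{C}v_m\subseteq V_{0,1,0}$, and $V'_{\alpha,\beta,0}=V_{\alpha,\beta,0}$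 otherwise. The tensor product carries the usual action $a(x\otimes y)=ax\otimes y+x\otimes ay$ for $a\in\mathcal{L}$.
   Formalization: The vectors u' are taken as given for every p with 2h_W+(p²-1)c/12=0, which excludes c=h_W=0: there no u' exists for p=2, and the claim fails at c=h=h_W=0, where L_{-1}v is singular but L(c,h,h_W) is trivial. *)

(* Defs.v *)
From HB Require Import structures.
From mathcomp Require Import all_boot all_order all_algebra.
From mathcomp Require Import generic_quotient ring_quotient.
From mathcomp Require Import finmap.
From mathcomp.multinomials Require Import monalg.
From mathcomp Require Import boolp classical_sets reals.
From mathcomp Require Import complex.
From mathcomp Require Import ring.

Set Implicit Arguments.
Unset Strict Implicit.
Unset Printing Implicit Defensive.

Import GRing.Theory.
Local Open Scope classical_set_scope.
Local Open Scope quotient_scope.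
Local Open Scope ring_scope.

(* A vector space with basis T is {malg K[T]}, the finitely
   supported functions T -> K, and << a *g t >> is a times the basis vector
   t.  Subspaces are sets in the sense of classical_sets. *)

Section LinearExtension.
Variables (K : fieldType) (T : choiceType) (V : lmodType K).

Definition lext (f : T -> V) (x : {malg K[T]}) : V :=
  \sum_(t <- msupp x) x@_t *: f t.

Lemma lextEw (f : T -> V) (x : {malg K[T]}) (d : {fset T}) :
  (msupp x `<=` d)%fset -> lext f x = \sum_(t <- d) x@_t *: f t.
Proof.
move=> sd; rewrite /lext; apply: big_fset_incl => //= t _.
by move=> /mcoeff_outdom ->; rewrite scale0r.
Qed.

Lemma lext_is_linear f : linear (lext f).
Proof.
move=> a x y; pose d := (msupp x `|` msupp y `|` msupp (a *: x + y))%fset.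
rewrite (@lextEw f _ d) ?fsubsetUr // (@lextEw f x d); last first.
  by rewrite /d -fsetUA fsubsetUl.
rewrite (@lextEw f y d); last by rewrite /d fsetUAC fsubsetUr.
rewrite scaler_sumr -big_split /=; apply: eq_bigr => t _.
by rewrite mcoeffD mcoeffZ scalerDl scalerA.
Qed.

HB.instance Definition _ f :=
  GRing.isLinear.Build K {malg K[T]} V _ (lext f) (lext_is_linear f).

Lemma lextU f t : lext f << t >> = f t.
Proof.
rewrite (@lextEw _ _ [fset t]%fset); last exact: msuppU_le.
by rewrite big_seq_fset1 mcoeffUU scale1r.
Qed.

Lemma lextUz f a t : lext f << a *g t >> = a *: f t.
Proof.
rewrite (@lextEw _ _ [fset t]%fset); last exact: msuppU_le.
by rewrite big_seq_fset1 mcoeffUU.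
Qed.

End LinearExtension.

Section Subspaces.
Variables (K : fieldType) (V : lmodType K).

Definition subspace (N : set V) : Prop :=
  N 0 /\ forall a x y, N x -> N y -> N (a *: x + y).

Definition span (S : set V) : set V := smallest subspace S.

Definition finite_dim (N : set V) : Prop :=
  exists s : seq V, N `<=` span [set` s].

Lemma smallest_subspace (P : set (set V)) (S : set V) :
  (forall N, P N -> subspace N) -> subspace (smallest P S).
Proof.
move=> sP; split=> [N [/sP[N0 _] _]//|a x y Nx Ny N [PN SN]].
by case: (sP _ PN) => _; apply; [apply: Nx|apply: Ny].
Qed.

Lemma span_subspace S : subspace (span S).
Proof. exact: smallest_subspace. Qed.

Lemma lker_subspace (W : lmodType K) (f : {linear V -> W}) :
  subspace [set x | f x = 0].
Proof.
by split=> [|a x y /= fx fy]; rewrite /= ?linear0 ?linearP ?fx ?fy ?scaler0 ?addr0.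
Qed.

End Subspaces.

Section Quotient.
Variables (K : fieldType) (V : lmodType K) (N : set V) (subN : subspace N).

Definition subspace_pred of subspace N : {pred V} := fun x => `[< N x >].

Fact subspace_pred_closed : submod_closed (subspace_pred subN).
Proof.
split; first by apply/asboolP; case: subN.
move=> a x y /asboolP Nx /asboolP Ny; apply/asboolP.
by case: subN => _; apply.
Qed.

HB.instance Definition _ :=
  GRing.isSubmodClosed.Build K V (subspace_pred subN) subspace_pred_closed.

Definition quotV := Quotient.quot (subspace_pred subN).
HB.instance Definition _ := GRing.Zmodule.on quotV.

Definition projV (x : V) : quotV := \pi_(Quotient.quot (subspace_pred subN)) x.

Lemma projVB : {morph projV : x y / x - y}.
Proof. by move=> x y; rewrite /projV raddfB. Qed.

Lemma projV_eq x y : (projV x = projV y) <-> N (x - y).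
Proof.
rewrite /projV; split => [/eqP|Nxy].
  by rewrite -Quotient.idealrBE => /asboolP.
by apply/eqP; rewrite -Quotient.idealrBE; apply/asboolP.
Qed.

Lemma projV0 x : (projV x = 0) <-> N x.
Proof.
have -> : 0 = projV 0 by rewrite -(subrr (0 : V)) projVB subrr.
by rewrite projV_eq subr0.
Qed.

Definition liftV (W : Type) (f : V -> W) (x : quotV) : W := f (repr x).

Lemma projVK x : projV (repr x) = x.
Proof. exact: reprK. Qed.

Lemma liftVE (W : lmodType K) (f : V -> W) : linear f ->
  (forall x, N x -> f x = 0) -> forall x, liftV f (projV x) = f x.
Proof.
move=> lf f0 x; rewrite /liftV.
have : f (repr (projV x) - x) = 0 by apply/f0/projV_eq; exact: projVK.
rewrite addrC -scaleN1r lf scaleN1r => e.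
by rewrite -[RHS]addr0 -e addrA subrr add0r.
Qed.

Definition scaleq (a : K) : quotV -> quotV := liftV (fun x => projV (a *: x)).

Lemma scaleqE a x : scaleq a (projV x) = projV (a *: x).
Proof.
apply/projV_eq; rewrite -scalerBr.
have Nx : N (repr (projV x) - x) by apply/projV_eq; rewrite projVK.
have [N0 Nl] := subN; have := Nl a _ 0 Nx N0; by rewrite addr0.
Qed.

Lemma projVD : {morph projV : x y / x + y}.
Proof. by move=> x y; rewrite /projV raddfD. Qed.

Fact scaleqA a b x : scaleq a (scaleq b x) = scaleq (a * b) x.
Proof. by rewrite -[x]projVK !scaleqE scalerA. Qed.
Fact scaleq1 : left_id 1 scaleq.
Proof. by move=> x; rewrite -[x]projVK scaleqE scale1r. Qed.
Fact scaleqDr : right_distributive scaleq +%R.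
Proof.
by move=> a x y; rewrite -[x]projVK -[y]projVK -projVD !scaleqE -projVD scalerDr.
Qed.
Fact scaleqDl x : {morph scaleq^~ x : a b / a + b}.
Proof. by move=> a b; rewrite -[x]projVK !scaleqE -projVD scalerDl. Qed.

HB.instance Definition _ := GRing.Zmodule_isLmodule.Build K quotV
  scaleqA scaleq1 scaleqDr scaleqDl.

Lemma projV_is_linear : linear projV.
Proof. by move=> a x y; rewrite projVD -scaleqE. Qed.

HB.instance Definition _ :=
  GRing.isLinear.Build K V quotV _ projV projV_is_linear.

Definition subV := {x : V | x \in subspace_pred subN}.
HB.instance Definition _ := [isSub of subV for sval].
HB.instance Definition _ := [Choice of subV by <:].
HB.instance Definition _ := [SubChoice_isSubLmodule of subV by <:].

Definition inclV (x : subV) : V := val x.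

Lemma inclV_is_linear : linear inclV.
Proof. by move=> a x y; rewrite /inclV linearP. Qed.

HB.instance Definition _ :=
  GRing.isLinear.Build K subV V _ inclV inclV_is_linear.

Lemma inclV_inj : injective inclV. Proof. exact: val_inj. Qed.

Lemma inclVP x : N (inclV x).
Proof. by have /asboolP := valP x. Qed.

End Quotient.

Lemma liftV_is_linear (K : fieldType) (V W : lmodType K) (N : set V)
    (subN : subspace N) (f : V -> W) : linear f ->
  (forall x, N x -> f x = 0) -> linear (liftV (subN := subN) f).
Proof.
move=> lf f0 a x y; have E := liftVE subN lf f0.
by rewrite -[x]projVK -[y]projVK -linearP !E lf.
Qed.

Lemma malgU_scale (K : fieldType) (T : choiceType) (a : K) (t : T) :
  << a *g t >> = a *: << t >> :> {malg K[T]}.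
Proof.
apply/malgP => k; transitivity (a * (<< t >> : {malg K[T]})@_k).
  by rewrite !mcoeffU mulr_natr.
by rewrite mcoeffZ.
Qed.

Lemma lext_pointwise_linear (K : fieldType) (T : choiceType) (V W : lmodType K)
    (f : T -> V -> W) (b : {malg K[T]}) :
  (forall t, linear (f t)) -> linear (fun v => lext (f^~ v) b).
Proof.
move=> lf a x y; rewrite /lext scaler_sumr -big_split; apply: eq_bigr => t _ /=.
by rewrite lf scalerDr !scalerA mulrC.
Qed.

Lemma malg_linearE (K : fieldType) (T : choiceType) (V : lmodType K)
    (f : {linear {malg K[T]} -> V}) x :
  f x = \sum_(t <- msupp x) x@_t *: f << t >>.
Proof.
rewrite [in LHS](monalgE x) linear_sum; apply: eq_bigr => t _.
rewrite -linearZ /=; congr (f _); apply/malgP => k.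
by rewrite mcoeffZ !mcoeffU mulr_natr.
Qed.

Lemma malg_linear_eq (K : fieldType) (T : choiceType) (V : lmodType K)
    (f g : {malg K[T]} -> V) : linear f -> linear g ->
  (forall t, f << t >> = g << t >>) -> f =1 g.
Proof.
move=> lf lg e x.
pose mf := GRing.isLinear.Build K {malg K[T]} V _ f lf.
pose mg := GRing.isLinear.Build K {malg K[T]} V _ g lg.
pose f' : {linear {malg K[T]} -> V} := HB.pack f mf.
pose g' : {linear {malg K[T]} -> V} := HB.pack g mg.
have -> : f x = f' x by []. have -> : g x = g' x by [].
by rewrite !malg_linearE; apply: eq_bigr => t _; rewrite /= e.
Qed.

Lemma malg_scalerAr (K : fieldType) (M : monomType) (a : K)
    (x y : {malg K[M]}) : a *: (x * y) = x * (a *: y).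
Proof.
apply/malgP => k.
transitivity (a * (x * y)@_k); first exact: mcoeffZ.
rewrite mcoeffMl (mcoeffMlw k (fsubset_refl (msupp x)) (msuppZ_le a y)).
rewrite mulr_sumr; apply: eq_bigr => k1 _; rewrite mulr_sumr.
by apply: eq_bigr => k2 _; rewrite mcoeffZ mulrnAr mulrCA.
Qed.

(* The basis {L_n, W_n, C} of the Lie algebra W(2,2), i.e. {malg K[gen]}. *)
Inductive gen := L_ of int | W_ of int | C_.

Definition gen_code (g : gen) : int + int + unit :=
  match g with L_ n => inl (inl n) | W_ n => inl (inr n) | C_ => inr tt end.
Definition gen_decode (s : int + int + unit) : gen :=
  match s with inl (inl n) => L_ n | inl (inr n) => W_ n | inr _ => C_ end.
Lemma gen_codeK : cancel gen_code gen_decode. Proof. by case. Qed.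
HB.instance Definition _ := Choice.copy gen (can_type gen_codeK).

Section W22.
Variable K : fieldType.

Definition cocycle (n m : int) : K :=
  if n == - m then (n ^+ 3 - n)%:~R / 12%:R else 0.

Definition bracket (x y : gen) : {malg K[gen]} :=
  match x, y with
  | L_ n, L_ m =>
      << (n - m)%:~R *g L_ (n + m) >> + << cocycle n m *g C_ >>
  | L_ n, W_ m =>
      << (n - m)%:~R *g W_ (n + m) >> + << cocycle n m *g C_ >>
  | W_ m, L_ n =>
      - (<< (n - m)%:~R *g W_ (n + m) >> + << cocycle n m *g C_ >>)
  | _, _ => 0
  end.

(* A W(2,2)-module: [act g] is the action of the basis element g.  The action
   of a general element is the linear extension in g, so the module axiom is
   only required on pairs of basis elements. *)
Record wmodule := WModule {
  wcarrier :> lmodType K;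
  act : gen -> wcarrier -> wcarrier;
  act_linear : forall g, linear (act g);
  act_bracket : forall x y v,
    act x (act y v) - act y (act x v) = lext (act^~ v) (bracket x y)
}.

HB.instance Definition _ (V : wmodule) (g : gen) :=
  GRing.isLinear.Build K V V _ (@act V g) (@act_linear V g).

Section Submodules.
Variable V : wmodule.

Definition submodule (N : set V) : Prop :=
  subspace N /\ forall g x, N x -> N (act g x).

Lemma smallest_submodule (S : set V) : submodule (smallest submodule S).
Proof.
split=> [|g x Nx N [sN SN]]; first by apply: smallest_subspace => N [].
by apply: sN.2; apply: Nx.
Qed.

Lemma setT_submodule : submodule setT. Proof. by []. Qed.

(* N, as a module, is irreducible. *)
Definition irreducible_in (N : set V) : Prop :=
  [/\ submodule N, exists2 x, N x & x != 0 &
    forall N', submodule N' -> N' `<=` N -> N' = [set 0] \/ N' = N].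

Definition irreducible : Prop := irreducible_in setT.

Definition weight_space (lam : K) : set V := [set x | act (L_ 0) x = lam *: x].

(* The weight subspaces of N are its subspaces N `&` weight_space lam that are
   not zero; all of them are required to be infinite-dimensional. *)
Definition infinite_dim_weights (N : set V) : Prop :=
  forall lam, (exists2 x, (N `&` weight_space lam) x & x != 0) ->
  ~ finite_dim (N `&` weight_space lam).

Definition singular (x : V) : Prop :=
  [/\ x != 0, exists lam, weight_space lam x &
    forall n : nat, (0 < n)%N -> act (L_ n) x = 0 /\ act (W_ n) x = 0].

End Submodules.

Section QuotientModule.
Variables (V : wmodule) (N : set V) (sN : submodule N).

Definition qact (g : gen) : quotV sN.1 -> quotV sN.1 :=
  liftV (fun x => projV sN.1 (act g x)).

Let qact_lin g : linear (fun x => projV sN.1 (act g x)).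
Proof. by move=> a x y; rewrite !linearP. Qed.

Let qact_0 g x : N x -> projV sN.1 (act g x) = 0.
Proof. by move=> Nx; apply/projV0/sN.2. Qed.

Lemma qactE g x : qact g (projV sN.1 x) = projV sN.1 (act g x).
Proof. by rewrite /qact liftVE //; exact: qact_0. Qed.

Fact qact_linear g : linear (qact g).
Proof. by apply: liftV_is_linear => //; exact: qact_0. Qed.

Fact qact_bracket x y v :
  qact x (qact y v) - qact y (qact x v) = lext (qact^~ v) (bracket x y).
Proof.
rewrite -[v]projVK !qactE -linearB /= act_bracket /lext linear_sum /=.
by apply: eq_bigr => t _; rewrite linearZ_LR /= qactE.
Qed.

Definition quot_module : wmodule := WModule qact_linear qact_bracket.

Definition proj (x : V) : quot_module := projV sN.1 x.

Definition sact (g : gen) (x : subV sN.1) : subV sN.1 :=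
  insubd x (act g (inclV x)).

Lemma sactE g x : inclV (sact g x) = act g (inclV x).
Proof. by rewrite /inclV insubdK //; apply/asboolP/sN.2; exact: inclVP. Qed.

Fact sact_linear g : linear (sact g).
Proof.
move=> a x y; apply: inclV_inj.
by rewrite sactE !linearP /= !sactE.
Qed.

Fact sact_bracket x y v :
  sact x (sact y v) - sact y (sact x v) = lext (sact^~ v) (bracket x y).
Proof.
apply: inclV_inj; rewrite linearB /= !sactE act_bracket /lext linear_sum /=.
by apply: eq_bigr => t _; rewrite linearZ_LR /= sactE.
Qed.

Definition sub_module : wmodule := WModule sact_linear sact_bracket.

End QuotientModule.

(* V / U(L)S; with V the left regular module [U] below, U(L)S is the left ideal
   generated by S. *)
Definition quot_generated (V : wmodule) (S : set V) : wmodule :=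
  quot_module (smallest_submodule S).

End W22.

Arguments act {K w} _ _.

Section Enveloping.
Variable K : fieldType.

(* The free associative algebra on gen. *)
Local Notation free_alg := {malg K[{fmonom gen}]}.

Definition fX (g : gen) : free_alg := << fmu g >>.

Lemma free_scalerAr (a : K) (x y : free_alg) : a *: (x * y) = x * (a *: y).
Proof. exact: malg_scalerAr. Qed.

Definition two_sided_ideal (J : set free_alg) : Prop :=
  subspace J /\ forall a x, J x -> J (a * x) /\ J (x * a).

Definition bracket_ideal : set free_alg := smallest two_sided_ideal
  [set r | exists x y, r = fX x * fX y - fX y * fX x - lext fX (bracket K x y)].

Lemma bracket_ideal_subspace : subspace bracket_ideal.
Proof. by apply: smallest_subspace => J []. Qed.

Lemma bracket_ideal_ideal : two_sided_ideal bracket_ideal.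
Proof.
split=> [|a x Jx]; first exact: bracket_ideal_subspace.
by split=> J [idJ SJ]; have [] := idJ.2 a x (Jx J (conj idJ SJ)).
Qed.

Definition U_carrier := quotV bracket_ideal_subspace.
HB.instance Definition _ := GRing.Lmodule.on U_carrier.

Definition U_act (g : gen) : U_carrier -> U_carrier :=
  liftV (fun a => projV bracket_ideal_subspace (fX g * a)).

Let U_act_lin g : linear (fun a => projV bracket_ideal_subspace (fX g * a)).
Proof.
by move=> a x y; rewrite mulrDr -free_scalerAr (projV_is_linear _).
Qed.

Let U_act_0 g x : bracket_ideal x ->
  projV bracket_ideal_subspace (fX g * x) = 0.
Proof.
by move=> Jx; apply: (projV0 _ _).2; exact: (bracket_ideal_ideal.2 _ _ Jx).1.
Qed.

Lemma U_actE g x : U_act g (projV bracket_ideal_subspace x) =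
  projV bracket_ideal_subspace (fX g * x).
Proof. exact: (liftVE _ (U_act_lin g) (@U_act_0 g)). Qed.

Fact U_act_linear g : linear (U_act g).
Proof. exact: (liftV_is_linear (U_act_lin g) (@U_act_0 g)). Qed.

Fact U_act_bracket x y v :
  U_act x (U_act y v) - U_act y (U_act x v) =
  lext (U_act^~ v) (bracket K x y).
Proof.
rewrite -[v]projVK; move: (repr v) => w; rewrite !U_actE -projVB.
transitivity (projV bracket_ideal_subspace (lext fX (bracket K x y) * w)).
  apply: (projV_eq _ _ _).2.
  have E (A : pzRingType) (a b d e : A) :
    a * (b * e) - b * (a * e) - d * e = (a * b - b * a - d) * e.
    by rewrite !mulrBl !mulrA.
  rewrite E; apply: (bracket_ideal_ideal.2 w _ _).2 => //.
  by move=> J [idJ]; apply; exists x, y.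
rewrite /lext mulr_suml linear_sum /=; apply: eq_bigr => t _.
by rewrite -scalerAl linearZ_LR /= U_actE.
Qed.

(* The universal enveloping algebra, as the left regular module: the free
   algebra modulo the two-sided ideal generated by xy - yx - [x, y]. *)
Definition U : wmodule K := WModule U_act_linear U_act_bracket.

Definition U_one : U := projV bracket_ideal_subspace 1.

Definition U_gen (g : gen) : U := projV bracket_ideal_subspace (fX g).

Section Verma.
Variables c h hW : K.

Definition verma_relations : set U := [set x |
  [\/ exists2 n : nat, (0 < n)%N & x = U_gen (L_ n) \/ x = U_gen (W_ n),
      x = U_gen C_ - c *: U_one, x = U_gen (L_ 0) - h *: U_one |
      x = U_gen (W_ 0) - hW *: U_one]].

Definition verma : wmodule K := quot_generated verma_relations.

Definition verma_vector : verma := proj (smallest_submodule _) U_one.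

End Verma.
End Enveloping.

Section IrreducibleQuotient.
Variables (K : fieldType) (V : wmodule K).

(* The kernel of the irreducible quotient of V.  It is picked by choice, and is
   meant for V having exactly one irreducible quotient, such as the Verma
   modules; [setT] is a dummy value. *)
Definition irreducible_kernel : {N : set V | submodule N} :=
  match pselect (exists N : {N : set V | submodule N},
                   irreducible (quot_module (svalP N))) with
  | left exN => sval (cid exN)
  | right _ => exist _ setT (setT_submodule V)
  end.

Definition irreducible_quotient : wmodule K :=
  quot_module (svalP irreducible_kernel).

End IrreducibleQuotient.

Section PBW.
Variables (K : fieldType) (c h hW : K).
Local Notation V := (verma c h hW).
Local Notation v := (verma_vector c h hW).

Definition is_partition (s : seq nat) : bool :=
  sorted geq s && all (leq 1) s.

(* i = ([:: m_s; ..; m_1], [:: n_t; ..; n_1]), both weakly decreasing, encodes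
   W_{-m_s} .. W_{-m_1} L_{-n_t} .. L_{-n_1} v, whose W-degree is size i.1. *)
Definition pbw (i : seq nat * seq nat) : V :=
  foldr (fun m : nat => act (W_ (- m%:Z)))
    (foldr (fun n : nat => act (L_ (- n%:Z))) v i.2) i.1.

(* y is the lowest nonzero component of x for the W-degree, in the PBW
   coordinates a of x.  No y is related to x = 0. *)
Definition is_lowest_component (x y : V) : Prop :=
  exists (a : {malg K[(seq nat * seq nat)%type]}) (s : nat),
  [/\ forall i, i \in msupp a -> is_partition i.1 && is_partition i.2,
      x = \sum_(i <- msupp a) a@_i *: pbw i,
      forall i, i \in msupp a -> (s <= size i.1)%N,
      exists2 i, i \in msupp a & size i.1 = s &
      y = \sum_(i <- msupp a | size i.1 == s) a@_i *: pbw i].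

Definition W_span : set V :=
  span [set pbw (ms, [::]) | ms in [set ms | is_partition ms]].

Definition critical (p : nat) : Prop :=
  (0 < p)%N /\ 2%:R * hW + (p%:R ^+ 2 - 1) / 12%:R * c = 0.

Definition is_u' (p : nat) (u' : V) : Prop :=
  [/\ singular u', weight_space (h + p%:R) u', W_span u' &
      is_lowest_component u' (act (W_ (- p%:Z)) v)].

(* subsingular with respect to L'(c, h, h_W) = V / U(L)u' *)
Definition subsingular (u' u : V) : Prop :=
  (exists lam, weight_space lam u) /\
  singular (proj (smallest_submodule [set u']) u).

End PBW.

Section Intermediate.
Variable K : fieldType.

Definition interm_basis (alpha beta : K) (g : gen) (m : int) : {malg K[int]} :=
  match g with
  | L_ n => << - (m%:~R + alpha + beta + n%:~R * beta) *g (m + n)%R >>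
  | _ => 0
  end.

Definition interm_act alpha beta g : {malg K[int]} -> {malg K[int]} :=
  lext (interm_basis alpha beta g).

Fact interm_act_linear alpha beta g : linear (interm_act alpha beta g).
Proof. exact: lext_is_linear. Qed.

Lemma interm_actU alpha beta g m :
  interm_act alpha beta g << m >> = interm_basis alpha beta g m.
Proof. exact: lextU. Qed.

Fact interm_act_bracket alpha beta x y v :
  interm_act alpha beta x (interm_act alpha beta y v) -
  interm_act alpha beta y (interm_act alpha beta x v) =
  lext ((interm_act alpha beta)^~ v) (bracket K x y).
Proof.
have := interm_act_linear alpha beta; have := @interm_actU alpha beta.
move: (interm_act alpha beta) => A AU lA.
have A0 g : A g 0 = 0 by have := lA g (-1) 0 0; rewrite !scaleN1r !oppr0 addNr addr0.
have AZ g a u : A g (a *: u) = a *: A g u.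
  by have := lA g a u 0; rewrite !addr0 A0 addr0.
have AUz g a m : A g << a *g m >> = a *: interm_basis alpha beta g m.
  by rewrite malgU_scale AZ AU.
apply: (@malg_linear_eq K int {malg K[int]}
  (fun v => A x (A y v) - A y (A x v))
  (fun v => lext (A^~ v) (bracket K x y))) v => [a u w||m].
- by rewrite !lA scalerBr opprD addrACA.
- by apply: lext_pointwise_linear => g; exact: lA.
have B a g : lext (A^~ << m >>) << a *g g >> = a *: interm_basis alpha beta g m.
  by rewrite lextUz AU.
rewrite !AU; case: x y => [n|n|] [k|k|];
  rewrite /bracket /interm_basis -/(interm_basis _ _) ?A0 ?subrr ?linear0 //.
- rewrite [RHS]linearD /= !B scaler0 addr0 !AUz /interm_basis.
  have C (a b : K) (t : int) :
    a *: << b *g t >> = (a * b) *: << t >> :> {malg K[int]}.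
    by rewrite (malgU_scale b) scalerA.
  rewrite (C _ _ (m + k + n)) (C _ _ (m + n + k)) (C _ _ (m + (n + k))).
  rewrite (_ : m + k + n = m + (n + k)); last by rewrite addrAC addrA.
  rewrite (_ : m + n + k = m + (n + k)); last by rewrite addrA.
  rewrite -scalerBl; congr (_ *: _); rewrite !(intrD, intrB).
  ring.
- by rewrite [RHS]linearD /= !B !scaler0 addr0 AUz scaler0 subrr.
- by rewrite AUz scaler0 subrr.
- by rewrite [RHS]linearN [X in _ = - X]linearD /= !B AUz !scaler0 !addr0 oppr0.
- by rewrite AUz scaler0 addr0.
Qed.

Definition interm alpha beta : wmodule K :=
  WModule (interm_act_linear alpha beta) (interm_act_bracket alpha beta).

Definition interm0_sub : set (interm 0 0) := [set a *: << 0 >> | a in setT].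

Lemma interm0_submodule : submodule interm0_sub.
Proof.
split; [split; first by exists 0; rewrite ?scale0r|].
  move=> a _ _ [b _ <-] [d _ <-]; exists (a * b + d) => //.
  by rewrite scalerDl scalerA.
move=> g _ [a _ <-]; exists 0 => //; rewrite scale0r linearZ_LR /=.
rewrite /interm_act lextU; case: g => [n|n|] /=; rewrite ?scaler0 //.
by rewrite !addr0 mulr0 addr0 oppr0 monalgU0 scaler0.
Qed.

Definition interm1_sub : set (interm 0 1) :=
  [set x | (x : {malg K[int]})@_(-1) = 0].

Lemma interm1_submodule : submodule interm1_sub.
Proof.
split.
  split; first exact: mcoeff0.
  move=> a x y; rewrite /interm1_sub /= => hx hy.
  by rewrite mcoeffD mcoeffZ hx hy mulr0 addr0.
move=> g x _; rewrite /interm1_sub /= /interm_act /lext raddf_sum big1 // => m _.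
transitivity ((x : {malg K[int]})@_m * (interm_basis 0 1 g m)@_(-1)).
  exact: mcoeffZ.
case: g => [n|n|] /=; rewrite ?mcoeff0 ?mulr0 //.
rewrite mcoeffU; case: eqP => [e|_]; last by rewrite mulr0.
have -> : - (m%:~R + 0 + 1 + n%:~R * 1) = 0 :> K.
  by rewrite addr0 mulr1 addrAC -intrD e mulrN1z addNr oppr0.
by rewrite mul0rn mulr0.
Qed.

(* For alpha an integer, V_{alpha,beta,0} is isomorphic to V_{0,beta,0} by a
   shift of indices, and alpha is first normalized to 0. *)
Definition interm' (alpha beta : K) : wmodule K :=
  let a := if `[< exists k : int, alpha = k%:~R >] then 0 else alpha in
  if (a == 0) && (beta == 0) then quot_module interm0_submodule
  else if (a == 0) && (beta == 1) then sub_module interm1_submodule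
  else interm a beta.

End Intermediate.

Section Tensor.
Variables (K : fieldType) (A B : wmodule K).

Local Notation free := {malg K[(A * B)%type]}.

Definition tensor_relations : set free := [set r |
  (exists a x x' y, r = << (a *: x + x', y) >> - a *: << (x, y) >> - << (x', y) >>)
  \/
  (exists a x y y', r = << (x, a *: y + y') >> - a *: << (x, y) >> - << (x, y') >>)].

Lemma tensor_subspace : subspace (span tensor_relations).
Proof. exact: span_subspace. Qed.

Definition tensor_carrier := quotV tensor_subspace.
HB.instance Definition _ := GRing.Lmodule.on tensor_carrier.

Definition pure (x : A) (y : B) : tensor_carrier :=
  projV tensor_subspace << (x, y) >>.

Let pi_comb a (r s t : free) : projV tensor_subspace (r - a *: s - t) =
  projV tensor_subspace r - a *: projV tensor_subspace s
    - projV tensor_subspace t.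
Proof. by rewrite !linearB linearZ. Qed.

Lemma pure_linear_l y : linear (pure^~ y).
Proof.
move=> a x x'; apply: subr0_eq; rewrite /= opprD addrA -pi_comb.
by apply: (projV0 _ _).2 => N [_]; apply; left; exists a, x, x', y.
Qed.

Lemma pure_linear_r x : linear (pure x).
Proof.
move=> a y y'; apply: subr0_eq; rewrite /= opprD addrA -pi_comb.
by apply: (projV0 _ _).2 => N [_]; apply; right; exists a, x, y, y'.
Qed.

(* The values are taken in the quotient, and the map is then shown to factor
   through it. *)
Definition tensor_free_act (g : gen) : free -> tensor_carrier :=
  lext (fun p => pure (act g p.1) p.2 + pure p.1 (act g p.2)).

Let tfa_lin g : linear (tensor_free_act g).
Proof. exact: lext_is_linear. Qed.

Let tfa_comb g a (r s t : free) : tensor_free_act g (r - a *: s - t) =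
  tensor_free_act g r - a *: tensor_free_act g s - tensor_free_act g t.
Proof. by rewrite /tensor_free_act !linearB linearZ. Qed.

Let tfaU g x y :
  tensor_free_act g << (x, y) >> = pure (act g x) y + pure x (act g y).
Proof. by rewrite /tensor_free_act lextU. Qed.

Let addr_comb (M : lmodType K) a (p q r s : M) :
  (a *: p + q) + (a *: r + s) - a *: (p + r) - (q + s) = 0.
Proof.
by rewrite scalerDr (addrACA (a *: p)) -[_ + _ - _ - _]addrA -opprD subrr.
Qed.

Let swap_comb (M : zmodType) (p q r s p' s' : M) :
  p' + s + (r + q) - (p + r + (s + s')) = p' - p + (q - s').
Proof.
rewrite (addrC r q) (addrACA p') (addrC s s') (addrACA p) (addrC r s).
by rewrite opprD (addrACA (p' + q)) subrr addr0 opprD addrACA.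
Qed.

Let tfa0 g z : span tensor_relations z -> tensor_free_act g z = 0.
Proof.
move=> Sz; apply: (Sz [set z | tensor_free_act g z = 0]); split.
  split=> [|a x y /= hx hy]; first by rewrite /= /tensor_free_act linear0.
  by rewrite tfa_lin hx hy scaler0 addr0.
move=> r [[a [x [x' [y rE]]]]|[a [x [y [y' rE]]]]].
  transitivity (tensor_free_act g r) => //.
  rewrite rE tfa_comb.
  rewrite 3!tfaU.
  rewrite act_linear.
  by rewrite !pure_linear_l addr_comb.
transitivity (tensor_free_act g r) => //.
rewrite rE tfa_comb 3!tfaU act_linear.
by rewrite !pure_linear_r addr_comb.
Qed.

Definition tensor_act (g : gen) : tensor_carrier -> tensor_carrier :=
  liftV (tensor_free_act g).

Lemma tensor_actE g x y :
  tensor_act g (pure x y) = pure (act g x) y + pure x (act g y).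
Proof.
rewrite -tfaU; exact: (liftVE tensor_subspace (tfa_lin g) (@tfa0 g)).
Qed.

Fact tensor_act_linear g : linear (tensor_act g).
Proof. exact: (liftV_is_linear (tfa_lin g) (@tfa0 g)). Qed.

Fact tensor_act_bracket x y v :
  tensor_act x (tensor_act y v) - tensor_act y (tensor_act x v) =
  lext (tensor_act^~ v) (bracket K x y).
Proof.
have TD g u w : tensor_act g (u + w) = tensor_act g u + tensor_act g w.
  by have := tensor_act_linear g 1 u w; rewrite !scale1r.
have pl := projV_is_linear tensor_subspace.
rewrite -[v]projVK; move: (repr v) => w.
apply: (@malg_linear_eq K _ tensor_carrier
  (fun w => tensor_act x (tensor_act y (projV tensor_subspace w)) -
            tensor_act y (tensor_act x (projV tensor_subspace w)))
  (fun w => lext (tensor_act^~ (projV tensor_subspace w)) (bracket K x y))) w.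
- by move=> a r s; rewrite !(pl, tensor_act_linear) scalerBr opprD addrACA.
- apply: lext_pointwise_linear => g a r s.
  by rewrite pl tensor_act_linear.
case=> a b; rewrite -/(pure a b) !tensor_actE !TD !tensor_actE.
transitivity (pure (lext (act^~ a) (bracket K x y)) b
              + pure a (lext (act^~ b) (bracket K x y))).
  rewrite -!act_bracket.
  have lB u u' : pure (u - u') b = pure u b - pure u' b.
    by rewrite -scaleN1r addrC pure_linear_l scaleN1r addrC.
  have rB u u' : pure a (u - u') = pure a u - pure a u'.
    by rewrite -scaleN1r addrC pure_linear_r scaleN1r addrC.
  rewrite lB rB; move: (pure _ _) (pure _ _) (pure _ _) (pure _ _) (pure _ _).
  move=> p q r s p'; move: (pure _ _) => s'.
  exact: swap_comb.
apply: (@malg_linear_eq K gen tensor_carrier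
  (fun e => pure (lext (act^~ a) e) b + pure a (lext (act^~ b) e))
  (lext (tensor_act^~ (pure a b)))).
- move=> k r s; rewrite !lext_is_linear pure_linear_l pure_linear_r.
  by rewrite scalerDr addrACA.
- exact: lext_is_linear.
by move=> t; rewrite !lextU tensor_actE.
Qed.

Definition tensor : wmodule K := WModule tensor_act_linear tensor_act_bracket.

End Tensor.

(* Main.v *)
From HB Require Import structures.
Require Import Defs.
From mathcomp Require Import all_boot all_order all_algebra.
From mathcomp Require Import finmap.
From mathcomp.multinomials Require Import monalg.
From mathcomp Require Import boolp classical_sets reals.
From mathcomp Require Import complex.
From mathcomp Require Import ring zify.

(** Let e_m be the basis of V'_(alpha, beta, 0), let v be the highest weight
    vector of the irreducible quotient L = L(c, h, h_W), and let E_j be the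
    submodule of the tensor product generated by the e_i (x) v with i >= j.

    Every nonzero submodule contains E_j for j large ([nonzero_submodule]). In
    fact, for n fixed and large the products L_(n-k) L_k kill the right factors
    of a given tensor and act on its component of index m by a scalar that is
    quadratic in k; differences of these scalars separate the components. So
    there is an irreducible submodule if and only if the chain of the E_j is
    stationary, and then its limit is the only one. Its weight spaces are
    infinite-dimensional because they contain vectors e_(d+n) (x) W_(-n) v for all
    n large.

    If u is subsingular with lowest component L_(-p)^r v, it vanishes in L, where
    L_(-p)^r v becomes a combination of words that start with a W. As W acts
    by 0 on the left factor, such words lie deeper in the chain, and
    e_j (x) v is in E_(j+1) for j large ([chain_stationary]).

    If there is no such u, then the kernel of the map from the Verma module V to L
    is zero or generated by u' ([radical_dichotomy]). The space U(L_-)(e_i (x) v)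
    is the image of a map from V, which kills u', as u' is made of words in the W and
    vanishes in L. Looking at the component of highest index in a sum of such
    vectors shows that e_j (x) v is never in E_(j+1) ([chain_strict]).

    The dichotomy rests on coordinates in the PBW basis ([straightenB]) and on
    leading terms. Order the monomials by increasing W-degree, then by decreasing
    L-degree. To leading order L_n is a derivation in the letter W_(-n) and W_n is
    a derivation in the letter L_(-n) ([posL_lead], [posW_lead]), both with the
    coefficient n (2 h_W + (n^2 - 1) c / 12), which vanishes exactly when n is
    critical. Leading monomials of elements of U(L) u' are those that contain
    W_(-p). An element of the kernel of minimal weight outside of U(L) u', reduced
    modulo U(L) u', is sent to U(L) u' by the positive letters; the two
    derivations show that its leading monomial has no W and no L other than
    L_(-p) ([minimal_weight]). *)

Set Implicit Arguments.
Unset Strict Implicit.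
Unset Printing Implicit Defensive.

Import Order.TTheory GRing.Theory Num.Theory.
Local Open Scope classical_set_scope.
Local Open Scope ring_scope.

(** * Straightening of words *)

(** The order of the letters in a PBW word: W_(-), L_(-), L_(>=0), W_(>=0), C,
    and increasing indices inside each class. *)
Definition gclass (g : gen) : nat :=
  match g with
  | W_ n => if n < 0 then 0%N else 3%N
  | L_ n => if n < 0 then 1%N else 2%N
  | C_ => 4%N
  end.

Definition gindex (g : gen) : int :=
  match g with W_ n | L_ n => n | C_ => 0 end.

Definition gle (x y : gen) : bool :=
  (gclass x < gclass y)%N || ((gclass x == gclass y) && (gindex x <= gindex y)).

Lemma gle_total : total gle.
Proof.
move=> x y; rewrite /gle [gclass y == _]eq_sym.
by case: ltngtP => //= _; exact: le_total.
Qed.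

Lemma gle_trans : transitive gle.
Proof.
move=> y x z /orP[xy|/andP[/eqP exy xy]] /orP[yz|/andP[/eqP eyz yz]]; rewrite /gle.
- by rewrite (ltn_trans xy yz).
- by rewrite -eyz xy.
- by rewrite exy yz.
- by rewrite exy eyz eqxx (le_trans xy yz) orbT.
Qed.

Lemma gle_anti : antisymmetric gle.
Proof.
move=> x y /andP[]; rewrite /gle [gclass y == _]eq_sym.
case: ltngtP => //= e xy yx.
have exy : gindex x = gindex y by apply/le_anti; rewrite xy yx.
case: x y e exy {xy yx} => [n|n|] [m|m|] //=; try by move=> _ ->.
all: by do !case: ifP.
Qed.

Lemma gleNtotal x y : ~~ gle x y -> gle y x.
Proof. by move=> nxy; have := gle_total x y; rewrite (negPf nxy). Qed.

Fixpoint inversions (w : seq gen) : nat :=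
  if w is x :: w' then (count (fun y => ~~ gle x y) w' + inversions w')%N else 0%N.

Lemma inversions_swap a x y b : ~~ gle x y ->
  inversions (a ++ x :: y :: b) = (inversions (a ++ y :: x :: b)).+1.
Proof.
move=> nxy; elim: a => [|z a IH] /=.
  by rewrite nxy (gleNtotal nxy) /=; lia.
by rewrite IH !count_cat /=; lia.
Qed.

Lemma inversions_le w : (inversions w <= size w ^ 2)%N.
Proof.
elim: w => //= x w IH; have := count_size (fun y => ~~ gle x y) w.
move: (inversions w) (count _ _) (size w) IH => i k n; nia.
Qed.

(** Exchanging a descent removes an inversion and replacing two letters by one
    shortens the word; the cube absorbs the inversions, which are at most
    quadratic in the length. *)
Definition wmeasure (w : seq gen) : nat := (size w ^ 3 + inversions w)%N.

Lemma wmeasure_swap a x y b : ~~ gle x y ->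
  (wmeasure (a ++ y :: x :: b) < wmeasure (a ++ x :: y :: b))%N.
Proof. by move=> nxy; rewrite /wmeasure (inversions_swap _ _ nxy) !size_cat /=; lia. Qed.

Lemma wmeasure_size w w' : (size w < size w')%N -> (1 < size w')%N ->
  (wmeasure w < wmeasure w')%N.
Proof.
move=> ww' w2; rewrite /wmeasure; have := inversions_le w.
move: (inversions w) (inversions w') (size w) (size w') ww' w2 => i j n m.
rewrite !expnS !expn0 !muln1 => nm _ i_le.
have m3 : (n.+1 * (n.+1 * n.+1) <= m * (m * m))%N by rewrite !leq_mul.
by nia.
Qed.

Lemma wmeasure_bracket a x y b g :
  (wmeasure (a ++ g :: b) < wmeasure (a ++ x :: y :: b))%N.
Proof. by apply: wmeasure_size; rewrite ?size_cat /= ?size_cat /=; lia. Qed.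

Fixpoint first_descent (w : seq gen) : option (seq gen * gen * gen * seq gen) :=
  match w with
  | x :: w' =>
    if w' is y :: b then
      if gle x y then
        omap (fun d => (x :: d.1.1.1, d.1.1.2, d.1.2, d.2)) (first_descent w')
      else Some ([::], x, y, b)
    else None
  | [::] => None
  end.

Lemma first_descentP w a x y b : first_descent w = Some (a, x, y, b) ->
  w = a ++ x :: y :: b /\ ~~ gle x y.
Proof.
elim: w a x y b => //= z [//|z' w] IH a x y b.
case: ifP => [_|/negbT nzz [<- <- <- <-] //].
case E: (first_descent _) => [[[[a' x'] y'] b']|//] [<- <- <- <-] /=.
by have [-> ?] := IH _ _ _ _ E.
Qed.

Lemma first_descent_sorted w : (first_descent w == None) = sorted gle w.
Proof.
elim: w => // z [//|z' w] IH; rewrite [RHS]/= -/(sorted gle (z' :: w)) -IH.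
rewrite [first_descent (z :: _)]/= -/(first_descent (z' :: w)).
by case: (gle z z') => //; case: (first_descent _).
Qed.

(** The cases of the diamond lemma: a descent of a word against the first one. *)
Lemma first_descent_cmp a x y b a' x' y' b' : ~~ gle x y ->
  first_descent (a ++ x :: y :: b) = Some (a', x', y', b') ->
  [\/ [/\ a' = a, x' = x, y' = y & b' = b],
      [/\ a = rcons a' x', y' = x & b' = y :: b] |
      exists2 c, a = a' ++ x' :: y' :: c & b' = c ++ x :: y :: b].
Proof.
move=> nxy; elim: a a' x' y' b' => [|z a IH] a' x' y' b'.
  by rewrite /= (negPf nxy) => -[<- <- <- <-]; constructor 1.
case: a IH => [|z' a] IH.
  rewrite [first_descent _]/= (negPf nxy); case: ifP => _ /= [<- <- <- <-].
    by constructor 1.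
  by constructor 2.
have fdE u v s : first_descent (u :: v :: s) = if gle u v then
    omap (fun d => (u :: d.1.1.1, d.1.1.2, d.1.2, d.2)) (first_descent (v :: s))
    else Some ([::], u, v, s) by [].
rewrite !cat_cons fdE -cat_cons; case: ifP => _.
  case E: (first_descent _) => [[[[a1 x1] y1] b1]|//] [<- <- <- <-] /=.
  case: (IH _ _ _ _ E) => [[-> -> -> ->]|[-> -> ->]|[c -> ->]].
  - by constructor 1.
  - by constructor 2.
  - by constructor 3; exists c.
by move=> [<- <- <- <-]; constructor 3; exists a.
Qed.

(** Induction along the straightening of a word, where the descent to resolve
    is left to the caller. *)
Lemma word_ind (P : seq gen -> Prop) :
  (forall w, sorted gle w -> P w) ->
  (forall a x y b, ~~ gle x y -> P (a ++ y :: x :: b) ->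
    (forall g, P (a ++ g :: b)) -> P (a ++ x :: y :: b)) ->
  forall w, P w.
Proof.
move=> Ps Pd w; have [n] := ubnP (wmeasure w); elim: n w => // n IH w le_wn.
case: (boolP (sorted gle w)) => [/Ps //|].
rewrite -first_descent_sorted.
case E: (first_descent w) => [[[[a x] y] b]|//] _.
have [ew nxy] := first_descentP E; rewrite ew ltnS in le_wn *.
apply: Pd => // [|g]; apply: IH; apply: leq_trans _ le_wn.
  exact: wmeasure_swap.
exact: wmeasure_bracket.
Qed.

Section Bracket.
Variable K : fieldType.

(** The value at [x, y] of the linear extension of F. Unlike [bracket], it has
    the same form for (L, W) and (W, L), so that antisymmetry and the Jacobi
    identity are identities between integers. *)
Definition bracketL (V : lmodType K) (F : gen -> V) (x y : gen) : V :=
  match x, y with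
  | L_ n, L_ m => (n - m)%:~R *: F (L_ (n + m)) + cocycle K n m *: F C_
  | L_ n, W_ m => (n - m)%:~R *: F (W_ (n + m)) + cocycle K n m *: F C_
  | W_ n, L_ m => (n - m)%:~R *: F (W_ (n + m)) + cocycle K n m *: F C_
  | _, _ => 0
  end.

Lemma cocycleC n m : cocycle K m n = - cocycle K n m.
Proof.
rewrite /cocycle; have -> : (m == - n) = (n == - m) by apply/eqP/eqP; lia.
case: eqP => [->|_]; last by rewrite oppr0.
by rewrite -mulNr -intrN; congr (_%:~R / _); ring.
Qed.

Lemma lext_bracket (V : lmodType K) (F : gen -> V) x y :
  lext F (bracket K x y) = bracketL F x y.
Proof.
case: x y => [n|n|] [m|m|]; rewrite /bracket /bracketL; try exact: linear0.
- by rewrite linearD /= !lextUz.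
- by rewrite linearD /= !lextUz.
rewrite linearN linearD /= !lextUz [m + n]addrC (cocycleC n m).
by rewrite -(opprB n m) mulrNz !scaleNr opprD !opprK.
Qed.

Lemma bracketL_anti (V : lmodType K) (F : gen -> V) x y :
  bracketL F y x = - bracketL F x y.
Proof.
case: x y => [n|n|] [m|m|]; rewrite /= ?oppr0 //.
all: by rewrite opprD -!scaleNr -cocycleC [m + n]addrC -mulrNz opprB.
Qed.

Lemma bracketLxx (V : lmodType K) (F : gen -> V) x : bracketL F x x = 0.
Proof.
have c0 n : cocycle K n n = 0.
  rewrite /cocycle; case: eqP => // e; have -> : n = 0 by lia.
  by rewrite subrr mul0r.
by case: x => [n|n|] //=; rewrite subrr c0 !scale0r addr0.
Qed.

Lemma bracketL_linear (V V' : lmodType K) (f : {linear V -> V'}) (F : gen -> V) x y :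
  f (bracketL F x y) = bracketL (f \o F) x y.
Proof.
by case: x y => [n|n|] [m|m|]; rewrite /bracketL ?linear0 // linearD !linearZ.
Qed.

(** Away from the central term this is the Jacobi identity of the brackets
    (n - m); the central terms add up because n^3 - n is a cocycle. *)
Lemma jacobi (V : lmodType K) (F : gen -> V) x y z :
  bracketL (bracketL F x) y z + bracketL (bracketL F y) z x
    + bracketL (bracketL F z) x y = 0.
Proof.
have comb (X Y Z c : V) (p q r p' q' r' : K) : X = Z -> Y = Z ->
    p + q + r = 0 -> p' + q' + r' = 0 ->
  p *: X + p' *: c + (q *: Y + q' *: c) + (r *: Z + r' *: c) = 0.
  move=> -> -> e e'; rewrite [X in X + _]addrACA -!scalerDl addrACA -!scalerDl.
  by rewrite e e' !scale0r addr0.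
have condE (n m k a b : int) : a + b = n + m + k -> (a == - b) = (n + m + k == 0).
  by move=> e; apply/eqP/eqP; lia.
case: x y z => [n|n|] [m|m|] [k|k|]; rewrite /bracketL ?scaler0 ?addr0 //.
all: rewrite !scalerDr !scalerA.
all: apply: comb; do ?by congr (F (_ _)); ring.
all: try by ring.
all: rewrite /cocycle !(condE n m k); try by ring.
all: case: eqP => [e|_]; last by rewrite !mulr0 !addr0.
all: have -> : k = - n - m by lia.
all: by move: (12%:R^-1 : K) => t; ring.
Qed.

End Bracket.

Section Straightening.
Variables (K : fieldType) (Z : lmodType K) (psi : seq gen -> Z).

Lemma eq_bracketL (V : lmodType K) (F G : gen -> V) x y :
  F =1 G -> bracketL F x y = bracketL G x y.
Proof. by move=> e; case: x y => [n|n|] [m|m|]; rewrite /bracketL ?e. Qed.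

Lemma bracketLD (V : lmodType K) (F G : gen -> V) x y :
  bracketL (fun g => F g + G g) x y = bracketL F x y + bracketL G x y.
Proof.
case: x y => [n|n|] [m|m|]; rewrite /bracketL ?addr0 //;
by rewrite !scalerDr addrACA.
Qed.

Lemma bracketLN (V : lmodType K) (F : gen -> V) x y :
  bracketL (fun g => - F g) x y = - bracketL F x y.
Proof.
by case: x y => [n|n|] [m|m|]; rewrite /bracketL ?oppr0 // !scalerN opprD.
Qed.

Lemma bracketL_exchange (V : lmodType K) (F : gen -> gen -> V) x1 y1 x2 y2 :
  bracketL (fun g => bracketL (F g) x1 y1) x2 y2 =
  bracketL (fun g' => bracketL (F^~ g') x2 y2) x1 y1.
Proof.
have comb (a b a' b' : K) (p q r s : V) :
    a *: (b *: p + b' *: q) + a' *: (b *: r + b' *: s) =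
    b *: (a *: p + a' *: r) + b' *: (a *: q + a' *: s).
  rewrite !scalerDr !scalerA addrACA.
  by rewrite (mulrC b a) (mulrC b' a) (mulrC b a') (mulrC b' a').
case: x1 y1 x2 y2 => [n|n|] [m|m|] [n'|n'|] [m'|m'|];
  rewrite /bracketL ?scaler0 ?addr0 //; exact: comb.
Qed.

(** [psi] gives the values on sorted words; any other word is rewritten at its
    first descent. *)
Fixpoint straighten_fuel n (w : seq gen) : Z :=
  if n is n'.+1 then
    if first_descent w is Some (a, x, y, b) then
      straighten_fuel n' (a ++ y :: x :: b)
        + bracketL (fun g => straighten_fuel n' (a ++ g :: b)) x y
    else psi w
  else 0.

Lemma straighten_fuelE n m w : (wmeasure w < n)%N -> (wmeasure w < m)%N ->
  straighten_fuel n w = straighten_fuel m w.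
Proof.
elim: n m w => // n IH [//|m] w; rewrite !ltnS => wn wm /=.
case E: (first_descent w) => [[[[a x] y] b]|//].
have [ew nxy] := first_descentP E; rewrite ew in wn wm.
have sw := wmeasure_swap a b nxy.
congr (_ + _); first by apply: IH; apply: leq_trans sw _.
apply: eq_bracketL => g; have sg := wmeasure_bracket a x y b g.
by apply: IH; apply: leq_trans sg _.
Qed.

Definition straighten w := straighten_fuel (wmeasure w).+1 w.

Lemma straighten_sorted w : sorted gle w -> straighten w = psi w.
Proof. by rewrite -first_descent_sorted /straighten /= => /eqP->. Qed.

Lemma straighten_first w a x y b : first_descent w = Some (a, x, y, b) ->
  straighten w = straighten (a ++ y :: x :: b)
                   + bracketL (fun g => straighten (a ++ g :: b)) x y.
Proof.
move=> E; have [ew nxy] := first_descentP E.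
rewrite {1}/straighten [LHS]/= E; congr (_ + _).
  by apply: straighten_fuelE => //; rewrite ew wmeasure_swap.
apply: eq_bracketL => g; apply: straighten_fuelE => //.
by rewrite ew wmeasure_bracket.
Qed.

(** By induction on the measure, against the first descent. Two disjoint
    descents commute because the bracket is bilinear ([bracketL_exchange]); for
    three letters z > x > y the two ways of sorting differ by the three double
    brackets of the Jacobi identity. *)
Lemma straighten_descent a x y b : ~~ gle x y ->
  straighten (a ++ x :: y :: b) = straighten (a ++ y :: x :: b)
    + bracketL (fun g => straighten (a ++ g :: b)) x y.
Proof.
have [n] := ubnP (wmeasure (a ++ x :: y :: b)).
elim: n a x y b => // n IH a x y b; rewrite ltnS => le_n nxy.
have IHg a1 x1 y1 b1 : (wmeasure (a1 ++ x1 :: y1 :: b1) < n)%N ->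
    (wmeasure (a1 ++ y1 :: x1 :: b1) < n)%N ->
  bracketL (fun g => straighten (a1 ++ g :: b1)) x1 y1 =
  straighten (a1 ++ x1 :: y1 :: b1) - straighten (a1 ++ y1 :: x1 :: b1).
  move=> l1 l2; case: (boolP (gle x1 y1)) => [xy|nxy1]; last first.
    by rewrite (IH _ _ _ _ l1) // addrC addKr.
  case: (boolP (gle y1 x1)) => [yx|nyx1].
    have -> : x1 = y1 by apply: gle_anti; rewrite xy.
    by rewrite bracketLxx subrr.
  by rewrite (bracketL_anti _ y1 x1) (IH _ _ _ _ l2) // opprD addrA subrr add0r.
have swn := leq_trans (wmeasure_swap a b nxy) le_n.
have brn g := leq_trans (wmeasure_bracket a x y b g) le_n.
case E: (first_descent (a ++ x :: y :: b)) => [[[[a' x'] y'] b']|]; last first.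
  move/eqP: E; rewrite first_descent_sorted => /cat_sorted2[_ /=].
  by rewrite (negPf nxy).
case: (first_descent_cmp nxy E) => [[ea ex ey eb]|[ea ey eb]|[c ea eb]].
- by rewrite (straighten_first E) ea ex ey eb.
- (* Overlapping descents: the word contains three decreasing letters. *)
  have nzx : ~~ gle x' x by have [_] := first_descentP E; rewrite ey.
  have := straighten_first E; move: le_n swn brn {E}; rewrite {}eb {}ey {}ea !cat_rcons.
  move: a' x' nzx => {a y' b'} a z nzx le_n swn brn e1.
  have nzy : ~~ gle z y.
    by apply: contra nzx => zy; apply: gle_trans zy (gleNtotal nxy).
  have le1 := leq_trans (wmeasure_swap a (y :: b) nzx) le_n.
  have le2 : (wmeasure (a ++ x :: y :: z :: b) < n)%N.
    by have := wmeasure_swap (rcons a x) b nzy; rewrite !cat_rcons => /ltn_trans; apply.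
  have le3 : (wmeasure (a ++ z :: y :: x :: b) < n)%N.
    exact: swn.
  have le4 := ltn_trans (wmeasure_swap a (x :: b) nzy) le3.
  have rc t u v : bracketL (fun g => straighten (rcons a t ++ g :: b)) u v =
      bracketL (fun g => straighten (a ++ t :: g :: b)) u v.
    by apply: eq_bracketL => g; rewrite cat_rcons.
  have e2 := IH (rcons a x) z y b; rewrite !cat_rcons rc in e2.
  have e3 := IH a x y (z :: b) le2 nxy.
  have e4 := IH a z y (x :: b) le3 nzy.
  have e5 := IH (rcons a y) z x b; rewrite !cat_rcons rc in e5.
  rewrite rc e1 (e2 le1 nzy) e3 e4 (e5 le4 nzx).
  pose F k := straighten (a ++ k :: b).
  have small g h : (wmeasure (a ++ g :: h :: b) < n)%N.
    apply: leq_trans le_n; apply: wmeasure_size; rewrite !size_cat /=; lia.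
  have B g h : straighten (a ++ g :: h :: b) =
      straighten (a ++ h :: g :: b) + bracketL F g h.
    by rewrite (IHg _ _ _ _ (small g h) (small h g)) addrC subrK.
  have Bg u v t : bracketL (fun g => straighten (a ++ g :: t :: b)) u v =
      bracketL (fun g => straighten (a ++ t :: g :: b)) u v
        - bracketL (bracketL F t) u v.
    rewrite -bracketLN -bracketLD; apply: eq_bracketL => g.
    by rewrite B bracketL_anti.
  rewrite (Bg z x y) (Bg x y z) (Bg z y x) (bracketL_anti (bracketL F x) y z) opprK.
  have := jacobi F x y z.
  move: (bracketL (bracketL F x) y z) (bracketL (bracketL F y) z x).
  move: (bracketL (bracketL F z) x y) => jz jx jy /eqP.
  rewrite -addrA addr_eq0 => /eqP->; rewrite opprD !addrA.
  by rewrite [RHS](ACl (1*6*5*3*2*4))%AC.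
(* Disjoint descents. *)
have [_ nxy'] := first_descentP E.
have e1 := straighten_first E; move: le_n swn brn e1.
rewrite {}eb {}ea -!catA /= {E} => le_n swn brn e1.
have le1 := leq_trans (wmeasure_swap a' (c ++ x :: y :: b) nxy') le_n.
have cA u v t : bracketL (fun g => straighten ((a' ++ t) ++ g :: b)) u v =
    bracketL (fun g => straighten (a' ++ t ++ g :: b)) u v.
  by apply: eq_bracketL => g; rewrite -catA.
have e2 := IH (a' ++ y' :: x' :: c) x y b; rewrite cA -!catA /= in e2.
have e4 := IH a' x' y' (c ++ y :: x :: b) swn nxy'.
rewrite cA /= e1 (e2 le1 nxy) e4 -!addrA; congr (_ + _).
have e3 g : straighten (a' ++ g :: c ++ x :: y :: b) =
    straighten (a' ++ g :: c ++ y :: x :: b)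
      + bracketL (fun h => straighten (a' ++ g :: c ++ h :: b)) x y.
  have := IH (a' ++ g :: c) x y b; rewrite cA -!catA /=; apply=> //.
  by apply: leq_trans (wmeasure_bracket _ _ _ _ _) le_n.
have e5 h : straighten (a' ++ x' :: y' :: c ++ h :: b) =
    straighten (a' ++ y' :: x' :: c ++ h :: b)
      + bracketL (fun g => straighten (a' ++ g :: c ++ h :: b)) x' y'.
  by apply: IH => //; have := brn h; rewrite -catA.
rewrite (eq_bracketL _ _ e3) (eq_bracketL _ _ e5) !bracketLD.
by rewrite addrCA bracketL_exchange.
Qed.

(** This is the Poincare-Birkhoff-Witt theorem: since the straightening is
    compatible with every commutation relation, a function on sorted words
    extends to the enveloping algebra. *)
Lemma straightenB a x y b :
  straighten (a ++ x :: y :: b) - straighten (a ++ y :: x :: b) =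
  bracketL (fun g => straighten (a ++ g :: b)) x y.
Proof.
case: (boolP (gle x y)) => [xy|nxy]; last first.
  by rewrite (straighten_descent _ _ nxy) addrC addKr.
case: (boolP (gle y x)) => [yx|nyx].
  have -> : x = y by apply: gle_anti; rewrite xy.
  by rewrite bracketLxx subrr.
rewrite (bracketL_anti _ y x) (straighten_descent _ _ nyx).
by rewrite opprD addrA subrr add0r.
Qed.

End Straightening.

(** * Words of negative letters *)

Definition isneg (g : gen) : bool := (gclass g < 2)%N.

Definition wmono (i : seq nat * seq nat) : seq gen :=
  [seq W_ (- m%:Z) | m <- i.1] ++ [seq L_ (- n%:Z) | n <- i.2].

Definition Wpart (g : gen) : option nat :=
  if g is W_ n then (if n < 0 then Some `|n|%N else None) else None.

Definition Lpart (g : gen) : option nat :=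
  if g is L_ n then (if n < 0 then Some `|n|%N else None) else None.

Definition parts (w : seq gen) : seq nat * seq nat := (pmap Wpart w, pmap Lpart w).

Definition is_bipartition (i : seq nat * seq nat) : bool :=
  is_partition i.1 && is_partition i.2.

Lemma neg_letter g : isneg g ->
  exists2 n, (0 < n)%N & g = L_ (- n%:Z) \/ g = W_ (- n%:Z).
Proof.
case: g => [n|n|] //; rewrite /isneg /=; case: ifP => // n0 _;
  exists `|n|%N; try (by lia); [left|right]; congr (_ _); lia.
Qed.

Lemma isneg_L n : (0 < n)%N -> isneg (L_ (- n%:Z)).
Proof. by move=> n0; rewrite /isneg /= ifT //; lia. Qed.
Lemma isneg_W n : (0 < n)%N -> isneg (W_ (- n%:Z)).
Proof. by move=> n0; rewrite /isneg /= ifT //; lia. Qed.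

Lemma parts_wmono i : is_bipartition i -> parts (wmono i) = i.
Proof.
case: i => ms ns; rewrite /is_bipartition /= => /andP[/andP[_ /allP pm] /andP[_ /allP pn]].
rewrite /parts /wmono /=.
rewrite !pmap_cat; congr (_, _).
  have -> : pmap Wpart [seq L_ (- n%:Z) | n <- ns] = [::] by elim: {pn} ns.
  rewrite cats0; elim: ms pm => //= m ms IH pm.
  have m0 := pm m (mem_head _ _); rewrite ifT ?abszN ?absz_id /=; last by lia.
  by congr (_ :: _); apply: IH => x xs; apply: pm; rewrite inE xs orbT.
have -> : pmap Lpart [seq W_ (- n%:Z) | n <- ms] = [::] by elim: {pm} ms.
rewrite cat0s; elim: ns pn => //= m ns IH pn.
have m0 := pn m (mem_head _ _); rewrite ifT ?abszN ?absz_id /=; last by lia.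
by congr (_ :: _); apply: IH => x xs; apply: pn; rewrite inE xs orbT.
Qed.

Lemma wmono_parts w : all isneg w -> sorted gle w -> wmono (parts w) = w.
Proof.
elim: w => //= x w IH /andP[nx nw] xw; have sw := path_sorted xw.
have {IH} := IH nw sw; have /allP xle := order_path_min gle_trans xw.
have [n n0 [ex|ex]] := neg_letter nx; rewrite {x}ex in nx xw xle *; last first.
  move=> e; rewrite -[in RHS]e /wmono /parts /=.
  by rewrite ifT /= ?abszN ?absz_id //; lia.
have noW : pmap Wpart w = [::].
  elim: w xle {xw sw nw} => //= y w IH xle; have := xle y (mem_head _ _).
  rewrite IH => [|z zw]; last by apply: xle; rewrite inE zw orbT.
  case: y {xle} => [m|m|] //=; rewrite /gle /=; case: (ltrP m 0) => // m0.
  by case: ifP => //; lia.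
move=> e; rewrite -[in RHS]e /wmono /parts /= noW /=.
by rewrite ifT /= ?abszN ?absz_id //; lia.
Qed.

Lemma wmono_neg i : is_bipartition i -> all isneg (wmono i).
Proof.
case: i => ms ns; rewrite /is_bipartition /= => /andP[/andP[_ /allP pm] /andP[_ /allP pn]].
rewrite all_cat !all_map; apply/andP; split; apply/allP => n.
  by move=> /pm; exact: isneg_W.
by move=> /pn; exact: isneg_L.
Qed.

Lemma wmono_sorted i : is_bipartition i -> sorted gle (wmono i).
Proof.
case: i => ms ns; rewrite /is_bipartition /is_partition /=.
move=> /andP[/andP[sm /allP pm] /andP[sn /allP pn]].
rewrite /wmono /= (sorted_pairwise gle_trans) pairwise_cat -!(sorted_pairwise gle_trans).
apply/and3P; split.
- apply/allrelP => x y /mapP[m mm ->] /mapP[n nn ->].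
  have := pm m mm; have := pn n nn; rewrite /gle /= => n0 m0.
  by rewrite !ifT //; lia.
- rewrite sorted_map; apply: (@sub_in_sorted _ (leq 1) _ _ _ _ _ sm); last exact/allP.
  move=> a b; rewrite !unfold_in => a0 b0 /= ab; rewrite /gle /=.
  by rewrite !ifT //=; lia.
- rewrite sorted_map; apply: (@sub_in_sorted _ (leq 1) _ _ _ _ _ sn); last exact/allP.
  move=> a b; rewrite !unfold_in => a0 b0 /= ab; rewrite /gle /=.
  by rewrite !ifT //=; lia.
Qed.

Lemma parts_bipartition w : sorted gle w -> is_bipartition (parts w).
Proof.
move=> sw; have posW : all (leq 1) (pmap Wpart w).
  apply/allP => n; rewrite mem_pmap => /mapP[[k|k|] //= _]; case: ifP => // k0 [->]; lia.
have posL : all (leq 1) (pmap Lpart w).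
  apply/allP => n; rewrite mem_pmap => /mapP[[k|k|] //= _]; case: ifP => // k0 [->]; lia.
rewrite /is_bipartition /is_partition posW posL !andbT.
elim: w sw {posW posL} => //= x w IH xw; have /andP[sW sL] := IH (path_sorted xw).
have /allP xle := order_path_min gle_trans xw.
apply/andP; split.
  case: x {xw} xle => [k|k|] //= xle; case: ifP => //= k0.
  rewrite path_min_sorted //; apply/allP => n.
  rewrite mem_pmap => /mapP[y /xle]; case: y => [j|j|] //=; case: ifP => // j0.
  by rewrite /gle /= k0 j0 /= => + [->]; lia.
case: x {xw} xle => [k|k|] //= xle; case: ifP => //= k0.
rewrite path_min_sorted //; apply/allP => n.
rewrite mem_pmap => /mapP[y /xle]; case: y => [j|j|] //=; case: ifP => // j0.
by rewrite /gle /= k0 j0 /= => + [->]; lia.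
Qed.

(** * Actions of words *)

Section Words.
Variable K : fieldType.
Implicit Types (M : wmodule K).

Definition wact M (w : seq gen) (m : M) : M := foldr act m w.

Arguments wact : simpl never.
Arguments act : simpl never.

Lemma wact_nil M (m : M) : wact [::] m = m.
Proof. by []. Qed.

Lemma wact_cons M g w (m : M) : wact (g :: w) m = act g (wact w m).
Proof. by []. Qed.

Lemma wact1 M g (m : M) : wact [:: g] m = act g m.
Proof. by []. Qed.

Lemma wact_cat M w1 w2 (m : M) : wact (w1 ++ w2) m = wact w1 (wact w2 m).
Proof. by rewrite /wact foldr_cat. Qed.

Lemma actB M x y (m : M) :
  act x (act y m) = act y (act x m) + bracketL (act^~ m) x y.
Proof. by rewrite -lext_bracket -act_bracket addrC subrK. Qed.

Lemma wact_is_linear M w : linear (@wact M w).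
Proof.
by elim: w => [//|g w IH] a x y; rewrite !wact_cons IH linearP.
Qed.
HB.instance Definition _ M w :=
  GRing.isLinear.Build K M M _ (@wact M w) (@wact_is_linear M w).

Lemma wactD M w (x y : M) : wact w (x + y) = wact w x + wact w y.
Proof. exact: linearD. Qed.
Lemma wactB M w (x y : M) : wact w (x - y) = wact w x - wact w y.
Proof. exact: linearB. Qed.
Lemma wactZ M w k (x : M) : wact w (k *: x) = k *: wact w x.
Proof. exact: linearZ. Qed.
Lemma wact0 M w : wact w (0 : M) = 0.
Proof. exact: linear0. Qed.
Lemma actD M g (x y : M) : act g (x + y) = act g x + act g y.
Proof. exact: linearD. Qed.
Lemma actN M g (x : M) : act g (- x) = - act g x.
Proof. exact: linearN. Qed.
Lemma actZ M g k (x : M) : act g (k *: x) = k *: act g x.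
Proof. exact: linearZ. Qed.
Lemma act0 M g : act g (0 : M) = 0.
Proof. exact: linear0. Qed.
Lemma act_sum M g (I : Type) (r : seq I) (P : pred I) (F : I -> M) :
  act g (\sum_(i <- r | P i) F i) = \sum_(i <- r | P i) act g (F i).
Proof. exact: linear_sum. Qed.

Lemma wact_bracket M a x y b (m : M) :
  wact (a ++ x :: y :: b) m = wact (a ++ y :: x :: b) m
    + bracketL (fun g => wact (a ++ g :: b) m) x y.
Proof.
rewrite !wact_cat !wact_cons actB linearD /=; congr (_ + _).
by rewrite bracketL_linear; apply: eq_bracketL => g; rewrite /= wact_cat.
Qed.

Section Subspace.
Variable V : lmodType K.
Implicit Types N : set V.

Lemma subspace0 N : subspace N -> N 0. Proof. by case. Qed.
Lemma subspaceD N x y : subspace N -> N x -> N y -> N (x + y).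
Proof. by move=> [_ Nl] Nx Ny; rewrite -[x]scale1r; apply: Nl. Qed.
Lemma subspaceZ N a x : subspace N -> N x -> N (a *: x).
Proof. by move=> [N0 Nl] Nx; rewrite -[_ *: _]addr0; apply: Nl. Qed.
Lemma subspaceN N x : subspace N -> N x -> N (- x).
Proof. by move=> sN Nx; rewrite -scaleN1r; apply: subspaceZ. Qed.
Lemma subspaceB N x y : subspace N -> N x -> N y -> N (x - y).
Proof. by move=> sN Nx Ny; apply: subspaceD => //; apply: subspaceN. Qed.
Lemma subspace_sum N (I : Type) (r : seq I) (P : pred I) (F : I -> V) :
  subspace N -> (forall i, P i -> N (F i)) -> N (\sum_(i <- r | P i) F i).
Proof.
move=> sN NF; elim/big_rec: _ => [|i x Pi Nx]; first exact: subspace0.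
by apply: subspaceD => //; apply: NF.
Qed.
Lemma subspace_sum_seq N (I : eqType) (r : seq I) (P : pred I) (F : I -> V) :
  subspace N -> (forall i, i \in r -> P i -> N (F i)) -> N (\sum_(i <- r | P i) F i).
Proof.
move=> sN NF; rewrite big_seq_cond; apply: subspace_sum => // i /andP[]; exact: NF.
Qed.

Lemma eq_subspace (V' : lmodType K) (f g : {linear V -> V'}) :
  subspace [set x | f x = g x].
Proof.
by split=> [|a x y fx fy]; rewrite /= ?linear0 // !linearP /= [f x]fx [f y]fy.
Qed.

Lemma subspace_bracketL N (F : gen -> V) x y :
  subspace N -> (forall g, N (F g)) -> N (bracketL F x y).
Proof.
move=> sN NF; case: x y => [n|n|] [m|m|]; rewrite /bracketL;
  try exact: subspace0; by apply: subspaceD => //; apply: subspaceZ.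
Qed.

End Subspace.

Lemma bracketLZ (V : lmodType K) k (F : gen -> V) x y :
  bracketL (fun g => k *: F g) x y = k *: bracketL F x y.
Proof.
case: x y => [n|n|] [m|m|]; rewrite /bracketL ?scaler0 //;
by rewrite scalerDr !scalerA ![k * _]mulrC.
Qed.

Definition supported (T : choiceType) (P : pred T) : set {malg K[T]} :=
  [set a | forall i, i \in msupp a -> P i].

Lemma supported_subspace (T : choiceType) (P : pred T) : subspace (supported P).
Proof.
split=> [i|a x y Px Py i]; first by rewrite msupp0 in_fset0.
move=> /(fsubsetP (msuppD_le _ _)); rewrite in_fsetU => /orP[|/Py//].
by move=> /(fsubsetP (msuppZ_le _ _)) /Px.
Qed.

Lemma supported_zero (T : choiceType) (P : pred T) : supported P 0.
Proof. by case: (supported_subspace P). Qed.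

Lemma supportedD (T : choiceType) (P : pred T) a b :
  supported P a -> supported P b -> supported P (a + b).
Proof. by move=> Pa Pb; have := (supported_subspace P).2 1 a b Pa Pb; rewrite scale1r. Qed.

Lemma supportedZ (T : choiceType) (P : pred T) k a :
  supported P a -> supported P (k *: a).
Proof. by move=> Pa i /(fsubsetP (msuppZ_le _ _)) /Pa. Qed.

Lemma supportedU (T : choiceType) (P : pred T) t : P t -> supported P << t >>.
Proof. by move=> Pt i /(fsubsetP msuppU_le); rewrite in_fset1 => /eqP->. Qed.

Lemma supportedS (T : choiceType) (P Q : pred T) a :
  subpred P Q -> supported P a -> supported Q a.
Proof. by move=> PQ Pa i /Pa /PQ. Qed.

Lemma supported0 (T : choiceType) (P : pred T) a :
  (forall i, ~~ P i) -> supported P a -> a = 0.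
Proof.
move=> nP Pa; apply/malgP => i; rewrite mcoeff0; case: msuppP => // /Pa.
by rewrite (negPf (nP i)).
Qed.

Lemma supportedP (T : choiceType) (P : pred T) a i :
  supported P a -> ~~ P i -> a@_i = 0.
Proof. by move=> Pa nPi; apply: mcoeff_outdom; apply: contra nPi => /Pa. Qed.

End Words.

Section Verma.
Variables (K : fieldType) (c h hW : K).
Local Notation bip := (seq nat * seq nat)%type.
Local Notation coords := {malg K[bip]}.
Local Notation V := (verma c h hW).
Local Notation v := (verma_vector c h hW).

(** The character of the nonnegative part by which it acts on the highest
    weight vector. The value 1 on negative letters makes the product of [chi]
    over a sorted word the scalar of its nonnegative part. *)
Definition chi (g : gen) : K :=
  match g with
  | L_ n => if n < 0 then 1 else if n == 0 then h else 0
  | W_ n => if n < 0 then 1 else if n == 0 then hW else 0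
  | C_ => c
  end.

(** The coordinates of the vector w v for a sorted word w. *)
Definition vword (w : seq gen) : coords := (\prod_(g <- w) chi g) *: << parts w >>.

Definition tau : seq gen -> coords := straighten vword.

Lemma tauB a x y b : tau (a ++ x :: y :: b) =
  tau (a ++ y :: x :: b) + bracketL (fun g => tau (a ++ g :: b)) x y.
Proof. by rewrite -straightenB addrC subrK. Qed.

(** A character vanishes on brackets: the coefficient of the zero modes and the
    central term in [x, y] are both zero for nonnegative x and y. *)
Lemma bracket_nonneg (F : gen -> coords) z x y : ~~ isneg x -> ~~ isneg y ->
  (forall g, ~~ isneg g -> F g = chi g *: z) -> bracketL F x y = 0.
Proof.
have cc (n m : int) : (n < 0) = false -> (m < 0) = false -> cocycle K n m = 0.
  move=> n0 m0; rewrite /cocycle; case: eqP => // e; have -> : n = 0 by lia.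
  by rewrite expr0n subrr mul0r.
have cd (n m : int) : (n < 0) = false -> (m < 0) = false -> (n + m < 0) = false.
  by lia.
have zz (n m : int) : (n < 0) = false -> (m < 0) = false -> (n - m)%:~R != 0 :> K -> n + m != 0.
  by move=> n0 m0; apply: contra => /eqP e; have -> : n - m = 0 by lia.
case: x y => [n|n|] [m|m|] //; rewrite /isneg /=; do 2![case: ifP => //] => m0 n0 _ _ FE.
all: rewrite cc // scale0r addr0.
all: have [-> |/(zz _ _ n0 m0) nm] := eqVneq ((n - m)%:~R : K) 0; first by rewrite scale0r.
all: rewrite FE /isneg /= ?cd // (negPf nm) scale0r scaler0 //.
Qed.

Lemma chi_neg g : isneg g -> chi g = 1.
Proof. by case: g => [n|n|] //; rewrite /isneg /=; case: ifP. Qed.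

Lemma prod_chi_neg w : all isneg w -> \prod_(g <- w) chi g = 1.
Proof.
by move=> /allP nw; rewrite big_seq big1 // => g /nw; exact: chi_neg.
Qed.

Lemma parts_cat_nonneg w u : all (predC isneg) u -> parts (w ++ u) = parts w.
Proof.
move=> /allP nu; rewrite /parts !pmap_cat.
have -> : pmap Wpart u = [::].
  elim: u nu => //= x u IH nu; rewrite IH => [|g gu]; last by apply: nu; rewrite inE gu orbT.
  have := nu x (mem_head _ _); case: x {nu} => //= n; rewrite /isneg /=; by case: ifP.
have -> : pmap Lpart u = [::].
  elim: u nu => //= x u IH nu; rewrite IH => [|g gu]; last by apply: nu; rewrite inE gu orbT.
  have := nu x (mem_head _ _); case: x {nu} => //= n; rewrite /isneg /=; by case: ifP.
by rewrite !cats0.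
Qed.

Lemma gle_neg x y : isneg x -> ~~ isneg y -> gle x y.
Proof. by rewrite /isneg /gle -leqNgt => x2 y2; rewrite (leq_trans x2 y2). Qed.

Lemma sorted_split w : sorted gle w ->
  exists w1 w2, [/\ w = w1 ++ w2, all isneg w1, all (predC isneg) w2 & sorted gle w1].
Proof.
elim: w => [_|x w IH xw]; first by exists [::], [::].
have /allP xle := order_path_min gle_trans xw.
have [w1 [w2 [ew n1 n2 s1]]] := IH (path_sorted xw).
have [nx|nx] := boolP (isneg x).
  exists (x :: w1), w2; split=> //=; first by rewrite ew.
    by rewrite nx.
  by move: xw; rewrite /= ew cat_path => /andP[].
exists [::], (x :: w); split=> //=; rewrite nx /=; apply/allP => y yw /=.
move: (xle y yw) nx; rewrite /isneg /gle -!leqNgt => /orP[|/andP[/eqP<- //]].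
by move=> xy x2; apply: leq_trans x2 (ltnW xy).
Qed.

Lemma tau_nonneg w u : sorted gle w -> all isneg w -> all (predC isneg) u ->
  tau (w ++ u) = (\prod_(g <- u) chi g) *: << parts w >>.
Proof.
move=> sw nw; elim/word_ind: u => [u su nu|a x y b nxy IH1 IH2].
  rewrite /tau straighten_sorted /vword ?big_cat /=.
    by rewrite (prod_chi_neg nw) mul1r (parts_cat_nonneg _ nu).
  rewrite !(sorted_pairwise gle_trans) in sw su *; rewrite pairwise_cat sw su.
  rewrite !andbT; apply/allrelP => x y xw yu; apply: gle_neg.
    exact: (allP nw).
  exact: (allP nu).
rewrite all_cat /= => /and4P[na nx ny nb].
rewrite catA tauB -!catA IH1 ?all_cat /= ?na ?nx ?ny ?nb //.
rewrite (bracket_nonneg (z := ((\prod_(g <- a) chi g) * (\prod_(g <- b) chi g)) *: << parts w >>)) //.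
  rewrite addr0 !big_cat /= !big_cons.
  by rewrite (mulrCA (chi x)).
move=> g ng; have nagb : all (predC isneg) (a ++ g :: b) by rewrite all_cat /= na ng.
by rewrite -catA (IH2 _ nagb) big_cat big_cons /= scalerA mulrCA.
Qed.

(** Nonnegative letters at the end of a word act on v by the character, whether
    or not the rest of the word has been sorted. This is what makes [tau]
    vanish on the left ideal that defines the Verma module. *)
Lemma tau_rcons w x : ~~ isneg x -> tau (rcons w x) = chi x *: tau w.
Proof.
move=> nx; elim/word_ind: w => [w sw|a y z b nyz IH1 IH2].
  have [w1 [w2 [-> n1 n2 s1]]] := sorted_split sw.
  have n2x : all (predC isneg) (w2 ++ [:: x]) by rewrite all_cat n2 /= nx.
  rewrite -cats1 -catA (tau_nonneg s1 n1 n2x) (tau_nonneg s1 n1 n2).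
  by rewrite big_cat big_seq1 /= scalerA mulrC.
rewrite rcons_cat /= [LHS]tauB [in RHS]tauB scalerDr; congr (_ + _).
  by rewrite -IH1 rcons_cat.
rewrite -bracketLZ; apply: eq_bracketL => g.
by rewrite -IH2 rcons_cat.
Qed.

(** * Coordinates on the Verma module *)

Local Notation free_alg := {malg K[{fmonom gen}]}.

Definition tauT (z : free_alg) : coords := lext (fun m : {fmonom gen} => tau m) z.

Lemma tauT_is_linear : linear tauT.
Proof. exact: lext_is_linear. Qed.
HB.instance Definition _ := GRing.isLinear.Build K free_alg coords _ tauT tauT_is_linear.

Definition mw (w : seq gen) : free_alg := << FMonom w >>.

Lemma mwM w1 w2 : mw w1 * mw w2 = mw (w1 ++ w2).
Proof.
rewrite /mw malgM_def fgmulUU mulr1; congr (<< _ >>).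
by apply/val_inj; rewrite /= fmM.
Qed.

Lemma mw1 : mw [::] = 1.
Proof. by rewrite /mw -fmoneE. Qed.

Lemma fXE g : fX K g = mw [:: g].
Proof. by rewrite /fX /mw fmuE. Qed.

Lemma tauT_mw w : tauT (mw w) = tau w.
Proof. by rewrite /tauT lextU. Qed.

Lemma free_expand (a : free_alg) : a = \sum_(m <- msupp a) a@_m *: mw m.
Proof.
rewrite {1}[a]monalgE; apply: eq_bigr => m _; rewrite malgU_scale.
by congr (_ *: << _ >>); case: m.
Qed.

Lemma malg_scalerAl k (x b : free_alg) : k *: x * b = k *: (x * b).
Proof. by rewrite scalerAl. Qed.

Lemma lin_comb0 (M : lmodType K) k (p q : M) : p = 0 -> q = 0 -> k *: p + q = 0.
Proof. by move=> -> ->; rewrite scaler0 addr0. Qed.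

(** Multiplying a relation by words on both sides gives an instance of
    [tauB]. *)
Lemma tauT_ideal z : bracket_ideal z -> tauT z = 0.
Proof.
pose S : set free_alg := [set z : free_alg | forall a b : free_alg, tauT (a * z * b) = 0].
suff Sz : bracket_ideal z -> S z.
  by move=> /Sz /(_ 1 1); rewrite mul1r mulr1.
apply; split.
  split.
    split=> [a b|k x y Sx Sy a b]; first by rewrite mulr0 mul0r linear0.
    rewrite mulrDr mulrDl -malg_scalerAr malg_scalerAl linearD linearZ /=.
    exact: (lin_comb0 k (Sx a b) (Sy a b)).
  move=> a x Sx; split=> a' b'; first by rewrite mulrA; exact: Sx.
  by rewrite mulrA -mulrA; exact: Sx.
move=> _ [x [y ->]] a b; set r := (X in a * X * b).
have la b' : linear (fun a => tauT (a * r * b')).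
  by move=> k a1 a2; rewrite !mulrDl !malg_scalerAl linearP.
have lb a' : linear (fun b => tauT (a' * r * b)).
  by move=> k b1 b2; rewrite mulrDr -malg_scalerAr linearP.
have l0 : linear (fun _ : free_alg => 0 : coords).
  by move=> k _ _; rewrite scaler0 addr0.
apply: (malg_linear_eq (la b) l0) => m.
apply: (malg_linear_eq (lb << m >>) l0) => m'.
have lf : linear (fun t => tauT (<< m >> * t * << m' >>)).
  by move=> k t1 t2; rewrite mulrDr mulrDl -malg_scalerAr malg_scalerAl linearP.
pose f : {linear free_alg -> coords} :=
  HB.pack (fun t => tauT (<< m >> * t * << m' >>)) (GRing.isLinear.Build K _ _ _ _ lf).
have mwE (m1 : {fmonom gen}) : << m1 >> = mw m1 :> free_alg.
  by rewrite /mw; case: (m1).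
have fE w : f (mw w) = tau (m ++ w ++ m').
  by rewrite /f /= (mwE m) (mwE m') mwM mwM tauT_mw -catA.
transitivity (f (fX K x * fX K y) - f (fX K y * fX K x)
              - bracketL (f \o @fX K) x y).
  rewrite -bracketL_linear -lext_bracket; transitivity (f r) => //.
  by rewrite /r 2!(raddfB f).
have fgE g : f (fX K g) = tau (m ++ g :: m') by rewrite fXE fE.
have fggE g g' : f (fX K g * fX K g') = tau (m ++ g :: g' :: m').
  by rewrite fXE fXE mwM fE.
have cancel (M : zmodType) (p q : M) : p + q - p - q = 0.
  by rewrite [p + q]addrC addrK subrr.
have eq3 (M : zmodType) (p q t p' q' t' : M) :
    p = p' -> q = q' -> t = t' -> p' - q' - t' = 0 -> p - q - t = 0.
  by move=> -> -> ->.
apply: (eq3 _ _ _ _ _ _ _ (fggE x y) (fggE y x) (eq_bracketL x y fgE)).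
by rewrite (tauB m x y m'); exact: cancel.
Qed.

Definition coordU (x : U K) : coords := liftV tauT x.

Lemma coordU_is_linear : linear coordU.
Proof. exact: (liftV_is_linear tauT_is_linear tauT_ideal). Qed.
HB.instance Definition _ := GRing.isLinear.Build K (U K) coords _ coordU coordU_is_linear.

Lemma wact_U_one w : wact w (U_one K) = projV (bracket_ideal_subspace K) (mw w).
Proof.
elim: w => [|g w IH]; first by rewrite mw1.
rewrite wact_cons IH.
rewrite /act /= U_actE; congr (projV _ _); by rewrite fXE mwM.
Qed.

Lemma coordU_wact w : coordU (wact w (U_one K)) = tau w.
Proof.
rewrite wact_U_one /coordU (liftVE _ tauT_is_linear tauT_ideal); exact: tauT_mw.
Qed.

(** The elements all of whose translates have zero coordinates form a submodule,
    and [tau_rcons] says that it contains the relations. *)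
Lemma coordU_kernel x : smallest (@submodule K (U K)) (verma_relations c h hW) x ->
  coordU x = 0.
Proof.
pose S : set (U K) := [set x : U K | forall w, coordU (wact w x) = 0].
suff Sx : smallest (@submodule K (U K)) (verma_relations c h hW) x -> S x.
  by move=> /Sx /(_ [::]).
apply; split.
  split; first split.
  - by move=> w; rewrite !linear0.
  - move=> k x1 x2 S1 S2 w; rewrite wactD wactZ linearP; exact: (lin_comb0 k (S1 w) (S2 w)).
  - move=> g y Sy w; have := Sy (rcons w g); by rewrite -cats1 wact_cat.
have rel g : ~~ isneg g -> S (wact [:: g] (U_one K) - chi g *: U_one K).
  move=> ng w; rewrite wactB wactZ -wact_cat cats1 linearB linearZ /=.
  rewrite !coordU_wact (tau_rcons _ ng); exact: subrr.
have gE g : U_gen K g = wact [:: g] (U_one K) by rewrite wact_U_one -fXE.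
move=> _ [[n n0 [->|->]]|->|->|->]; rewrite gE.
- have := rel (L_ n); rewrite /isneg /= ifF ?ifF; try by lia.
  by rewrite scale0r subr0; apply.
- have := rel (W_ n); rewrite /isneg /= ifF ?ifF; try by lia.
  by rewrite scale0r subr0; apply.
- exact: (rel C_).
- exact: (rel (L_ 0)).
- exact: (rel (W_ 0)).
Qed.

Definition vcoord (x : V) : coords := liftV coordU x.

Lemma coord_is_linear : linear vcoord.
Proof. exact: (liftV_is_linear coordU_is_linear coordU_kernel). Qed.
HB.instance Definition _ := GRing.isLinear.Build K V coords _ vcoord coord_is_linear.

Lemma vcoord0 : vcoord 0 = 0. Proof. exact: linear0. Qed.
Lemma vcoordD x y : vcoord (x + y) = vcoord x + vcoord y.
Proof. exact: linearD. Qed.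
Lemma vcoordB x y : vcoord (x - y) = vcoord x - vcoord y.
Proof. exact: linearB. Qed.
Lemma vcoordZ k x : vcoord (k *: x) = k *: vcoord x.
Proof. exact: linearZ. Qed.

Lemma coord_proj x : vcoord (proj (smallest_submodule _) x) = coordU x.
Proof. exact: (liftVE _ coordU_is_linear coordU_kernel). Qed.

Lemma wact_proj (M : wmodule K) (N : set M) (sN : submodule N) w x :
  wact w (proj sN x) = proj sN (wact w x).
Proof. by elim: w => // g w IH; rewrite !wact_cons IH /act /= qactE. Qed.

Lemma coord_wact w : vcoord (wact w v) = tau w.
Proof.
rewrite /verma_vector wact_proj coord_proj; exact: coordU_wact.
Qed.

Lemma verma_span (N : set V) : subspace N -> (forall w, N (wact w v)) ->
  forall x, N x.
Proof.
move=> sN Nw.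
have sub : subspace [set z : free_alg |
    N (projV (smallest_submodule (verma_relations c h hW)).1
         (projV (bracket_ideal_subspace K) z))].
  split; first by rewrite /= !linear0; exact: sN.1.
  by move=> k z1 z2 N1 N2; rewrite /= !linearP; apply: sN.2.
move=> x; rewrite -[x]projVK; rewrite -[repr x]projVK.
move: (repr (repr x)) => z; suff : [set z : free_alg |
    N (projV (smallest_submodule (verma_relations c h hW)).1
         (projV (bracket_ideal_subspace K) z))] z by [].
rewrite (free_expand z); apply: (subspace_sum _ sub) => m _.
apply: (subspaceZ _ sub); have := Nw m.
by rewrite /verma_vector wact_proj wact_U_one.
Qed.

Lemma verma_ind (N : set V) : submodule N -> N v -> forall x, N x.
Proof.
move=> sN Nv; apply: verma_span => [|w]; first exact: sN.1.
by elim: w => // g w IH; rewrite wact_cons; apply: sN.2.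
Qed.

Lemma verma_highest g : ~~ isneg g -> act g v = chi g *: v.
Proof.
move=> ng; pose s := smallest_submodule (verma_relations c h hW).
have rel : smallest (@submodule K (U K)) (verma_relations c h hW)
    (U_gen K g - chi g *: U_one K).
  move=> N [sN RN]; apply: RN.
  case: g ng => [n|n|]; rewrite /isneg /=; last by move=> _; constructor 2.
    case: ifP => // n0 _; case: eqP => [->|n1]; first by constructor 3.
    rewrite scale0r subr0; constructor 1; exists `|n|%N; first by lia.
    by left; congr (U_gen _ (L_ _)); lia.
  case: ifP => // n0 _; case: eqP => [->|n1]; first by constructor 4.
  rewrite scale0r subr0; constructor 1; exists `|n|%N; first by lia.
  by right; congr (U_gen _ (W_ _)); lia.
have gE : U_gen K g = act g (U_one K).
  by rewrite -[RHS]/(wact [:: g] (U_one K)) wact_U_one -fXE.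
rewrite /verma_vector -(wact1 g) wact_proj wact1 -gE.
transitivity (proj s (chi g *: U_one K)); first exact/projV_eq.
exact: linearZ.
Qed.

End Verma.

Arguments wact {K M} w m : simpl never.
Arguments act {K w} _ _ : simpl never.

(** * Leading terms of words *)

(* From here on the Verma module is only used through its coordinates. *)
Opaque verma verma_vector vcoord tau.

Definition cW (g : gen) : nat := gclass g == 0%N.
Definition cL (g : gen) : nat := gclass g == 1%N.
Definition gwt (g : gen) : nat := (odflt 0 (Wpart g) + odflt 0 (Lpart g))%N.

Definition nW (w : seq gen) : nat := sumn (map cW w).
Definition nL (w : seq gen) : nat := sumn (map cL w).
Definition wt (w : seq gen) : nat := sumn (map gwt w).
Definition wti (i : seq nat * seq nat) : nat := (sumn i.1 + sumn i.2)%N.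

Lemma nW_cat u w : nW (u ++ w) = (nW u + nW w)%N.
Proof. by rewrite /nW map_cat sumn_cat. Qed.
Lemma nL_cat u w : nL (u ++ w) = (nL u + nL w)%N.
Proof. by rewrite /nL map_cat sumn_cat. Qed.
Lemma wt_cat u w : wt (u ++ w) = (wt u + wt w)%N.
Proof. by rewrite /wt map_cat sumn_cat. Qed.
Lemma nW_cons g w : nW (g :: w) = (cW g + nW w)%N. Proof. by []. Qed.
Lemma nL_cons g w : nL (g :: w) = (cL g + nL w)%N. Proof. by []. Qed.
Lemma wt_cons g w : wt (g :: w) = (gwt g + wt w)%N. Proof. by []. Qed.

Lemma size_Wpart w : size (pmap Wpart w) = nW w.
Proof.
elim: w => //= -[n|n|] w IH //=; rewrite nW_cons -IH /cW /=; by case: ifP.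
Qed.
Lemma size_Lpart w : size (pmap Lpart w) = nL w.
Proof.
elim: w => //= -[n|n|] w IH //=; rewrite nL_cons -IH /cL /=; by case: ifP.
Qed.

Lemma wti_parts w : wti (parts w) = wt w.
Proof.
rewrite /wti /parts /=; elim: w => //= g w IH; rewrite wt_cons -IH /gwt.
case: g => [n|n|] /=; do ?[case: ifP => _ /=]; lia.
Qed.

Lemma nW_wmono i : is_bipartition i -> nW (wmono i) = size i.1.
Proof. by move=> /parts_wmono /(congr1 fst) /= <-; rewrite size_Wpart. Qed.
Lemma nL_wmono i : is_bipartition i -> nL (wmono i) = size i.2.
Proof. by move=> /parts_wmono /(congr1 snd) /= <-; rewrite size_Lpart. Qed.
Lemma wt_wmono i : is_bipartition i -> wt (wmono i) = wti i.
Proof. by move=> ip; rewrite -wti_parts (parts_wmono ip). Qed.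

(** The bipartition formed by the letters of w in any order: the leading term of
    the vector w v. *)
Definition srt (w : seq gen) : seq nat * seq nat :=
  (sort geq (pmap Wpart w), sort geq (pmap Lpart w)).

Lemma geq_total : total geq. Proof. by move=> m n; exact: leq_total. Qed.
Lemma geq_trans : transitive geq.
Proof. by move=> m n p /= nm pm; exact: leq_trans pm nm. Qed.
Lemma geq_anti : antisymmetric geq.
Proof. by move=> m n /= /andP[nm mn]; apply/eqP; rewrite eqn_leq mn nm. Qed.

Lemma sort_geq_id s : sorted geq s -> sort geq s = s.
Proof. exact: (sorted_sort geq_trans). Qed.

Lemma perm_sort_geq s t : perm_eq s t -> sort geq s = sort geq t.
Proof. by move/(perm_sortP geq_total geq_trans geq_anti). Qed.

Lemma srt_perm u w : perm_eq u w -> srt u = srt w.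
Proof.
move=> uw; rewrite /srt; congr (_, _); apply: perm_sort_geq; exact: perm_pmap.
Qed.

Lemma srt_sorted w : sorted gle w -> srt w = parts w.
Proof.
move=> /parts_bipartition; rewrite /is_bipartition /is_partition.
by move=> /andP[/andP[s1 _] /andP[s2 _]]; rewrite /srt !sort_geq_id.
Qed.

Lemma srt_bipartition w : is_bipartition (srt w).
Proof.
rewrite /srt /is_bipartition /is_partition /= !(sort_sorted geq_total) /= !all_sort.
apply/andP; split; apply/allP => n; rewrite mem_pmap => /mapP[[k|k|] //= _];
  case: ifP => // k0 [->]; lia.
Qed.

Lemma size_srt1 w : size (srt w).1 = nW w.
Proof. by rewrite /= size_sort size_Wpart. Qed.
Lemma size_srt2 w : size (srt w).2 = nL w.
Proof. by rewrite /= size_sort size_Lpart. Qed.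
Lemma wti_srt w : wti (srt w) = wt w.
Proof.
rewrite -wti_parts /wti /=; congr (_ + _)%N; apply: perm_sumn; exact/permPl/perm_sort.
Qed.

Lemma perm_swap2 (a b : seq gen) x y :
  perm_eq (a ++ x :: y :: b) (a ++ y :: x :: b).
Proof.
rewrite perm_cat2l; apply/permP => p /=; lia.
Qed.

Section NegativeBrackets.
Variable K : fieldType.

(** Commuting two negative letters loses one L and keeps the number of W and the
    weight. *)
Lemma bracketL_neg (V : lmodType K) (N : set V) (F : gen -> V) x y :
  subspace N -> isneg x -> isneg y ->
  (forall g, isneg g -> cW g = (cW x + cW y)%N -> (cL g).+1 = (cL x + cL y)%N ->
     gwt g = (gwt x + gwt y)%N -> N (F g)) ->
  N (bracketL F x y).
Proof.
move=> sN nx ny NF.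
have [n n0 ex] := neg_letter nx; have [m m0 ey] := neg_letter ny.
have cc : cocycle K (- n%:Z) (- m%:Z) = 0 by rewrite /cocycle ifF //; lia.
have e : - n%:Z + - m%:Z = - (n + m)%N%:Z by lia.
have nm0 : (0 < n + m)%N by lia.
case: ex ey => -> [] -> in NF *; rewrite /bracketL; last exact: subspace0.
all: rewrite cc scale0r addr0 e; apply: subspaceZ => //; apply: NF.
all: do ?by [apply: isneg_L|apply: isneg_W].
all: have hn : - n%:Z < 0 by lia.
all: have hm : - m%:Z < 0 by lia.
all: have hnm : - (n + m)%N%:Z < 0 by lia.
all: by rewrite /cW /cL /gwt /= ?hn ?hm ?hnm /=; lia.
Qed.

Local Notation bip := (seq nat * seq nat)%type.
Local Notation coords := {malg K[bip]}.

(** The element of U(L_-) with PBW coordinates a, applied to m. *)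
Definition pact (M : wmodule K) (m : M) (a : coords) : M :=
  lext (fun i => wact (wmono i) m) a.

HB.instance Definition _ (M : wmodule K) (m : M) :=
  GRing.isLinear.Build K coords M _ (pact m) (lext_is_linear _).

Lemma pactU (M : wmodule K) (m : M) i : pact m << i >> = wact (wmono i) m.
Proof. exact: lextU. Qed.

Lemma pact0 (M : wmodule K) (m : M) : pact m 0 = 0.
Proof. exact: linear0. Qed.
Lemma pactD (M : wmodule K) (m : M) a b : pact m (a + b) = pact m a + pact m b.
Proof. exact: linearD. Qed.
Lemma pactZ (M : wmodule K) (m : M) k a : pact m (k *: a) = k *: pact m a.
Proof. exact: linearZ. Qed.

End NegativeBrackets.

Section VermaBasis.
Variables (K : fieldType) (c h hW : K).
Local Notation bip := (seq nat * seq nat)%type.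
Local Notation coords := {malg K[bip]}.
Local Notation V := (verma c h hW).
Local Notation v := (verma_vector c h hW).
Local Notation tau := (tau c h hW).

Definition highest (M : wmodule K) (m : M) :=
  forall g, ~~ isneg g -> act g m = chi c h hW g *: m.

Lemma tau_sorted w : sorted gle w -> tau w = vword c h hW w.
Proof. exact: straighten_sorted. Qed.

(** Straightening holds in every module: for an arbitrary vector as long as only
    negative letters occur, and for all words on a highest weight vector. *)
Lemma wact_tau (M : wmodule K) (m : M) w : all isneg w \/ highest m ->
  wact w m = pact m (tau w).
Proof.
move=> H; elim/word_ind: w H => [w sw|a x y b nxy IH1 IH2] H.
  rewrite tau_sorted // /vword linearZ /= pactU.
  case: H => [nw|hm].
    by rewrite prod_chi_neg // wmono_parts // scale1r.
  have [w1 [w2 [-> n1 n2 s1]]] := sorted_split sw.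
  rewrite parts_cat_nonneg // wmono_parts // wact_cat big_cat /= prod_chi_neg // mul1r.
  rewrite -wactZ; congr (wact _ _).
  elim: w2 n2 => [_|g u IH /= /andP[ng nu]]; first by rewrite big_nil scale1r.
  by rewrite wact_cons IH // actZ hm // big_cons scalerA mulrC.
rewrite wact_bracket tauB linearD /=; congr (_ + _).
  apply: IH1; case: H => [|hm]; [left|by right].
  by rewrite -(perm_all _ (perm_swap2 a b x y)).
rewrite bracketL_linear; case: H => [nw|hm]; last first.
  by apply: eq_bracketL => g /=; apply: IH2; right.
have [na nx ny nb] : [/\ all isneg a, isneg x, isneg y & all isneg b].
  by move: nw; rewrite all_cat /= => /and4P[].
pose N : set M := [set z | z = 0].
have sN : subspace N.
  by split=> // k p q -> ->; rewrite /N /= scaler0 addr0.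
apply/eqP; rewrite -subr_eq0 -bracketLN -bracketLD; apply/eqP.
apply: (bracketL_neg (N := N)) => // g ng _ _ _; rewrite /N /=; apply/eqP.
by rewrite subr_eq0; apply/eqP/IH2; left; rewrite all_cat /= na ng.
Qed.

(** What the commutators in the straightening of w contribute. *)
Definition lower_terms w (i : bip) : bool :=
  [&& is_bipartition i, size i.1 == nW w, (size i.2 < nL w)%N & wti i == wt w].

Lemma tau_lead w : all isneg w -> supported (lower_terms w) (tau w - << srt w >>).
Proof.
elim/word_ind: w => [w sw nw|a x y b nxy IH1 IH2 nw].
  rewrite tau_sorted // /vword prod_chi_neg // scale1r srt_sorted // subrr.
  exact: supported_zero.
have [na nx ny nb] : [/\ all isneg a, isneg x, isneg y & all isneg b].
  by move: nw; rewrite all_cat /= => /and4P[].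
rewrite tauB addrAC; apply: supportedD.
  have nw' : all isneg (a ++ y :: x :: b) by rewrite all_cat /= na ny nx.
  have := IH1 nw'; rewrite (srt_perm (perm_swap2 a b y x)); apply: supportedS => i.
  rewrite /lower_terms !nW_cat !nL_cat !wt_cat !nW_cons !nL_cons !wt_cons.
  by rewrite (addnCA (cW y)) (addnCA (cL y)) (addnCA (gwt y)).
apply: bracketL_neg => //; first exact: supported_subspace.
move=> g ng eW eL ewt; have nw' : all isneg (a ++ g :: b) by rewrite all_cat /= na ng.
have -> : tau (a ++ g :: b) = (tau (a ++ g :: b) - << srt (a ++ g :: b) >>)
  + << srt (a ++ g :: b) >> by rewrite subrK.
apply: supportedD.
  apply: supportedS (IH2 g nw') => i /and4P[ip /eqP iW iL /eqP iwt].
  rewrite /lower_terms ip iW iwt /=; move: iL.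
  rewrite !nW_cat !nL_cat !wt_cat !nW_cons !nL_cons !wt_cons; lia.
apply: supportedU; rewrite /lower_terms srt_bipartition size_srt1 size_srt2 wti_srt.
rewrite !nW_cat !nL_cat !wt_cat !nW_cons !nL_cons !wt_cons; lia.
Qed.

End VermaBasis.

Section VermaFiltration.
Variables (K : fieldType) (c h hW : K).
Local Notation bip := (seq nat * seq nat)%type.
Local Notation coords := {malg K[bip]}.
Local Notation V := (verma c h hW).
Local Notation v := (verma_vector c h hW).
Local Notation tau := (tau c h hW).
Local Notation coord := (@vcoord K c h hW).
Local Notation base i := (wact (wmono i) v).

Lemma tau_bipartition w : supported is_bipartition (tau w).
Proof.
elim/word_ind: w => [w sw|a x y b nxy IH1 IH2].
  rewrite tau_sorted //; apply: supportedZ; apply: supportedU.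
  exact: parts_bipartition.
rewrite tauB; apply: supportedD; first exact: IH1.
by apply: subspace_bracketL; [exact: supported_subspace|exact: IH2].
Qed.

Lemma coord_bipartition x : supported is_bipartition (coord x).
Proof.
apply: (verma_span (N := [set x | supported is_bipartition (coord x)])) => [|w].
  split=> [|a y z Py Pz]; first by rewrite /= vcoord0; exact: supported_zero.
  by rewrite /= vcoordD vcoordZ; apply: supportedD; [apply: supportedZ; exact: Py|exact: Pz].
by rewrite /= coord_wact; exact: tau_bipartition.
Qed.

Lemma coordK x : pact v (coord x) = x.
Proof.
pose N : set V := [set x | pact v (coord x) = x].
have sN : subspace N by exact: (eq_subspace (pact v \o coord) idfun).
apply: (verma_span sN) => w.
rewrite /N /= coord_wact -wact_tau //; right; exact: verma_highest.
Qed.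

Lemma coord_base i : is_bipartition i -> coord (base i) = << i >>.
Proof.
move=> ip; rewrite coord_wact tau_sorted ?wmono_sorted // /vword.
by rewrite prod_chi_neg ?wmono_neg // scale1r parts_wmono.
Qed.

Lemma coord_inj x : coord x = 0 -> x = 0.
Proof. by move=> cx; rewrite -(coordK x) cx pact0. Qed.

Lemma pbwE i : pbw c h hW i = base i.
Proof.
rewrite /pbw /wmono wact_cat /wact !foldr_map; congr (foldr _ _ _).
Qed.

(** The span of the PBW vectors with index in P. *)
Definition Vs (P : pred bip) : set V := [set x : V | supported P (coord x)].

Lemma Vs_subspace P : subspace (Vs P).
Proof.
split=> [|a y z Py Pz]; first by rewrite /Vs /= vcoord0; exact: supported_zero.
by rewrite /Vs /= vcoordD vcoordZ; apply: supportedD; [apply: supportedZ; exact: Py|exact: Pz].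
Qed.

Lemma VsS (P Q : pred bip) x : (forall i, is_bipartition i -> P i -> Q i) -> Vs P x -> Vs Q x.
Proof. by move=> PQ Px i ix; apply: PQ; [apply: coord_bipartition ix|apply: Px]. Qed.

Lemma Vs_op (f : {linear V -> V}) (P Q : pred bip) :
  (forall i, is_bipartition i -> P i -> Vs Q (f (base i))) ->
  forall x, Vs P x -> Vs Q (f x).
Proof.
move=> fPQ x Px; rewrite -(coordK x) /pact /lext linear_sum.
apply: subspace_sum_seq; first exact: Vs_subspace.
move=> i ix _; rewrite linearZ; apply: (subspaceZ _ (Vs_subspace _)).
by apply: fPQ; [apply: coord_bipartition ix|apply: Px].
Qed.

Lemma Vs_base (P : pred bip) i : is_bipartition i -> P i -> Vs P (base i).
Proof. by move=> ip Pi; rewrite /Vs /= coord_base //; exact: supportedU. Qed.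

Lemma word_lead w : all isneg w -> Vs (lower_terms w) (wact w v - base (srt w)).
Proof.
move=> nw; rewrite /Vs /= vcoordB coord_wact coord_base ?srt_bipartition //.
exact: tau_lead.
Qed.

Definition word_terms w (i : bip) : bool :=
  [&& is_bipartition i, size i.1 == nW w, (size i.2 <= nL w)%N & wti i == wt w].

Lemma word_mem w : all isneg w -> Vs (word_terms w) (wact w v).
Proof.
move=> nw; rewrite -[wact w v](subrK (base (srt w))).
apply: (subspaceD (Vs_subspace _)).
  apply: VsS (word_lead nw) => i _ /and4P[ip i1 i2 iw].
  by rewrite /word_terms ip i1 iw (ltnW i2).
apply: Vs_base; first exact: srt_bipartition.
by rewrite /word_terms srt_bipartition size_srt1 size_srt2 wti_srt !eqxx leqnn.
Qed.

Lemma word_perm u w : all isneg u -> perm_eq u w ->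
  Vs (lower_terms w) (wact u v - wact w v).
Proof.
move=> nu uw; have nw : all isneg w by rewrite -(perm_all _ uw).
have -> : wact u v - wact w v =
    (wact u v - base (srt u)) - (wact w v - base (srt w)).
  by rewrite (srt_perm uw) opprB addrA subrK.
apply: (subspaceB (Vs_subspace _)); last exact: word_lead.
apply: VsS (word_lead nu) => i _; rewrite /lower_terms /nW /nL /wt.
by rewrite !(perm_sumn (perm_map _ uw)).
Qed.

(** Monomials are compared by increasing W-degree, then by decreasing L-degree:
    [late 0 0 s t] are those that do not come before W-degree s and L-degree t.
    The shifts d and e measure how much L-degree and W-degree were lost by
    applying a positive letter. *)
Definition late d e s t (i : bip) : bool :=
  (s < size i.1 + e)%N || ((size i.1 + e == s)%N && (size i.2 + d <= t)%N).

Lemma late_neg d e s t g x : isneg g -> Vs (late d e s t) x ->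
  Vs (late d e (s + cW g) (t + cL g)) (act g x).
Proof.
move=> ng; apply: (Vs_op (f := act g)) => i ip Pi; rewrite /= -wact_cons.
apply: VsS (word_mem (w := g :: wmono i) _); last by rewrite /= ng wmono_neg.
move=> j _ /and4P[_ /eqP j1 j2 _]; move: Pi j1 j2; rewrite /late nW_cons nL_cons.
rewrite nW_wmono // nL_wmono //; lia.
Qed.

Lemma late_word d e s t w : all isneg w ->
  (forall n, (n <= nL w)%N -> (s < nW w + e)%N || ((nW w + e == s)%N && (n + d <= t)%N)) ->
  Vs (late d e s t) (wact w v).
Proof.
move=> nw H; apply: VsS (word_mem nw) => i _ /and4P[_ /eqP i1 i2 _].
by rewrite /late i1; apply: H.
Qed.

Definition moreW s (i : bip) : bool := (s < size i.1)%N.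

Lemma moreW_neg s g x : isneg g -> Vs (moreW s) x -> Vs (moreW (s + cW g)) (act g x).
Proof.
move=> ng; apply: (Vs_op (f := act g)) => i ip Pi; rewrite /= -wact_cons.
apply: VsS (word_mem (w := g :: wmono i) _); last by rewrite /= ng wmono_neg.
move=> j _ /and4P[_ /eqP j1 _ _]; move: Pi j1; rewrite /moreW nW_cons.
rewrite nW_wmono //; lia.
Qed.

Lemma moreW_word s w : all isneg w -> (s < nW w)%N -> Vs (moreW s) (wact w v).
Proof.
by move=> nw sw; apply: VsS (word_mem nw) => i _ /and4P[_ /eqP i1 _ _]; rewrite /moreW i1.
Qed.

(** * Zero modes *)

Lemma act_C (M : wmodule K) (m : M) k w : act C_ m = k *: m ->
  act C_ (wact w m) = k *: wact w m.
Proof.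
move=> Cm; elim: w => // g w IH; rewrite wact_cons actB IH actZ /=.
by rewrite addr0.
Qed.

Lemma act_L0 (M : wmodule K) (m : M) k w : all isneg w -> act (L_ 0) m = k *: m ->
  act (L_ 0) (wact w m) = (k + (wt w)%:R) *: wact w m.
Proof.
move=> nw L0m; elim: w nw => [_|g w IH /= /andP[ng nw]]; first by rewrite addr0.
rewrite wact_cons actB IH // actZ wt_cons natrD [k + (_ + _)]addrCA [in RHS]scalerDl [RHS]addrC.
congr (_ + _); have [n n0 eg] := neg_letter ng.
have cc : cocycle K 0 (- n%:Z) = 0 by rewrite /cocycle ifF //; lia.
have hn : - n%:Z < 0 by lia.
case: eg => ->; rewrite /bracketL cc scale0r addr0 sub0r opprK add0r /gwt /= hn /=;
  by rewrite ?addn0 ?add0n abszN absz_nat.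
Qed.

Lemma verma_C (x : V) : act C_ x = c *: x.
Proof.
apply: (verma_span (N := [set x : V | act C_ x = c *: x])) => [|w].
  split=> [|a y z Py Pz]; first by rewrite /= act0 scaler0.
  by rewrite /= actD actZ Py Pz scalerDr !scalerA mulrC.
by apply: act_C; exact: (verma_highest c h hW (isT : ~~ isneg (C_))).
Qed.

Lemma verma_L0 w : all isneg w -> act (L_ 0) (wact w v) = (h + (wt w)%:R) *: wact w v.
Proof. by move=> nw; apply: act_L0 => //; exact: (verma_highest c h hW (isT : ~~ isneg (L_ 0))). Qed.

(** [W_0, L_(-n)] = n W_(-n) turns an L into a W, so W_0 is h_W up to terms of
    higher W-degree. *)
Lemma verma_W0 w : all isneg w ->
  Vs (moreW (nW w)) (act (W_ 0) (wact w v) - hW *: wact w v).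
Proof.
elim: w => [_|g w IH /= /andP[ng nw]].
  rewrite (verma_highest c h hW (isT : ~~ isneg (W_ 0))) //= subrr; exact: (Vs_subspace _).1.
rewrite wact_cons actB addrAC -actZ -actN -actD.
apply: (subspaceD (Vs_subspace _)).
  by rewrite nW_cons addnC; exact: moreW_neg ng (IH nw).
have [n n0 eg] := neg_letter ng; case: eg => eg; rewrite eg /bracketL.
  have cc : cocycle K 0 (- n%:Z) = 0 by rewrite /cocycle ifF //; lia.
  rewrite cc scale0r addr0 sub0r opprK add0r; apply: (subspaceZ _ (Vs_subspace _)).
  rewrite -wact_cons; apply: moreW_word; first by rewrite /= isneg_W.
  have hn : - n%:Z < 0 by lia.
  by rewrite !nW_cons /cW /= hn.
exact: (Vs_subspace _).1.
Qed.

Lemma scale_gram (M : lmodType K) (k l a : K) (x y : M) :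
  k *: x + l *: y - (k * a + l) *: y = k *: (x - a *: y).
Proof. by rewrite scalerDl opprD addrACA subrr addr0 -scalerA -scalerBr. Qed.

(** The scalar by which [L_n, W_(-n)] acts on v; it is also that of
    [W_n, L_(-n)]. *)
Definition gram (n : nat) : K :=
  (n%:Z + n%:Z)%:~R * hW + cocycle K n%:Z (- n%:Z) * c.

Lemma rem_neg g w : all isneg w -> all isneg (rem g w).
Proof. by move=> /allP nw; apply/allP => x /mem_rem /nw. Qed.

Lemma nW_rem g w : g \in w -> nW w = (cW g + nW (rem g w))%N.
Proof. by move=> gw; rewrite /nW (perm_sumn (perm_map _ (perm_to_rem gw))). Qed.
Lemma nL_rem g w : g \in w -> nL w = (cL g + nL (rem g w))%N.
Proof. by move=> gw; rewrite /nL (perm_sumn (perm_map _ (perm_to_rem gw))). Qed.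

Lemma cW_W n : (0 < n)%N -> cW (W_ (- n%:Z)) = 1%N.
Proof. by move=> n0; rewrite /cW /= ifT //; lia. Qed.
Lemma cL_W n : (0 < n)%N -> cL (W_ (- n%:Z)) = 0%N.
Proof. by move=> n0; rewrite /cL /= ifT //; lia. Qed.
Lemma cW_L n : (0 < n)%N -> cW (L_ (- n%:Z)) = 0%N.
Proof. by move=> n0; rewrite /cW /= ifT //; lia. Qed.
Lemma cL_L n : (0 < n)%N -> cL (L_ (- n%:Z)) = 1%N.
Proof. by move=> n0; rewrite /cL /= ifT //; lia. Qed.

(** Removing the letter Q from w loses exactly the degrees of Q, so the leading
    term is absorbed once the error is known to be late as well. *)
Lemma lead_weaken Q a d e (y : V) w : all isneg w ->
  (forall s t, subpred (late d e s t) (late (cL Q) (cW Q) s t)) ->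
  Vs (late d e (nW w) (nL w)) (y - ((count_mem Q w)%:R * a) *: wact (rem Q w) v) ->
  Vs (late (cL Q) (cW Q) (nW w) (nL w)) y.
Proof.
move=> nw sub; set z := _ *: _ => Hy; rewrite -[y](subrK z).
apply: (subspaceD (Vs_subspace _)); first by apply: VsS Hy => i _; exact: sub.
have [gw|gw] := boolP (Q \in w); last first.
  by rewrite /z (count_memPn gw) mul0r scale0r; exact: (Vs_subspace _).1.
apply: (subspaceZ _ (Vs_subspace _)); apply: late_word; first exact: rem_neg.
by move=> j; rewrite (nW_rem gw) (nL_rem gw); lia.
Qed.

(** Both [W_n, L_(-m)] and [L_n, W_(-m)] are (n + m) W_(n-m) plus a central
    term. For m = n this is [gram n] up to higher W-degree; for m > n it has
    more W; for m < n the hypothesis on w applies. *)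
Lemma bracket_WL n m w : (0 < n)%N -> (0 < m)%N -> all isneg w ->
  (forall k, (0 < k)%N -> (k < n)%N -> Vs (late 1 0 (nW w) (nL w)) (act (W_ k%:Z) (wact w v))) ->
  Vs (late 1 0 (nW w) (nL w))
    ((n%:Z + m%:Z)%:~R *: act (W_ (n%:Z - m%:Z)) (wact w v)
      + cocycle K n%:Z (- m%:Z) *: act C_ (wact w v)
      - ((n == m)%:R * gram n) *: wact w v).
Proof.
move=> n0 m0 nw H; rewrite verma_C scalerA.
have [<-|nm] := eqVneq n m.
  rewrite mul1r /gram (subrr n%:Z) scale_gram; apply: (subspaceZ _ (Vs_subspace _)).
  by apply: VsS (verma_W0 nw) => i _; rewrite /late /moreW addn0 => ->.
rewrite mul0r scale0r subr0 /cocycle ifF; last by lia.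
rewrite mul0r scale0r addr0; apply: (subspaceZ _ (Vs_subspace _)).
have [lt_mn|lt_nm|] := ltngtP m n; last by lia.
  have -> : n%:Z - m%:Z = (n - m)%N%:Z by lia.
  by apply: H; lia.
have -> : n%:Z - m%:Z = - (m - n)%N%:Z by lia.
have k0 : (0 < m - n)%N by lia.
rewrite -wact_cons; apply: late_word; first by rewrite /= isneg_W.
by move=> k _; rewrite nW_cons cW_W //; lia.
Qed.

Lemma rem_comb (M : lmodType K) (k a : K) (x y : M) :
  (k * a) *: x + a *: y - ((1 + k) * a) *: y = (k * a) *: (x - y).
Proof.
by rewrite mulrDl mul1r scalerDl scalerBr opprD addrA addrK.
Qed.

Lemma rem_step (Q g : gen) (a : K) w : isneg g -> all isneg w ->
  Vs (fun i => (g == Q) && lower_terms w i)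
    (((count_mem Q w)%:R * a) *: wact (g :: rem Q w) v + ((g == Q)%:R * a) *: wact w v
      - ((count_mem Q (g :: w))%:R * a) *: wact (rem Q (g :: w)) v).
Proof.
move=> ng nw.
have -> : count_mem Q (g :: w) = ((g == Q) + count_mem Q w)%N by [].
have -> : rem Q (g :: w) = if g == Q then w else g :: rem Q w by [].
case: eqP => [gQ|_]; last first.
  by rewrite mul0r scale0r addr0 add0n subrr; exact: (Vs_subspace _).1.
rewrite natrD mul1r (rem_comb (count_mem Q w)%:R).
have [Qw|Qw] := boolP (Q \in w); last first.
  by rewrite (count_memPn Qw) mul0r scale0r; exact: (Vs_subspace _).1.
apply: (subspaceZ _ (Vs_subspace _)).
have gw : all isneg (g :: rem Q w) by rewrite /= ng rem_neg.
by apply: (word_perm gw); rewrite gQ perm_sym perm_to_rem.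
Qed.

Lemma split3 (M : zmodType) (a p q y z : M) :
  a + y - z = (a - p) + (y - q) + (p + q - z).
Proof. by rewrite [X in X + (_ - z)]addrACA -opprD addrA subrK. Qed.

(** The Leibniz rule for the derivation that replaces the letter Q by a. *)
Lemma posn_split (Q g : gen) (a : K) (x y : V) w :
  act g x + y - ((count_mem Q (g :: w))%:R * a) *: wact (rem Q (g :: w)) v =
  act g (x - ((count_mem Q w)%:R * a) *: wact (rem Q w) v)
  + (y - ((g == Q)%:R * a) *: wact w v)
  + (((count_mem Q w)%:R * a) *: wact (g :: rem Q w) v + ((g == Q)%:R * a) *: wact w v
      - ((count_mem Q (g :: w))%:R * a) *: wact (rem Q (g :: w)) v).
Proof.
by rewrite actD actN actZ wact_cons; apply: split3.
Qed.

Lemma verma_pos n : (0 < n)%N -> act (L_ n%:Z) v = 0 /\ act (W_ n%:Z) v = 0.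
Proof.
case: n => // n _; split.
  by rewrite (verma_highest c h hW (isT : ~~ isneg (L_ n.+1%:Z))) /= scale0r.
by rewrite (verma_highest c h hW (isT : ~~ isneg (W_ n.+1%:Z))) /= scale0r.
Qed.

(** To leading order W_n is a derivation killing every letter but L_(-n): moved
    through the word to v, it only survives by its bracket with L_(-n), as its
    bracket with another L_(-m) is a multiple of W_(n-m), which for m > n adds a W
    to the word and for m < n has to meet a second L. *)
Lemma posW_lead n w : (0 < n)%N -> all isneg w ->
  Vs (late 2 0 (nW w) (nL w)) (act (W_ n%:Z) (wact w v)
     - ((count_mem (L_ (- n%:Z)) w)%:R * gram n) *: wact (rem (L_ (- n%:Z)) w) v).
Proof.
elim: w n => [|g w IH] n n0 nw.
  rewrite mul0r scale0r subr0 (verma_pos n0).2; exact: (Vs_subspace _).1.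
move: nw => /= /andP[ng nw].
have weak k : (0 < k)%N -> Vs (late 1 0 (nW w) (nL w)) (act (W_ k%:Z) (wact w v)).
  move=> k0; have := lead_weaken nw _ (IH k k0 nw); rewrite cW_L // cL_L //.
  by apply=> s t i; rewrite /late; lia.
rewrite wact_cons actB (posn_split (L_ (- n%:Z))).
apply: (subspaceD (Vs_subspace _)); first apply: (subspaceD (Vs_subspace _)).
- apply: VsS (late_neg ng (IH n n0 nw)) => i _.
  by rewrite nW_cons nL_cons (addnC (cW g)) (addnC (cL g)).
- have [m m0 [eg|eg]] := neg_letter ng; rewrite eg /bracketL; last first.
    rewrite (_ : (_ == _) = false); last by apply/eqP.
    by rewrite mul0r scale0r subrr; exact: (Vs_subspace _).1.
  have -> : (L_ (- m%:Z) == L_ (- n%:Z)) = (n == m).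
    by apply/eqP/eqP => [[]|->] //; lia.
  rewrite opprK; apply: VsS (bracket_WL n0 m0 nw (fun k k0 _ => weak k k0)) => i _.
  rewrite nW_cons nL_cons cW_L // cL_L // /late; lia.
- apply: VsS (rem_step ng nw) => i _.
  rewrite /lower_terms /late nW_cons nL_cons => /andP[/eqP-> /and4P[_ /eqP-> i2 _]].
  by rewrite cW_L // cL_L //; lia.
Qed.

End VermaFiltration.

Section LeadingTerms.
Variables (K : fieldType) (c h hW : K).
Local Notation bip := (seq nat * seq nat)%type.
Local Notation coords := {malg K[bip]}.
Local Notation V := (verma c h hW).
Local Notation v := (verma_vector c h hW).
Local Notation tau := (tau c h hW).
Local Notation coord := (@vcoord K c h hW).
Local Notation base i := (wact (wmono i) v).
Local Notation Vs := (@Vs K c h hW).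
Local Notation gram := (gram c hW).
Local Notation sVs := (@Vs_subspace K c h hW).

Lemma posW_weak n w : (0 < n)%N -> all isneg w ->
  Vs (late 1 0 (nW w) (nL w)) (act (W_ n%:Z) (wact w v)).
Proof.
move=> n0 nw; have := lead_weaken nw _ (posW_lead n0 nw); rewrite cW_L // cL_L //.
by apply=> s t i; rewrite /late; lia.
Qed.

(** To leading order L_n is a derivation killing every letter but W_(-n). A
    bracket [L_n, L_(-m)] is an L again, so it loses L-degree without losing
    W-degree. *)
Lemma posL_lead n w : (0 < n)%N -> all isneg w ->
  Vs (late 1 1 (nW w) (nL w)) (act (L_ n%:Z) (wact w v)
     - ((count_mem (W_ (- n%:Z)) w)%:R * gram n) *: wact (rem (W_ (- n%:Z)) w) v).
Proof.
elim: w n => [|g w IH] n n0 nw.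
  rewrite mul0r scale0r subr0 (verma_pos c h hW n0).1; exact: (sVs _).1.
move: nw => /= /andP[ng nw].
have weak k : (0 < k)%N -> Vs (late 0 1 (nW w) (nL w)) (act (L_ k%:Z) (wact w v)).
  move=> k0; have := lead_weaken nw _ (IH k k0 nw); rewrite cW_W // cL_W //.
  by apply=> s t i; rewrite /late; lia.
rewrite wact_cons actB (posn_split (W_ (- n%:Z))).
apply: (subspaceD (sVs _)); first apply: (subspaceD (sVs _)).
- apply: VsS (late_neg ng (IH n n0 nw)) => i _.
  by rewrite nW_cons nL_cons (addnC (cW g)) (addnC (cL g)).
- have [m m0 [eg|eg]] := neg_letter ng; rewrite eg /bracketL.
    rewrite (_ : (_ == _) = false); last by apply/eqP.
    rewrite mul0r scale0r subr0 opprK verma_C scalerA.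
    apply: (subspaceD (sVs _)); apply: (subspaceZ _ (sVs _)); last first.
      apply: late_word nw _ => k _.
      by rewrite nW_cons nL_cons cW_L // cL_L //; lia.
    have [lt_mn|lt_nm|->] := ltngtP m n.
    + have -> : n%:Z - m%:Z = (n - m)%N%:Z by lia.
      apply: VsS (weak _ _) => [i _|]; last by lia.
      by rewrite nW_cons nL_cons cW_L // cL_L // /late; lia.
    + have -> : n%:Z - m%:Z = - (m - n)%N%:Z by lia.
      rewrite -wact_cons; apply: late_word; first by rewrite /= isneg_L //; lia.
      by move=> k _; rewrite !nW_cons !nL_cons !cW_L //; lia.
    + rewrite subrr verma_L0 //; apply: (subspaceZ _ (sVs _)).
      apply: late_word nw _ => k _.
      by rewrite nW_cons nL_cons cW_L // cL_L //; lia.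
  have -> : (W_ (- m%:Z) == W_ (- n%:Z)) = (n == m).
    by apply/eqP/eqP => [[]|->] //; lia.
  rewrite opprK.
  apply: VsS (bracket_WL n0 m0 nw (fun k k0 _ => posW_weak k0 nw)) => i _.
  by rewrite nW_cons nL_cons cW_W // cL_W // /late; lia.
- apply: VsS (rem_step ng nw) => i _.
  rewrite /lower_terms /late nW_cons nL_cons => /andP[/eqP-> /and4P[_ /eqP-> i2 _]].
  by rewrite cW_W // cL_W //; lia.
Qed.

Lemma posL_weak n w : (0 < n)%N -> all isneg w ->
  Vs (late 0 1 (nW w) (nL w)) (act (L_ n%:Z) (wact w v)).
Proof.
move=> n0 nw; have := lead_weaken nw _ (posL_lead n0 nw); rewrite cW_W // cL_W //.
by apply=> s t i; rewrite /late; lia.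
Qed.

(** * Coordinates of the leading terms *)

Lemma vcoord_sum (I : Type) (r : seq I) (P : pred I) (F : I -> V) j :
  (coord (\sum_(i <- r | P i) F i))@_j = \sum_(i <- r | P i) (coord (F i))@_j.
Proof.
elim/big_rec2: _ => [|i a b _ <-]; first by rewrite vcoord0 mcoeff0.
by rewrite vcoordD mcoeffD.
Qed.

Lemma coord_delta (f : {linear V -> V}) x i j (k : bip -> K) :
  (forall i', i' \in msupp (coord x) -> (coord (f (base i')))@_j = k i' * (i' == i)%:R) ->
  (coord (f x))@_j = (coord x)@_i * k i.
Proof.
move=> H; rewrite -{1}(coordK x) /pact /lext linear_sum vcoord_sum.
transitivity (\sum_(i' <- msupp (coord x)) (coord x)@_i' * (k i' * (i' == i)%:R)).
  rewrite big_seq [RHS]big_seq; apply: eq_bigr => i' ix.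
  by rewrite linearZ vcoordZ mcoeffZ H.
have [ix|ix] := boolP (i \in msupp (coord x)).
  rewrite (bigD1_seq i) ?fset_uniq //= eqxx mulr1 big1 ?addr0 // => i' /negPf->.
  by rewrite !mulr0.
rewrite (mcoeff_outdom ix) mul0r big1_seq // => i' /andP[_ i'x].
by case: eqP => [e|_]; [rewrite -e i'x in ix|rewrite !mulr0].
Qed.

Lemma Vs_coord0 P x i : Vs P x -> ~~ P i -> (coord x)@_i = 0.
Proof. exact: supportedP. Qed.

Lemma mem_wmono_W n i : is_bipartition i -> (0 < n)%N ->
  count_mem (W_ (- n%:Z)) (wmono i) = count_mem n i.1.
Proof.
case: i => ms ns ip n0; rewrite /wmono count_cat !count_map.
rewrite [X in (_ + X)%N](_ : _ = 0%N) ?addn0.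
  by apply: eq_count => m /=; apply/eqP/eqP => [[]|->] //; lia.
by apply/eqP; rewrite -leqn0 leqNgt -has_count; apply/hasP => -[].
Qed.

Lemma mem_wmono_L n i : is_bipartition i -> (0 < n)%N ->
  count_mem (L_ (- n%:Z)) (wmono i) = count_mem n i.2.
Proof.
case: i => ms ns ip n0; rewrite /wmono count_cat !count_map.
rewrite [X in (X + _)%N](_ : _ = 0%N) ?add0n.
  by apply: eq_count => m /=; apply/eqP/eqP => [[]|->] //; lia.
by apply/eqP; rewrite -leqn0 leqNgt -has_count; apply/hasP => -[].
Qed.

Lemma rem_map_inj (T U : eqType) (f : T -> U) x s : injective f ->
  rem (f x) (map f s) = map f (rem x s).
Proof.
by move=> fi; elim: s => //= y s IH; rewrite (inj_eq fi); case: eqP => //= _; rewrite IH.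
Qed.

Lemma rem_wmono_W n i : n \in i.1 ->
  rem (W_ (- n%:Z)) (wmono i) = wmono (rem n i.1, i.2).
Proof.
have fi : injective (fun m : nat => W_ (- m%:Z)) by move=> a b []; lia.
case: i => ms ns /= nms; rewrite /wmono /= -(rem_map_inj _ _ fi).
have : W_ (- n%:Z) \in [seq W_ (- m%:Z) | m <- ms] by apply/mapP; exists n.
elim: (map _ ms) => //= y s IH; rewrite inE eq_sym; case: eqP => //= _ /IH ->//.
Qed.

Lemma rem_wmono_L n i :
  rem (L_ (- n%:Z)) (wmono i) = wmono (i.1, rem n i.2).
Proof.
have fi : injective (fun m : nat => L_ (- m%:Z)) by move=> a b []; lia.
case: i => ms ns; rewrite /wmono /= -(rem_map_inj _ _ fi).
by elim: ms => //= m ms <-.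
Qed.

Lemma partition_rem n s : is_partition s -> is_partition (rem n s).
Proof.
rewrite /is_partition => /andP[ss /allP ps]; apply/andP; split.
  exact: (subseq_sorted geq_trans (rem_subseq n s)).
by apply/allP => x /mem_rem /ps.
Qed.

Lemma partition_rem_inj n s t : is_partition s -> is_partition t ->
  n \in s -> n \in t -> rem n s = rem n t -> s = t.
Proof.
move=> /andP[ss _] /andP[st _] ns nt e.
apply: (sorted_eq geq_trans geq_anti) => //.
by rewrite (perm_trans (perm_to_rem ns)) // e perm_sym perm_to_rem.
Qed.

Lemma coordE_base i j : is_bipartition i -> (coord (base i))@_j = (i == j)%:R.
Proof. by move=> ip; rewrite coord_base // mcoeffU. Qed.

(** Removing n from the W-part is injective on the bipartitions where n occurs,
    so the leading coefficients of L_n x do not mix. *)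
Lemma coord_posL n x i : (0 < n)%N -> is_bipartition i -> n \in i.1 ->
  Vs (late 0 0 (size i.1) (size i.2)) x ->
  (coord (act (L_ n%:Z) x))@_(rem n i.1, i.2) =
    (coord x)@_i * ((count_mem n i.1)%:R * gram n).
Proof.
move=> n0 ip ni xs; apply: (coord_delta (k := fun j => (count_mem n j.1)%:R * gram n)) => j jx /=.
have jp := coord_bipartition jx; have js := xs j jx.
rewrite -[act _ _](subrK (((count_mem (W_ (- n%:Z)) (wmono j))%:R * gram n)
   *: wact (rem (W_ (- n%:Z)) (wmono j)) v)).
rewrite vcoordD mcoeffD vcoordZ mcoeffZ.
rewrite (Vs_coord0 (posL_lead n0 (wmono_neg jp))) ?add0r; last first.
  move: js; rewrite /late nW_wmono // nL_wmono // size_rem //=.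
  have : (0 < size i.1)%N by case: (i.1) ni.
  lia.
rewrite mem_wmono_W //; have [nj|nj] := boolP (n \in j.1); last first.
  by rewrite (count_memPn nj) !mul0r.
rewrite rem_wmono_W // coordE_base; last first.
  by move: jp; rewrite /is_bipartition /= => /andP[/(partition_rem n)-> ->].
congr (_ * _%:R); congr nat_of_bool; apply/eqP/eqP => [|->] //.
case: i j ip jp ni nj {xs jx js} => ms ns [ms' ns'] /andP[/= pm _] /andP[/= pm' _] nm nm' [e ->].
by rewrite (partition_rem_inj pm' pm nm' nm e).
Qed.

Lemma coord_posW n x i : (0 < n)%N -> is_bipartition i -> n \in i.2 ->
  Vs (late 0 0 (size i.1) (size i.2)) x ->
  (coord (act (W_ n%:Z) x))@_(i.1, rem n i.2) =
    (coord x)@_i * ((count_mem n i.2)%:R * gram n).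
Proof.
move=> n0 ip ni xs; apply: (coord_delta (k := fun j => (count_mem n j.2)%:R * gram n)) => j jx /=.
have jp := coord_bipartition jx; have js := xs j jx.
rewrite -[act _ _](subrK (((count_mem (L_ (- n%:Z)) (wmono j))%:R * gram n)
   *: wact (rem (L_ (- n%:Z)) (wmono j)) v)).
rewrite vcoordD mcoeffD vcoordZ mcoeffZ.
rewrite (Vs_coord0 (posW_lead n0 (wmono_neg jp))) ?add0r; last first.
  move: js; rewrite /late nW_wmono // nL_wmono // size_rem //=.
  have : (0 < size i.2)%N by case: (i.2) ni.
  lia.
rewrite mem_wmono_L //; have [nj|nj] := boolP (n \in j.2); last first.
  by rewrite (count_memPn nj) !mul0r.
rewrite rem_wmono_L // coordE_base; last first.
  by move: jp; rewrite /is_bipartition /= => /andP[-> /(partition_rem n)->].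
congr (_ * _%:R); congr nat_of_bool; apply/eqP/eqP => [|->] //.
case: i j ip jp ni nj {xs jx js} => ms ns [ms' ns'] /andP[/= _ pm] /andP[/= _ pm'] nm nm' [-> e].
by rewrite (partition_rem_inj pm' pm nm' nm e).
Qed.

End LeadingTerms.

(** * The radical of the Verma module *)

Section Radical.
Variables (K : fieldType) (c h hW : K).
Hypothesis char0 : [pchar K] =i pred0.
Local Notation bip := (seq nat * seq nat)%type.
Local Notation V := (verma c h hW).
Local Notation v := (verma_vector c h hW).
Local Notation coord := (@vcoord K c h hW).
Local Notation base i := (wact (wmono i) v).
Local Notation Vs := (@Vs K c h hW).
Local Notation sVs := (@Vs_subspace K c h hW).
Local Notation gram := (gram c hW).
Local Notation vac := ([::] : seq nat, [::] : seq nat).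

Lemma natr_neq0 n : (0 < n)%N -> n%:R != 0 :> K.
Proof. by rewrite ((pcharf0P K).1 char0) -lt0n. Qed.

Lemma natr_inj (m n : nat) : m%:R = n%:R :> K -> m = n.
Proof.
wlog le_mn : m n / (m <= n)%N => [H|e].
  by case: (leqP m n) => [/H//|/ltnW /H] h' /esym/h'.
apply/eqP; rewrite eqn_leq le_mn /= -subn_eq0 -((pcharf0P K).1 char0).
by rewrite natrB // e subrr.
Qed.

Lemma gramE n : (0 < n)%N ->
  gram n = n%:R * (2%:R * hW + (n%:R ^+ 2 - 1) / 12%:R * c).
Proof.
move=> n0; rewrite /gram /cocycle opprK eqxx.
rewrite !(intrD, intrB, rmorphXn) /= -!pmulrn.
by move: (12%:R^-1 : K) => t; ring.
Qed.

Lemma gram_eq0 n : (0 < n)%N -> gram n = 0 <-> critical c hW n.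
Proof.
move=> n0; rewrite gramE //; split=> [/eqP|[_ ->]]; last by rewrite mulr0.
by rewrite mulf_eq0 (negPf (natr_neq0 n0)) /= => /eqP; split.
Qed.

(** For c nonzero the equation determines p^2; for c = 0 it says h_W = 0. *)
Lemma critical_uniq p q : (c != 0) || (hW != 0) ->
  critical c hW p -> critical c hW q -> p = q.
Proof.
move=> chW [p0 ep] [q0 eq].
have n12 : 12%:R != 0 :> K by apply: natr_neq0.
have c0 : c != 0.
  case/orP: chW => // w0; apply/eqP => c0; move: ep; rewrite c0 mulr0 addr0 => /eqP.
  by rewrite mulf_eq0 (negPf w0) orbF (negPf (natr_neq0 _)).
have /eqP : (p%:R ^+ 2 - q%:R ^+ 2) / 12%:R * c = 0 :> K.
  transitivity ((2%:R * hW + (p%:R ^+ 2 - 1) / 12%:R * c)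
                - (2%:R * hW + (q%:R ^+ 2 - 1) / 12%:R * c)).
    by move: (12%:R^-1 : K) => t; ring.
  by rewrite ep eq subrr.
rewrite !mulf_eq0 (negPf c0) invr_eq0 (negPf n12) !orbF subr_eq0 => /eqP.
by rewrite -!natrX => /natr_inj /eqP; rewrite eqn_exp2r // => /eqP.
Qed.

Lemma base_ind (N : set V) : subspace N ->
  (forall i, is_bipartition i -> N (base i)) -> forall x, N x.
Proof.
move=> sN Nb x; rewrite -(coordK x) /pact /lext; apply: (subspace_sum_seq sN) => i ix _.
by apply: (subspaceZ _ sN); apply: Nb; exact: coord_bipartition ix.
Qed.

Lemma wti_eq0 i : is_bipartition i -> wti i = 0%N -> i = vac.
Proof.
case: i => ms ns /andP[/= /andP[_ pm] /andP[_ pn]]; rewrite /wti /= => e.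
have nil s : all (leq 1) s -> sumn s = 0%N -> s = [::] by case: s => //= a s /andP[]; lia.
have e1 : sumn ms = 0%N by lia.
have e2 : sumn ns = 0%N by lia.
by rewrite (nil ms pm e1) (nil ns pn e2).
Qed.

(** The coordinate along the highest weight vector. *)
Definition eps (x : V) : K := (coord x)@_vac.

Lemma epsD x y : eps (x + y) = eps x + eps y.
Proof. by rewrite /eps vcoordD mcoeffD. Qed.
Lemma epsZ k x : eps (k *: x) = k * eps x.
Proof. by rewrite /eps vcoordZ mcoeffZ. Qed.
Lemma eps0 : eps 0 = 0.
Proof. by rewrite /eps vcoord0 mcoeff0. Qed.
Lemma eps_v : eps v = 1.
Proof. by rewrite /eps -[v]/(base vac) coordE_base // eqxx. Qed.

Lemma eps_lin a x y : eps (a *: x + y) = a * eps x + eps y.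
Proof. by rewrite epsD epsZ. Qed.

Lemma coord_lin a x y i : (coord (a *: x + y))@_i = a * (coord x)@_i + (coord y)@_i.
Proof. by rewrite vcoordD vcoordZ mcoeffD mcoeffZ. Qed.

Lemma form_subspace (phi psi : V -> K) l :
  (forall a x y, phi (a *: x + y) = a * phi x + phi y) ->
  (forall a x y, psi (a *: x + y) = a * psi x + psi y) ->
  subspace [set x | phi x = l * psi x].
Proof.
move=> phiL psiL; have z (f : V -> K) : (forall a x y, f (a *: x + y) = a * f x + f y) ->
    f 0 = 0.
  move=> fL; have := fL (-1) 0 0; rewrite scaler0 addr0 mulN1r addNr //.
split=> [|a x y /= ex ey]; first by rewrite /= (z _ phiL) (z _ psiL) mulr0.
by rewrite phiL psiL ex ey mulrDr mulrCA.
Qed.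

Lemma form_ker (phi : V -> K) :
  (forall a x y, phi (a *: x + y) = a * phi x + phi y) -> subspace [set x | phi x = 0].
Proof.
move=> phiL; split=> [|a x y /= ex ey]; last by rewrite phiL ex ey mulr0 addr0.
by rewrite /=; have := phiL (-1) 0 0; rewrite scaler0 addr0 mulN1r addNr.
Qed.

Lemma eps_subspace g k : subspace [set x : V | eps (act g x) = k * eps x].
Proof.
apply: form_subspace => a x y; last exact: eps_lin.
by rewrite act_linear eps_lin.
Qed.

Lemma gwt_neg g : isneg g -> (0 < gwt g)%N.
Proof.
move=> ng; have [n n0 eg] := neg_letter ng; have hn : - n%:Z < 0 by lia.
by case: eg => ->; rewrite /gwt /= hn /=; lia.
Qed.

Lemma eps_neg g x : isneg g -> eps (act g x) = 0.
Proof.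
move=> ng; suff : Vs (fun i => i != vac) (act g x).
  by move=> /Vs_coord0; apply; rewrite negbK.
have : Vs predT x by [].
apply: (Vs_op (f := act g)) => i ip _; rewrite /= -wact_cons.
have nw : all isneg (g :: wmono i) by rewrite /= ng wmono_neg.
apply: VsS (word_mem nw) => j _ /and4P[_ _ _ /eqP].
by rewrite wt_cons; case: eqP => // ->; rewrite /wti /=; have := gwt_neg ng; lia.
Qed.

Lemma coord_L0 x i : (coord (act (L_ 0) x))@_i = (h + (wti i)%:R) * (coord x)@_i.
Proof.
pose N : set V := [set x | (coord (act (L_ 0) x))@_i = (h + (wti i)%:R) * (coord x)@_i].
have sN : subspace N.
  by apply: form_subspace => a y z; rewrite ?act_linear coord_lin.
apply: (base_ind sN) => j jp.
rewrite /N /= verma_L0 ?wmono_neg // vcoordZ mcoeffZ coordE_base //.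
by case: eqP => [<-|_]; rewrite ?mulr0 // wt_wmono.
Qed.

Lemma eps_zero g x : g \in [:: L_ 0; W_ 0; C_] -> eps (act g x) = chi c h hW g * eps x.
Proof.
rewrite !inE => /or3P[]/eqP-> /=.
- by rewrite /eps coord_L0 addr0.
- apply: (base_ind (eps_subspace (W_ 0) hW)) => i ip /=.
  rewrite -[act _ _](subrK (hW *: base i)) epsD epsZ /eps.
  rewrite (Vs_coord0 (verma_W0 (wmono_neg ip))) ?add0r //.
- by rewrite verma_C epsZ.
Qed.

Opaque eps.

(** The radical: the elements from which the highest weight vector cannot be
    reached. *)
Definition radical : set V := [set x | forall w, eps (wact w x) = 0].

Lemma radical_submodule : submodule radical.
Proof.
split; first split.
- by move=> w; rewrite wact0 eps0.
- by move=> a x y Jx Jy w; rewrite wactD wactZ epsD epsZ Jx Jy mulr0 addr0.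
- by move=> g x Jx w; have := Jx (rcons w g); rewrite -cats1 wact_cat.
Qed.

Lemma radicalNv : ~ radical v.
Proof. by move=> /(_ [::]) /eqP; rewrite eps_v oner_eq0. Qed.

Lemma eps_bracketL (F : gen -> V) x y :
  (forall g, eps (F g) = 0) -> eps (bracketL F x y) = 0.
Proof.
move=> F0; exact: (subspace_bracketL x y (form_ker eps_lin) F0).
Qed.

(** In a word that leads from x to v, the leftmost letter cannot be negative and
    a zero mode only contributes a scalar, while a positive letter can be moved
    through the word until it hits x; the commutators are shorter words. *)
Lemma radical_pos x : eps x = 0 ->
  (forall n, (0 < n)%N -> radical (act (L_ n%:Z) x) /\ radical (act (W_ n%:Z) x)) ->
  radical x.
Proof.
move=> ex px w; have [n] := ubnP (size w).
elim: n w => [w|n IH [|g w]]; [rewrite ltn0; discriminate|by move=> _; rewrite wact_nil; exact: ex|].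
rewrite ltnS => /= sw; rewrite wact_cons.
have [ng|ng] := boolP (isneg g); first exact: eps_neg.
have [g0|g0] := boolP (g \in [:: L_ 0; W_ 0; C_]).
  by rewrite (eps_zero _ g0) (IH w sw) mulr0.
have Jg : radical (act g x).
  case: g ng g0 {sw} => [[m|m]|[m|m]|] //.
    move=> _; rewrite !inE => m0; have m1 : (0 < m)%N by case: m m0.
    exact: (px m m1).1.
  move=> _; rewrite !inE => m0; have m1 : (0 < m)%N by case: m m0.
  exact: (px m m1).2.
suff H w1 w2 : (size w1 + size w2 <= size w)%N -> eps (wact w1 (act g (wact w2 x))) = 0.
  by have := H [::] w (leqnn _); rewrite wact_nil.
elim: w2 w1 => [|y w2 IH2] w1 le_w; first by rewrite wact_nil; exact: Jg.
rewrite wact_cons actB wactD epsD -[act y _]wact1 -wact_cat.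
have s1 : (size (w1 ++ [:: y]) + size w2 <= size w)%N.
  by rewrite size_cat /=; move: le_w => /=; lia.
rewrite (IH2 _ s1) add0r bracketL_linear; apply: eps_bracketL => g' /=.
rewrite -wact_cons -wact_cat; apply: IH; rewrite size_cat /=.
by move: le_w => /=; lia.
Qed.

(** * Weights *)

Definition homog (k : nat) : set V := Vs (fun i => wti i == k).

(** The projection on the weight space of weight h + k. *)
Definition wproj (k : nat) (x : V) : V :=
  \sum_(i <- msupp (coord x) | wti i == k) (coord x)@_i *: base i.

Lemma homog_base i : is_bipartition i -> homog (wti i) (base i).
Proof. by move=> ip; apply: Vs_base ip _ => /=; exact: eqxx. Qed.

Lemma wproj_homog k x : homog k (wproj k x).
Proof.
rewrite /homog /wproj; apply: (subspace_sum_seq (sVs _)) => i ix /eqP <-.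
apply: (subspaceZ _ (sVs _)); apply: homog_base; exact: coord_bipartition ix.
Qed.

Lemma coord_wproj k x i : (coord (wproj k x))@_i = if wti i == k then (coord x)@_i else 0.
Proof.
rewrite /wproj vcoord_sum; case: ifP => [wi|wi]; last first.
  rewrite big1_seq // => j /andP[/eqP wj jx].
  rewrite vcoordZ mcoeffZ coordE_base ?(coord_bipartition jx) //.
  by case: eqP => [ji|_]; rewrite ?mulr0 //; rewrite -ji wj eqxx in wi.
rewrite -{3}(coordK x) /pact /lext vcoord_sum [RHS](bigID (fun j => wti j == k)) /=.
rewrite [X in _ + X]big1_seq ?addr0 // => j /andP[wj jx].
rewrite vcoordZ mcoeffZ coordE_base ?(coord_bipartition jx) //.
by case: eqP => [ji|_]; rewrite ?mulr0 //; rewrite ji wi in wj.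
Qed.

Lemma coord_eq x y : (forall i, (coord x)@_i = (coord y)@_i) -> x = y.
Proof.
move=> e; rewrite -(coordK x) -(coordK y); congr (pact _ _); apply/malgP => i; exact: e.
Qed.

Lemma wproj_id k x : homog k x -> wproj k x = x.
Proof.
move=> hx; apply: coord_eq => i; rewrite coord_wproj; case: ifP => // wi.
by rewrite (Vs_coord0 hx) ?wi.
Qed.

Lemma wproj_sum x : exists B, x = \sum_(k < B) wproj k x.
Proof.
exists (\max_(i <- msupp (coord x)) (wti i).+1)%N; apply: coord_eq => i.
rewrite vcoord_sum; have [ix|ix] := boolP (i \in msupp (coord x)); last first.
  rewrite (mcoeff_outdom ix) big1 // => k _; rewrite coord_wproj (mcoeff_outdom ix).
  by case: ifP.
have iB : (wti i < \max_(i <- msupp (coord x)) (wti i).+1)%N.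
  by rewrite (big_rem i) //= leq_max ltnS leqnn.
rewrite (bigD1 (Ordinal iB)) //= coord_wproj eqxx big1 ?addr0 // => k kB.
by rewrite coord_wproj ifF //; apply: contraNF kB => /eqP e; apply/eqP/val_inj; rewrite /= e.
Qed.

Lemma homog_L0 k x : homog k x -> act (L_ 0) x = (h + k%:R) *: x.
Proof.
move=> hx; apply: coord_eq => i; have e1 := coord_L0 x i.
have e2 : (coord ((h + k%:R) *: x))@_i = (h + k%:R) * (coord x)@_i.
  by rewrite vcoordZ mcoeffZ.
apply: (etrans e1); apply: (etrans _ (esym e2)).
have [->|wi] := eqVneq (wti i) k; first reflexivity.
by rewrite (Vs_coord0 hx wi) !mulr0.
Qed.

Lemma L0_coord mu x i : act (L_ 0) x = (h + mu) *: x ->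
  i \in msupp (coord x) -> (wti i)%:R = mu.
Proof.
move=> Lx ix; have : (coord (act (L_ 0) x))@_i = (coord ((h + mu) *: x))@_i by rewrite Lx.
rewrite coord_L0 vcoordZ mcoeffZ => /mulIf e; apply: (addrI h); apply: e.
by rewrite mcoeff_neq0.
Qed.

(** A subspace stable under f contains the eigenvector components of its
    elements: f minus an eigenvalue removes one component and rescales the
    others. *)
Lemma eigen_split (M : lmodType K) (N : set M) (f : {linear M -> M}) (y : nat -> M) s :
  subspace N -> (forall x, N x -> N (f x)) -> uniq s ->
  (forall k, f (y k) = (h + k%:R) *: y k) ->
  N (\sum_(k <- s) y k) -> forall k, k \in s -> N (y k).
Proof.
move=> sN Nf us fy; elim: s us => // k0 s IH /= /andP[k0s us] in y fy *.
rewrite big_cons => Ns; have Ns' k : k \in s -> N (y k).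
  move=> ks; have kk0 : k%:R - k0%:R != 0 :> K.
    by rewrite subr_eq0; apply: contraNneq k0s => /natr_inj <-.
  rewrite -[y k](scalerK kk0); apply: (subspaceZ _ sN).
  apply: (IH us (fun k => (k%:R - k0%:R) *: y k)) ks => [j|].
    by rewrite linearZ /= fy !scalerA mulrC.
  have -> : \sum_(j <- s) (j%:R - k0%:R) *: y j =
      f (y k0 + \sum_(j <- s) y j) - (h + k0%:R) *: (y k0 + \sum_(j <- s) y j).
    rewrite linearD /= fy scalerDr opprD addrACA subrr add0r linear_sum scaler_sumr.
    rewrite -sumrB; apply: eq_bigr => j _; rewrite fy -scalerBl.
    by congr (_ *: _); rewrite opprD addrACA subrr add0r.
  by apply: (subspaceB sN); [exact: Nf|exact: (subspaceZ _ sN)].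
move=> k; rewrite inE => /orP[/eqP->|/Ns'//].
have -> : y k0 = (y k0 + \sum_(j <- s) y j) - \sum_(j <- s) y j by rewrite addrK.
apply: (subspaceB sN) => //; apply: (subspace_sum_seq sN) => j js _; exact: Ns'.
Qed.

Lemma submodule_wproj (N : set V) k x : submodule N -> N x -> N (wproj k x).
Proof.
move=> sN Nx; have [B eB] := wproj_sum x.
have NB j : (j < B)%N -> N (wproj j x).
  move=> jB; apply: (@eigen_split V N (act (L_ 0)) (wproj^~ x) (index_iota 0 B)).
  - exact: sN.1.
  - by move=> z; apply: sN.2.
  - exact: iota_uniq.
  - by move=> i; apply: homog_L0; exact: wproj_homog.
  - by rewrite big_mkord -eB.
  - by rewrite mem_index_iota.
have [kB|kB] := ltnP k B; first exact: NB.
suff -> : wproj k x = 0 by exact: sN.1.1.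
apply: coord_eq => i; rewrite coord_wproj vcoord0 mcoeff0; case: eqP => // wi.
rewrite eB vcoord_sum big1 // => j _; rewrite coord_wproj ifF // wi; apply/eqP.
by have := ltn_ord j; lia.
Qed.

Lemma wproj0E x : wproj 0 x = eps x *: v.
Proof.
apply: coord_eq => i; rewrite coord_wproj vcoordZ mcoeffZ -[v]/(base vac) coordE_base //.
have [<-|iv] := eqVneq vac i; first by rewrite mulr1.
rewrite mulr0; case: eqP => // wi; apply: mcoeff_outdom; apply/negP => ix.
by move: iv; rewrite -(wti_eq0 (coord_bipartition ix) wi) eqxx.
Qed.

(** If N were not in the radical, some element of N would have a nonzero
    component in weight h, hence v would be in N. *)
Lemma proper_radical (N : set V) : submodule N -> ~ N v -> N `<=` radical.
Proof.
move=> sN Nv x Nx w; apply/eqP; apply/negPn/negP => ew; apply: Nv.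
have Nw : N (wact w x) by elim: w {ew} => // g w IH; rewrite wact_cons; apply: sN.2.
have := submodule_wproj 0 sN Nw; rewrite wproj0E => Ne.
by rewrite -[v](scalerK ew); apply: (subspaceZ _ sN.1).
Qed.

End Radical.

(** * The irreducible quotient *)

Section QuotientFacts.
Variables (K : fieldType) (M : wmodule K) (N : set M) (sN : submodule N).

Lemma proj_eq0 x : proj sN x = 0 <-> N x.
Proof. exact: projV0. Qed.

Lemma proj_linear : linear (proj sN).
Proof. exact: projV_is_linear. Qed.

HB.instance Definition _ :=
  GRing.isLinear.Build K M (quot_module sN) _ (proj sN) proj_linear.

Lemma act_proj g x : act g (proj sN x) = proj sN (act g x).
Proof. exact: qactE. Qed.

Lemma proj_surj y : exists x, y = proj sN x.
Proof. by exists (repr y); rewrite /proj projVK. Qed.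

Lemma proj_preim (N' : set (quot_module sN)) : submodule N' ->
  submodule [set x | N' (proj sN x)].
Proof.
move=> sN'; split; first split.
- by rewrite /= linear0; exact: sN'.1.1.
- by move=> a x y Nx Ny; rewrite /= proj_linear; apply: sN'.1.2.
- by move=> g x Nx; rewrite /= -act_proj; apply: sN'.2.
Qed.

End QuotientFacts.

Section Kernel.
Variables (K : fieldType) (c h hW : K).
Hypothesis char0 : [pchar K] =i pred0.
Local Notation V := (verma c h hW).
Local Notation v := (verma_vector c h hW).
Local Notation radical := (@radical K c h hW).
Local Notation sR := (radical_submodule c h hW).

Lemma radical_irreducible : irreducible (quot_module sR).
Proof.
split; first exact: setT_submodule.
  exists (proj sR v) => //; apply/eqP => /proj_eq0; exact: radicalNv.
move=> N' sN' _; have sP := proj_preim sN'.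
have [Pv|Pv] := pselect (N' (proj sR v)); [right|left].
  apply/seteqP; split=> // y _; have [x ->] := proj_surj y.
  exact: (verma_ind sP Pv x).
have PR := proper_radical char0 sP Pv.
apply/seteqP; split=> y; last by move=> ->; exact: sN'.1.1.
by have [x ->] := proj_surj y; move=> Nx /=; apply/proj_eq0; apply: PR.
Qed.

(** The kernel is a proper submodule, hence in the radical; conversely the image
    of the radical in the irreducible quotient is not everything. *)
Lemma kernelE x : sval (irreducible_kernel V) x <-> radical x.
Proof.
rewrite /irreducible_kernel; case: pselect => [ex|[]]; last first.
  exists (exist _ _ sR); move: (svalP _) => /= s.
  by rewrite (Prop_irrelevance s sR); exact: radical_irreducible.
case: (cid ex) => -[N sN0] /=; move: (svalP _) => /= sN [_ [y _ y0] maxN].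
have Nv : ~ N v.
  move=> Nv; move/eqP: y0; apply; have [z ->] := proj_surj y.
  by apply/proj_eq0; exact: (verma_ind sN Nv z).
have NR := proper_radical char0 sN Nv.
split=> [/NR //|Rx].
pose N' : set (quot_module sN) := [set proj sN z | z in radical].
have sN' : submodule N'.
  split; first split.
  - by exists 0; [exact: sR.1.1|exact: linear0].
  - move=> a _ _ [z Rz <-] [t Rt <-]; exists (a *: z + t); first exact: sR.1.2.
    exact: proj_linear.
  - by move=> g _ [z Rz <-]; exists (act g z); [exact: sR.2|rewrite act_proj].
have [N'0|N'T] := maxN N' sN' (fun _ _ => I).
  have : N' (proj sN x) by exists x.
  by rewrite N'0 => /= /proj_eq0.
have [z Rz e] : N' (proj sN v) by rewrite N'T.
have Nzv : N (z - v) by apply/(proj_eq0 sN); rewrite linearB /= e subrr.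
have : radical (z - (z - v)) by exact: (subspaceB sR.1 Rz (NR _ Nzv)).
by rewrite subKr => /radicalNv.
Qed.

End Kernel.

(** * Leading monomials *)

Section Leading.
Variables (K : fieldType) (c h hW : K).
Hypothesis char0 : [pchar K] =i pred0.
Local Notation bip := (seq nat * seq nat)%type.
Local Notation coords := {malg K[bip]}.
Local Notation V := (verma c h hW).
Local Notation v := (verma_vector c h hW).
Local Notation coord := (@vcoord K c h hW).
Local Notation base i := (wact (wmono i) v).
Local Notation Vs := (@Vs K c h hW).
Local Notation sVs := (@Vs_subspace K c h hW).
Local Notation gram := (gram c hW).
Local Notation homog := (@homog K c h hW).
Local Notation radical := (@radical K c h hW).
Local Notation sR := (radical_submodule c h hW).

Lemma seq_min (T : eqType) (r : rel T) (s : seq T) : total r -> transitive r ->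
  s != [::] -> exists2 i, i \in s & forall j, j \in s -> r i j.
Proof.
move=> rt rtr; elim: s => // x s IH _; have [->|/IH[i ins ri]] := eqVneq s [::].
  by exists x; rewrite ?mem_head // => j; rewrite inE => /eqP->; have := rt x x; rewrite orbb.
have rr y : r y y by have := rt y y; rewrite orbb.
case/orP: (rt i x) => rix.
  by exists i; rewrite ?inE ?ins ?orbT // => j; rewrite inE => /orP[/eqP->|/ri].
exists x; rewrite ?mem_head // => j; rewrite inE => /orP[/eqP-> //|/ri].
exact: rtr.
Qed.

Lemma lead_malg (a : coords) : a != 0 -> exists2 i, i \in msupp a &
  forall j, j \in msupp a -> late 0 0 (size i.1) (size i.2) j.
Proof.
move=> a0; apply: (@seq_min _ (fun i j => late 0 0 (size i.1) (size i.2) j)).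
- by move=> i j; rewrite /late /=; lia.
- by move=> i j k; rewrite /late /=; lia.
apply: contra a0 => /eqP e; apply/eqP.
apply: (@supported0 _ _ pred0) => // i; rewrite -[_ \in _]/(i \in enum_fset _) e.
by [].
Qed.

Lemma lead_exists x : x <> 0 -> exists2 i, i \in msupp (coord x) &
  Vs (late 0 0 (size i.1) (size i.2)) x.
Proof.
move=> x0; apply: lead_malg; apply/eqP => cx; apply: x0; exact: coord_inj cx.
Qed.

Lemma late_posL n s t x : (0 < n)%N -> Vs (late 0 0 s t) x ->
  Vs (late 0 1 s t) (act (L_ n%:Z) x).
Proof.
move=> n0; apply: (Vs_op (f := act (L_ n%:Z))) => i ip Pi /=.
apply: VsS (posL_weak n0 (wmono_neg ip)) => j _; move: Pi.
by rewrite /late nW_wmono // nL_wmono //; lia.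
Qed.

Lemma homog_eig k x : act (L_ 0) x = (h + k%:R) *: x -> homog k x.
Proof. by move=> Lx i ix; apply/eqP/(natr_inj char0)/(L0_coord Lx ix). Qed.

Lemma homog_pos k n x g : g = L_ n%:Z \/ g = W_ n%:Z -> (0 < n)%N -> homog k x ->
  ((n <= k)%N -> homog (k - n) (act g x)) /\ ((k < n)%N -> act g x = 0).
Proof.
move=> eg n0 hx; have Lg : act (L_ 0) (act g x) = (h + (k%:R - n%:R)) *: act g x.
  have cc : cocycle K 0 n%:Z = 0 by rewrite /cocycle ifF //; lia.
  rewrite actB (homog_L0 hx) actZ addrA [RHS]scalerBl; congr (_ + _).
  case: eg => ->; rewrite /bracketL cc scale0r addr0 sub0r add0r mulrNz scaleNr //.
split=> nk.
  by apply: homog_eig; rewrite natrB.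
apply: coord_inj; apply: (@supported0 _ _ pred0 _ (fun _ => isT)) => i ix; exfalso; have /eqP := L0_coord Lg ix.
rewrite eq_sym subr_eq -natrD => /eqP /(natr_inj char0); lia.
Qed.

(** For p critical [gram p] vanishes, so the derivation W_n kills L_(-p)^r v to
    leading order; as only the letter L_(-p) occurs, what remains involves a
    W. *)
Lemma posW_critical p r n : critical c hW p -> (0 < n)%N ->
  Vs (moreW 0) (act (W_ n%:Z) (wact (nseq r (L_ (- p%:Z))) v)).
Proof.
move=> cp; have p0 := cp.1; have gp : gram p = 0 by apply/gram_eq0.
have nr m : all isneg (nseq m (L_ (- p%:Z))) by rewrite all_nseq isneg_L ?orbT.
have W0 m : nW (nseq m (L_ (- p%:Z))) = 0%N by elim: m => //= m IH; rewrite nW_cons IH cW_L.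
elim: r n => [|r IH] n n0.
  by rewrite wact_nil (verma_pos c h hW n0).2; exact: (sVs _).1.
rewrite [nseq _ _]/= wact_cons actB; apply: (subspaceD (sVs _)).
  by have := moreW_neg (isneg_L p0) (IH n n0); rewrite cW_L.
rewrite /bracketL opprK.
have [lt_np|lt_pn|enp] := ltngtP n p.
- rewrite /cocycle ifF ?mul0r ?scale0r ?addr0; last by lia.
  apply: (subspaceZ _ (sVs _)); have -> : n%:Z - p%:Z = - (p - n)%N%:Z by lia.
  have k0 : (0 < p - n)%N by lia.
  rewrite -wact_cons; apply: moreW_word; first by rewrite /= isneg_W // nr.
  by rewrite nW_cons cW_W.
- rewrite /cocycle ifF ?mul0r ?scale0r ?addr0; last by lia.
  apply: (subspaceZ _ (sVs _)); have -> : n%:Z - p%:Z = (n - p)%N%:Z by lia.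
  by apply: IH; lia.
- rewrite enp subrr verma_C scalerA.
  set y := wact _ v; have := scale_gram (p%:Z + p%:Z)%:~R (cocycle K p (- p%:Z) * c) hW
     (act (W_ 0) y) y.
  rewrite -/(gram p) gp scale0r subr0 => ->; apply: (subspaceZ _ (sVs _)).
  by have := verma_W0 (nr r); rewrite W0.
Qed.

End Leading.

(** * Vectors of minimal weight outside a submodule *)

Section MinimalWeight.
Variables (K : fieldType) (c h hW : K).
Hypothesis char0 : [pchar K] =i pred0.
Hypothesis chW : (c != 0) || (hW != 0).
Local Notation bip := (seq nat * seq nat)%type.
Local Notation V := (verma c h hW).
Local Notation v := (verma_vector c h hW).
Local Notation coord := (@vcoord K c h hW).
Local Notation base i := (wact (wmono i) v).
Local Notation Vs := (@Vs K c h hW).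
Local Notation sVs := (@Vs_subspace K c h hW).
Local Notation gram := (gram c hW).
Local Notation homog := (@homog K c h hW).
Local Notation radical := (@radical K c h hW).
Local Notation sR := (radical_submodule c h hW).
Local Notation crit := (critical c hW).

Definition has_critical (i : bip) : bool := `[< exists2 n, n \in i.1 & crit n >].

(** N0 is a submodule of the radical for which the leading monomials containing
    a critical W-letter are exactly those that can be reached: elements of N0
    have such a leading monomial, and modulo N0 it can be removed. *)
Variable N0 : set V.
Hypothesis sN0 : submodule N0.
Hypothesis N0R : N0 `<=` radical.
Hypothesis N0lead : forall z i, N0 z -> i \in msupp (coord z) ->
  Vs (late 0 0 (size i.1) (size i.2)) z -> has_critical i.
Hypothesis N0red : forall k x, homog k x -> ~ N0 x ->
  exists y, [/\ homog k y, N0 (x - y) & exists i, [/\ i \in msupp (coord y), ~~ has_critical i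
    & Vs (late 0 0 (size i.1) (size i.2)) y]].

Lemma bip_pos i n : is_bipartition i -> n \in i.1 \/ n \in i.2 -> (0 < n)%N.
Proof.
move=> /andP[/andP[_ /allP p1] /andP[_ /allP p2]] [/p1|/p2] //.
Qed.

(** A leading monomial of W-degree 0 has no critical W-letter. *)
Lemma N0_moreW z : N0 z -> Vs (moreW 0) z.
Proof.
move=> Nz i iz; rewrite /moreW lt0n; apply/negP => /eqP i0.
have z0 : z <> 0.
  by move=> e; rewrite e vcoord0 msupp0 in_fset0 in iz.
have [j jz lz] := lead_exists z0; have := lz i iz; rewrite /late i0 => j0.
have j1 : size j.1 = 0%N by lia.
by have /asboolP[n] := N0lead Nz jz lz; rewrite (size0nil j1).
Qed.

Lemma N0_sub x y : N0 (x - y) -> N0 y -> N0 x.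
Proof. by move=> Nxy Ny; rewrite -(subrK y x); apply: (subspaceD sN0.1). Qed.

(** The leading monomial of y is a word in the L only, and W_n acts on it as a
    derivation with coefficient [gram n]. Hence all its letters are critical,
    and there is a single critical index. *)
Lemma top_critical k y : (0 < k)%N -> homog k y -> ~ Vs (moreW 0) y ->
  (forall n, (0 < n)%N -> Vs (moreW 0) (act (W_ n%:Z) y)) ->
  exists p r, [/\ crit p, (0 < r)%N, (r * p)%N = k &
    ([::], nseq r p) \in msupp (coord y)].
Proof.
move=> k0 hy ny Wy.
have [j [jy j0]] : exists j, j \in msupp (coord y) /\ size j.1 = 0%N.
  apply: contrapT => nj; apply: ny => j jy; rewrite /moreW lt0n.
  by apply/negP => /eqP j0; apply: nj; exists j.
have y0 : y <> 0 by move=> e; rewrite e vcoord0 msupp0 in_fset0 in jy.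
have [i iy ly] := lead_exists y0; have := ly j jy; rewrite /late j0 => i0'.
have i0 : size i.1 = 0%N by lia.
have ip := coord_bipartition iy.
have nc n : n \in i.2 -> crit n.
  move=> ni; have n0 := bip_pos ip (or_intror ni); apply/(gram_eq0 _ _ char0 n0).
  have := coord_posW n0 ip ni ly.
  rewrite (Vs_coord0 (Wy n n0)); last by rewrite /moreW /= i0.
  move/esym/eqP; rewrite !mulf_eq0 mcoeff_eq0 iy /= => /orP[|/eqP//].
  by rewrite ((pcharf0P K).1 char0) => /eqP e; move: ni; rewrite -has_pred1 has_count e.
have wi : wti i = k by apply/eqP/hy.
case ei : i ip iy i0 nc wi => [ms ns] /=; case: ms {ei} => // ip iy _ nc wi.
case ens : ns wi ip iy nc => [|p ns'] wi ip iy nc; first by move: wi k0; rewrite /wti /=; lia.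
have cp : crit p by apply: nc; rewrite mem_head.
have eq_ns : p :: ns' = nseq (size ns').+1 p.
  apply/all_pred1P/allP => n /nc cn /=; apply/eqP; exact: (critical_uniq char0 chW).
exists p, (size ns').+1; split=> //; last by rewrite -eq_ns.
by move: wi; rewrite eq_ns /wti /= sumn_nseq mulnC; lia.
Qed.

Lemma wmono_nseq r p : wmono ([::], nseq r p) = nseq r (L_ (- p%:Z)).
Proof. by rewrite /wmono /= map_nseq. Qed.

Lemma nseq_bipartition r p : (0 < p)%N -> is_bipartition ([::], nseq r p).
Proof.
move=> p0; rewrite /is_bipartition /is_partition /= all_nseq p0 orbT andbT.
by case: r => //= r; elim: r => //= r ->; rewrite leqnn.
Qed.

Lemma scale_invB (M : lmodType K) (x y : M) k : k != 0 ->
  k^-1 *: x - y = k^-1 *: (x - k *: y).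
Proof. by move=> k0; rewrite scalerBr scalerA mulVf // scale1r. Qed.

(** Take x in the radical but not in N0, of minimal weight, with a leading
    monomial i free of critical W-letters. By minimality the positive letters
    send x to N0. If i had a letter W_(-n), with n not critical, then L_n x would
    be an element of N0 whose leading monomial has no critical W-letter. So i is
    a word in the L, and [top_critical] applies to x, and then to x minus its
    multiple of L_(-p)^r v. *)
Lemma minimal_weight : ~ (radical `<=` N0) ->
  exists p r k u, [/\ crit p, (0 < r)%N, homog k u /\ ~ N0 u,
    (forall n, (0 < n)%N -> N0 (act (L_ n%:Z) u) /\ N0 (act (W_ n%:Z) u)) &
    Vs (moreW 0) (u - wact (nseq r (L_ (- p%:Z))) v)].
Proof.
move=> nRN; pose P k := `[< exists x, [/\ homog k x, radical x & ~ N0 x] >].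
have exP : exists k, P k.
  apply: contrapT => nP; apply: nRN => x Rx; have [B ->] := wproj_sum x.
  apply: (subspace_sum _ sN0.1) => i _; apply: contrapT => ni; apply: nP.
  exists i; apply/asboolP; exists (wproj i x).
  by split; [exact: wproj_homog|exact: (submodule_wproj char0 _ sR Rx)|exact: ni].
case: (ex_minnP exP) => k /asboolP[x [hx Rx nx]] kmin.
have [y [hy Nxy [i [iy ni ly]]]] := N0red hx nx.
have ny : ~ N0 y by move=> /(N0_sub Nxy).
have Ry : radical y.
  by rewrite -(subKr x y); apply: (subspaceB sR.1 Rx); exact: N0R.
have pos g n : g = L_ n%:Z \/ g = W_ n%:Z -> (0 < n)%N -> N0 (act g y).
  move=> eg n0; have [h1 h2] := homog_pos char0 eg n0 hy.
  have [nk|kn] := leqP n k; last by rewrite h2 //; exact: sN0.1.1.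
  apply: contrapT => nN; have : P (k - n)%N.
    by apply/asboolP; exists (act g y); split; [exact: h1|exact: sR.2|].
  by move/kmin; lia.
have k0 : (0 < k)%N.
  rewrite lt0n; apply/negP => /eqP ek; apply: ny.
  have : wproj 0 y = y by apply: wproj_id; rewrite -ek.
  rewrite wproj0E; have := Ry [::]; rewrite wact_nil => -> <-.
  by rewrite scale0r; exact: sN0.1.1.
have ip := coord_bipartition iy.
have i0 : i.1 = [::].
  case ei : (i.1) => [//|n ms]; exfalso.
  have ni1 : n \in i.1 by rewrite ei mem_head.
  have n0 := bip_pos ip (or_introl ni1).
  have gn : gram n != 0.
    apply/eqP => /(gram_eq0 _ _ char0 n0) cn; move/negP: ni; apply.
    by apply/asboolP; exists n.
  have := coord_posL n0 ip ni1 ly; set j := (rem n i.1, i.2) => e.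
  have jy : j \in msupp (coord (act (L_ n%:Z) y)).
    rewrite -mcoeff_neq0 e !mulf_neq0 ?mcoeff_neq0 //.
    by rewrite ((pcharf0P K).1 char0) -lt0n -has_count has_pred1.
  have lj : Vs (late 0 0 (size j.1) (size j.2)) (act (L_ n%:Z) y).
    apply: VsS (late_posL n0 ly) => t _; rewrite /late /= size_rem // ei /=; lia.
  have /asboolP[m mj cm] := N0lead (pos _ n (or_introl erefl) n0) jy lj.
  move/negP: ni; apply; apply/asboolP; exists m => //; exact: mem_rem mj.
have Wy n : (0 < n)%N -> Vs (moreW 0) (act (W_ n%:Z) y).
  by move=> n0; apply: N0_moreW; apply: pos n0; right.
have nyW : ~ Vs (moreW 0) y by move=> /(_ i iy); rewrite /moreW i0.
have [p [r [cp r0 rk iy']]] := top_critical k0 hy nyW Wy.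
have p0 : (0 < p)%N := cp.1.
set j : bip := ([::], nseq r p) in iy'.
have jp : is_bipartition j := nseq_bipartition r p0.
pose kappa := (coord y)@_j.
have kappa0 : kappa != 0 by rewrite mcoeff_neq0.
pose y' := y - kappa *: base j.
have y'W : Vs (moreW 0) y'.
  apply: contrapT => ny'.
  have hy' : homog k y'.
    apply: (subspaceB (sVs _) hy); apply: (subspaceZ _ (sVs _)).
    have wj : wti j = k by rewrite /wti /= sumn_nseq add0n mulnC.
    by have := homog_base jp; rewrite wj; apply.
  have Wy' n : (0 < n)%N -> Vs (moreW 0) (act (W_ n%:Z) y').
    move=> n0; rewrite /y' actD actN actZ; apply: (subspaceB (sVs _) (Wy n n0)).
    by apply: (subspaceZ _ (sVs _)); rewrite wmono_nseq; exact: posW_critical.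
  have [p' [r' [cp' _ rk' jy']]] := top_critical k0 hy' ny' Wy'.
  have ep := critical_uniq char0 chW cp' cp; rewrite {p' cp'}ep in rk' jy'.
  have er : r' = r by apply/eqP; rewrite -(eqn_pmul2r p0) rk' rk.
  move: jy'; rewrite er -/j -mcoeff_neq0 /y' vcoordB mcoeffB vcoordZ mcoeffZ.
  have e1 : (coord (base j))@_j = 1 by rewrite (coord_base _ _ _ jp) mcoeffUU.
  by rewrite [(coord (base j))@_j]e1 mulr1 -/kappa subrr => /eqP[].
have yE : kappa *: (kappa^-1 *: y) = y by exact: scalerKV kappa0 y.
exists p, r, k, (kappa^-1 *: y); split.
- exact: cp.
- exact: r0.
- split; first exact: (subspaceZ _ (sVs _) hy).
  by move=> Nu; apply: ny; rewrite -yE; apply: (subspaceZ _ sN0.1).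
- move=> n n0; rewrite !actZ; split; apply: (subspaceZ _ sN0.1).
    by apply: pos n0; left.
  by apply: pos n0; right.
rewrite -wmono_nseq (scale_invB y (base j) kappa0).
exact: (subspaceZ _ (sVs _)).
Qed.

End MinimalWeight.

(** * Submodules generated by negative words *)

Section Generated.
Variables (K : fieldType) (M : wmodule K) (m : M).
Local Notation bip := (seq nat * seq nat)%type.
Local Notation coords := {malg K[bip]}.
Local Notation tau := (tau 0 0 0 : seq gen -> coords).

(** U(L_-) m. *)
Definition negspan : set M :=
  [set z | exists2 b : coords, supported is_bipartition b & z = pact m b].

Lemma negspan_subspace : subspace negspan.
Proof.
split; first by exists 0; [exact: supported_zero|rewrite pact0].
move=> a _ _ [b sb ->] [b' sb' ->]; exists (a *: b + b').
  by apply: supportedD; [exact: supportedZ sb|].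
by rewrite pactD pactZ.
Qed.

Lemma negspan_word w : all isneg w -> negspan (wact w m).
Proof.
move=> nw; exists (tau w); first exact: tau_bipartition.
by apply: wact_tau; left.
Qed.

Lemma negspan_ind (N : set M) : subspace N ->
  (forall w, all isneg w -> N (wact w m)) -> negspan `<=` N.
Proof.
move=> sN Nw _ [b sb ->]; apply: (subspace_sum_seq sN) => i ib _.
by apply: (subspaceZ _ sN); apply: Nw; apply: wmono_neg; exact: sb.
Qed.

Lemma negspan_neg g z : isneg g -> negspan z -> negspan (act g z).
Proof.
move=> ng; apply: (negspan_ind (N := [set z | negspan (act g z)])) => [|w nw].
  split=> [|a x y Nx Ny]; first by rewrite /= act0; exact: negspan_subspace.1.
  by rewrite /= act_linear; exact: negspan_subspace.2.
by rewrite /= -wact_cons; apply: negspan_word; rewrite /= ng.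
Qed.

Lemma negspan_submodule : (forall g, ~~ isneg g -> exists k, act g m = k *: m) ->
  submodule negspan.
Proof.
move=> Hm; split; first exact: negspan_subspace.
move=> g z; apply: (negspan_ind (N := [set z | negspan (act g z)])) => [|w].
  split=> [|a x y Nx Ny]; first by rewrite /= act0; exact: negspan_subspace.1.
  by rewrite /= act_linear; exact: negspan_subspace.2.
elim: w g => [|x w IH] g /=.
  move=> _; have [ng|ng] := boolP (isneg g).
    by rewrite -wact_cons; apply: negspan_word; rewrite /= ng.
  have [k e] := Hm g ng; rewrite wact_nil e; apply: (subspaceZ _ negspan_subspace).
  by rewrite -[m]wact_nil; exact: negspan_word.
move=> /andP[nx nw]; rewrite wact_cons actB; apply: (subspaceD negspan_subspace).
  by apply: negspan_neg nx _; exact: IH.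
by apply: (subspace_bracketL _ _ negspan_subspace) => g'; exact: IH.
Qed.

End Generated.

(** * Lowest components *)

Section LowestComponent.
Variables (K : fieldType) (c h hW : K).
Local Notation bip := (seq nat * seq nat)%type.
Local Notation V := (verma c h hW).
Local Notation v := (verma_vector c h hW).
Local Notation coord := (@vcoord K c h hW).
Local Notation base i := (wact (wmono i) v).

Lemma sum_delta (T : eqType) (s : seq T) (P : pred T) (F : T -> K) j : uniq s ->
  \sum_(i <- s | P i) F i * (i == j)%:R =
  if P j then (if j \in s then F j else 0) else 0.
Proof.
move=> us; have [js|js] := boolP (j \in s); last first.
  rewrite if_same big1_seq // => i /andP[_ ins].
  by case: eqP => [e|_]; [rewrite -e ins in js|rewrite mulr0].
rewrite big_mkcond (bigD1_seq j) //= eqxx mulr1 big1 ?addr0 // => i /negPf->.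
by case: ifP; rewrite ?mulr0.
Qed.

Lemma coord_comb (a : {malg K[bip]}) (P : pred bip) j :
  supported is_bipartition a ->
  (coord (\sum_(i <- msupp a | P i) a@_i *: pbw c h hW i))@_j = if P j then a@_j else 0.
Proof.
move=> sa; rewrite vcoord_sum.
transitivity (\sum_(i <- msupp a | P i) a@_i * (i == j)%:R).
  rewrite [LHS]big_seq_cond [RHS]big_seq_cond; apply: eq_bigr => i /andP[ia _].
  by rewrite vcoordZ mcoeffZ pbwE (coordE_base c h hW j (sa i ia)).
rewrite sum_delta ?fset_uniq //; case: ifP => // _.
by case: msuppP.
Qed.

(** The coordinates in [is_lowest_component] are the PBW coordinates, as these
    are unique. *)
Lemma lowest_coord (x y : V) : is_lowest_component x y -> exists s,
  [/\ forall i, i \in msupp (coord x) -> (s <= size i.1)%N,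
      exists2 i, i \in msupp (coord x) & size i.1 = s &
      forall j, (coord y)@_j = if size j.1 == s then (coord x)@_j else 0].
Proof.
move=> [a [s [sa ex ax [i ia is_] ey]]]; exists s.
have ca j : (coord x)@_j = a@_j by rewrite ex (coord_comb predT).
have ci j : (j \in msupp (coord x)) = (j \in msupp a) by rewrite -!mcoeff_neq0 ca.
split=> [j|| j]; first by rewrite ci; exact: ax.
  by exists i => //; rewrite ci.
by rewrite ey coord_comb // ca.
Qed.

Lemma lowest_intro (x y : V) : y <> 0 -> Vs (fun i => size i.1 == 0%N) y ->
  Vs (moreW 0) (x - y) -> is_lowest_component x y.
Proof.
move=> y0 hy hxy; have cy j : (coord y)@_j = if size j.1 == 0%N then (coord x)@_j else 0.
  have := congr1 (fun t => (coord t)@_j) (subrK y x); rewrite vcoordD mcoeffD => e.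
  case: ifP => js; last by rewrite (Vs_coord0 hy) ?js.
  have z : (coord (x - y))@_j = 0 by apply: (Vs_coord0 hxy); rewrite /moreW (eqP js).
  by move: e; rewrite z add0r.
have sx := @coord_bipartition K c h hW x.
exists (coord x), 0%N; split.
- exact: sx.
- rewrite -{1}(coordK x) /pact /lext; apply: eq_bigr => i _; by rewrite pbwE.
- by move=> i _; exact: leq0n.
- have [i iy li] := lead_exists y0; exists i; last exact/eqP/hy.
  have e := cy i; rewrite (hy i iy) in e.
  by rewrite -mcoeff_neq0 -e mcoeff_neq0.
apply: coord_eq => j; rewrite cy; symmetry; exact: coord_comb.
Qed.

End LowestComponent.

(** * The submodule generated by the singular vector of type W *)

Section SingularSubmodule.
Variables (K : fieldType) (c h hW : K).
Hypothesis char0 : [pchar K] =i pred0.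
Local Notation bip := (seq nat * seq nat)%type.
Local Notation V := (verma c h hW).
Local Notation v := (verma_vector c h hW).
Local Notation coord := (@vcoord K c h hW).
Local Notation base i := (wact (wmono i) v).
Local Notation Vs := (@Vs K c h hW).
Local Notation sVs := (@Vs_subspace K c h hW).
Local Notation gram := (gram c hW).
Local Notation homog := (@homog K c h hW).
Local Notation radical := (@radical K c h hW).
Local Notation sR := (radical_submodule c h hW).
Local Notation crit := (critical c hW).
Local Notation has_critical := (has_critical c hW).

Variables (p : nat) (u0 : V).
Hypothesis cp : crit p.
Hypothesis Hu : is_u' p u0.
Local Notation Wp := (W_ (- p%:Z)).
Local Notation N0 := (smallest (@submodule K V) [set u0]).
Let p0 : (0 < p)%N := cp.1.
Let sN0 : submodule N0 := smallest_submodule [set u0].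

Lemma usub_mem : N0 u0.
Proof. by move=> N [_]; apply. Qed.

Lemma wmono_p : wmono ([:: p], [::]) = [:: Wp]. Proof. by []. Qed.

Lemma bip_p : is_bipartition ([:: p], [::]).
Proof. by rewrite /is_bipartition /is_partition /= p0. Qed.

Lemma u_shape : Vs (moreW 1) (u0 - act Wp v).
Proof.
have [_ _ _ /lowest_coord[s [le_s _ cE]]] := Hu.
have b1 j : (coord (act Wp v))@_j = (([:: p], [::]) == j)%:R.
  by have := coordE_base c h hW j bip_p; rewrite wmono_p wact1.
have s1 : s = 1%N.
  have := cE ([:: p], [::]); rewrite b1 eqxx /=; case: eqP => // _ /eqP.
  by rewrite oner_eq0.
move=> j; rewrite -mcoeff_neq0 vcoordB mcoeffB => nz; rewrite /moreW.
rewrite ltnNge; apply: contra nz; rewrite leq_eqVlt => /orP[/eqP j1|j1].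
  by rewrite cE j1 s1 eqxx subrr.
rewrite cE s1 (ltn_eqF j1).
by rewrite subr0 mcoeff_eq0; apply/negP => /le_s; rewrite s1 leqNgt j1.
Qed.

Lemma act_W0_words (x : V) : W_span x -> act (W_ 0) x = hW *: x.
Proof.
move=> Wx; apply: (Wx [set x : V | act (W_ 0) x = hW *: x]); split.
  split=> [|a y z ey ez]; first by rewrite /= act0 scaler0.
  by rewrite /= act_linear ey ez scalerDr !scalerA mulrC.
move=> _ [ms _ <-] /=; rewrite pbwE /wmono cats0.
elim: ms => [|m ms IH] /=; first exact: (verma_highest c h hW (isT : ~~ isneg (W_ 0))).
by rewrite wact_cons actB IH actZ; exact: addr0.
Qed.

(** The zero modes also act on u' by scalars: W_0 acts by h_W on words in the W,
    as the W commute. *)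
Lemma u_zero g : ~~ isneg g -> exists k, act g u0 = k *: u0.
Proof.
have [[_ _ su] wu Wu _] := Hu.
case: g => [n|n|] ng; last by exists c; exact: verma_C.
  have [n0|n0] := eqVneq n 0; first by exists (h + p%:R); rewrite n0.
  have [] := su `|n|%N; first by lia.
  have -> : `|n|%N%:Z = n by move: ng; rewrite /isneg /=; case: ifP => //; lia.
  by move=> e _; exists 0; rewrite scale0r.
have [n0|n0] := eqVneq n 0; first by exists hW; rewrite n0; exact: act_W0_words.
have [] := su `|n|%N; first by lia.
have -> : `|n|%N%:Z = n by move: ng; rewrite /isneg /=; case: ifP => //; lia.
by move=> _ e; exists 0; rewrite scale0r.
Qed.

Lemma usub_negspan : N0 `<=` negspan u0.
Proof.
move=> z Nz; apply: (Nz (negspan u0)); split; first exact: negspan_submodule u_zero.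
move=> _ ->; rewrite -[u0]wact_nil; exact: negspan_word.
Qed.

Lemma moreW_wact s w x : all isneg w -> Vs (moreW s) x -> Vs (moreW (s + nW w)) (wact w x).
Proof.
move=> nw hx; elim: w nw => [_|g w IH /= /andP[ng nw]]; first by rewrite addn0 wact_nil.
by rewrite wact_cons nW_cons (addnC (cW g)) addnA; apply: moreW_neg ng (IH nw).
Qed.

(** The leading monomial of (the monomial j applied to u'). *)
Definition ins (j : bip) : bip := (sort geq (j.1 ++ [:: p]), j.2).

Lemma srt_ins j : is_bipartition j -> srt (wmono j ++ [:: Wp]) = ins j.
Proof.
move=> jp; have /(congr1 fst) /= e1 := parts_wmono jp.
have /(congr1 snd) /= e2 := parts_wmono jp.
have hp : - p%:Z < 0 by lia.
rewrite /srt (pmap_cat _ (wmono j)) e1 (pmap_cat _ (wmono j)) e2 /= hp /= abszN absz_nat cats0 /ins.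
by congr (_, _); apply: sort_geq_id; case/andP: jp => _ /andP[].
Qed.

Lemma ins_bip j : is_bipartition j -> is_bipartition (ins j).
Proof. by move=> jp; rewrite -srt_ins //; exact: srt_bipartition. Qed.

Lemma p_ins j : p \in (ins j).1.
Proof. by rewrite mem_sort mem_cat mem_head orbT. Qed.

Lemma size_ins1 j : size (ins j).1 = (size j.1).+1.
Proof. by rewrite size_sort size_cat addn1. Qed.

Lemma ins_rem i : is_bipartition i -> p \in i.1 -> ins (rem p i.1, i.2) = i.
Proof.
case: i => ms ns /= /andP[/= /andP[sm _] _] pm; rewrite /ins /=; congr (_, _).
rewrite -[RHS](sort_geq_id sm); apply: perm_sort_geq.
by rewrite perm_catC /= perm_sym perm_to_rem.
Qed.

Lemma ins_inj j j' : is_bipartition j -> is_bipartition j' -> ins j = ins j' -> j = j'.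
Proof.
case: j j' => ms ns [ms' ns'] /andP[/= /andP[sm _] _] /andP[/= /andP[sm' _] _] [e ->].
congr (_, _); apply: (sorted_eq geq_trans geq_anti) => //.
have : perm_eq (sort geq (ms ++ [:: p])) (ms' ++ [:: p]) by rewrite e perm_sort.
by rewrite perm_sort perm_cat2r.
Qed.

Lemma u_lead j : is_bipartition j ->
  Vs (late 1 0 (size j.1).+1 (size j.2)) (wact (wmono j) u0 - base (ins j)).
Proof.
move=> jp; have nj := wmono_neg jp.
have nw : all isneg (wmono j ++ [:: Wp]) by rewrite all_cat nj /= isneg_W.
have -> : wact (wmono j) u0 - base (ins j) =
    wact (wmono j) (u0 - act Wp v)
    + (wact (wmono j ++ [:: Wp]) v - base (srt (wmono j ++ [:: Wp]))).
  by rewrite srt_ins // wactB wact_cat wact1 addrA subrK.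
apply: (subspaceD (sVs _)).
  apply: VsS (moreW_wact nj u_shape) => i _.
  by rewrite /moreW /late nW_wmono //; lia.
apply: VsS (word_lead nw) => i _ /and4P[_ /eqP i1 i2 _]; move: i1 i2.
rewrite /late nW_cat nL_cat nW_wmono // nL_wmono //.
rewrite {1}/nW {1}/nL /= cW_W // cL_W //; lia.
Qed.

Lemma has_critical_ins j : has_critical (ins j).
Proof. by apply/asboolP; exists p; [exact: p_ins|]. Qed.

Lemma late_weak s t i : late 1 0 s t i -> late 0 0 s t i.
Proof. by rewrite /late; lia. Qed.

Lemma late_anti (i j : bip) :
  late 0 0 (size i.1) (size i.2) j -> late 0 0 (size j.1) (size j.2) i ->
  size i.1 = size j.1 /\ size i.2 = size j.2.
Proof. by rewrite /late; lia. Qed.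

(** An element of U(L_-) u' is a combination of monomials applied to u'. As
    [ins] is injective, the leading ones do not cancel, and they contain the
    critical letter W_(-p). *)
Lemma usub_lead z i : N0 z -> i \in msupp (coord z) ->
  Vs (late 0 0 (size i.1) (size i.2)) z -> has_critical i.
Proof.
move=> /usub_negspan[b sb ez] iz lz.
have b0 : b != 0.
  by apply/eqP => b0; move: iz; rewrite ez b0 pact0 vcoord0 msupp0 in_fset0.
have [j0 jb lb] := lead_malg b0.
set s := (size j0.1).+1; set t := size j0.2.
pose P (j : bip) := (size j.1 == size j0.1) && (size j.2 == t).
pose y := \sum_(j <- msupp b | P j) b@_j *: base (ins j).
have hzy : Vs (late 1 0 s t) (z - y).
  rewrite ez /pact /lext /y (bigID P) /= addrAC -sumrB.
  apply: (subspaceD (sVs _)); apply: (subspace_sum_seq (sVs _)) => j jb' Pj.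
    rewrite -scalerBr; apply: (subspaceZ _ (sVs _)).
    by case/andP: Pj => /eqP j1 /eqP j2; rewrite /s -j1 -j2; apply: u_lead; exact: sb.
  apply: (subspaceZ _ (sVs _)); have jp := sb j jb'.
  rewrite -[wact _ u0](subrK (base (ins j))); apply: (subspaceD (sVs _)).
    apply: VsS (u_lead jp) => k _; move: (lb j jb') Pj; rewrite /P /late /s /t; lia.
  apply: Vs_base; first exact: ins_bip.
  move: (lb j jb') Pj; rewrite /P /late /s /t size_ins1 /=; lia.
have cy k : (coord y)@_k = \sum_(j <- msupp b | P j) b@_j * (ins j == k)%:R.
  rewrite vcoord_sum [LHS]big_seq_cond [RHS]big_seq_cond; apply: eq_bigr => j /andP[jb' _].
  by rewrite vcoordZ mcoeffZ (coordE_base c h hW k (ins_bip (sb j jb'))).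
have cz k : size k.1 = s -> size k.2 = t -> (coord z)@_k = (coord y)@_k.
  move=> k1 k2; have e : (coord (z - y))@_k = 0.
    by apply: (Vs_coord0 hzy); rewrite /late k1 k2; lia.
  by move: e; rewrite vcoordB mcoeffB => /eqP; rewrite subr_eq0 => /eqP.
have z0 : (coord z)@_(ins j0) = b@_j0.
  rewrite cz ?size_ins1 // cy.
  transitivity (\sum_(j <- msupp b | P j) b@_j * (j == j0)%:R).
    rewrite [LHS]big_seq_cond [RHS]big_seq_cond; apply: eq_bigr => j /andP[jb' _].
    congr (_ * _%:R); congr nat_of_bool; apply/eqP/eqP => [|->//].
    exact: ins_inj (sb _ jb') (sb _ jb).
  by rewrite sum_delta ?fset_uniq // /P !eqxx jb.
have jz : ins j0 \in msupp (coord z) by rewrite -mcoeff_neq0 z0 mcoeff_neq0.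
have lzst : Vs (late 0 0 s t) z.
  rewrite -(subrK y z); apply: (subspaceD (sVs _)).
    by apply: VsS hzy => k _; exact: late_weak.
  apply: (subspace_sum_seq (sVs _)) => j jb' /andP[/eqP j1 /eqP j2].
  apply: (subspaceZ _ (sVs _)); apply: Vs_base; first exact: ins_bip (sb j jb').
  by rewrite /late size_ins1 j1 [size (ins j).2]j2 !addn0 eqxx leqnn orbT.
have lzi : late 0 0 (size (ins j0).1) (size (ins j0).2) i.
  by rewrite size_ins1; exact: lzst.
have [i1 i2] := late_anti (lz _ jz) lzi; rewrite size_ins1 in i1.
move: iz; rewrite -mcoeff_neq0 (cz _ i1 i2) cy.
have [/hasP[j _ /eqP <-] _|nh] := boolP (has (fun j => ins j == i) (msupp b)).
  exact: has_critical_ins.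
rewrite big1_seq ?eqxx // => j /andP[_ jb']; move/hasPn: nh => /(_ j jb') /negPf ->.
by rewrite mulr0.
Qed.

Lemma usub_radical : N0 `<=` radical.
Proof.
have [[_ _ su] wu _ _] := Hu.
have hu : homog p u0 := homog_eig char0 wu.
move=> z Nz; apply: (Nz radical); split; first exact: sR.
move=> _ ->; apply: radical_pos => [|n n0].
  by apply: (Vs_coord0 hu); apply/eqP; rewrite /wti /=; lia.
have [-> ->] := su n n0; split; exact: sR.1.1.
Qed.

(** The monomial i with one letter W_(-p) replaced by u'. *)
Definition subst_u (i : bip) : V := wact (wmono (rem p i.1, i.2)) u0.

Lemma bip_rem i : is_bipartition i -> is_bipartition (rem p i.1, i.2).
Proof. by rewrite /is_bipartition /= => /andP[/(partition_rem p)-> ->]. Qed.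

Lemma subst_u_N0 i : N0 (subst_u i).
Proof.
rewrite /subst_u; elim: (wmono _) => [|g w IH]; first by rewrite wact_nil; exact: usub_mem.
by rewrite wact_cons; apply: sN0.2.
Qed.

Lemma subst_u_homog i : is_bipartition i -> p \in i.1 -> homog (wti i) (subst_u i).
Proof.
move=> ip pi; have [_ wu _ _] := Hu; apply: (homog_eig char0).
have jp := bip_rem ip.
rewrite /subst_u (act_L0 (wmono_neg jp) wu) (wt_wmono jp).
have e : wti i = (p + wti (rem p i.1, i.2))%N.
  by rewrite /wti /= (perm_sumn (perm_to_rem pi)) /= addnA.
by rewrite e natrD; congr (_ *: _); rewrite addrA.
Qed.

Lemma subst_u_lead i : is_bipartition i -> p \in i.1 ->
  Vs (late 1 0 (size i.1) (size i.2)) (subst_u i - base i).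
Proof.
move=> ip pi; have := u_lead (bip_rem ip); rewrite (ins_rem ip pi) /=.
rewrite size_rem // prednK //; by case: (i.1) pi.
Qed.

Lemma size_wti i : is_bipartition i -> (size i.1 <= wti i)%N /\ (size i.2 <= wti i)%N.
Proof.
case: i => ms ns /andP[/= /andP[_ p1] /andP[_ p2]]; rewrite /wti /=.
have H s : all (leq 1) s -> (size s <= sumn s)%N by elim: s => //= a s IH /andP[a1 /IH]; lia.
by have := H _ p1; have := H _ p2; lia.
Qed.

Hypothesis chW : (c != 0) || (hW != 0).

Lemma has_criticalE i : has_critical i = (p \in i.1).
Proof.
apply/asboolP/idP => [[n ni cn]|pi]; last by exists p.
by rewrite -(critical_uniq char0 chW cn cp).
Qed.

(** Monomials in the leading part that contain W_(-p) are removed by subtracting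
    [subst_u]. If nothing of the leading part remains, the leading monomial
    comes later in the order, which is finite in a given weight. *)
Lemma usub_reduce k x : homog k x -> ~ N0 x ->
  exists y, [/\ homog k y, N0 (x - y) & exists i, [/\ i \in msupp (coord y), ~~ has_critical i
    & Vs (late 0 0 (size i.1) (size i.2)) y]].
Proof.
(* Both degrees are at most k in weight k, so mu decreases along the order. *)
pose mu (i : bip) := ((k - size i.1) * k.+1 + size i.2)%N.
have x0 z : ~ N0 z -> z <> 0 by move=> nz e; apply: nz; rewrite e; exact: sN0.1.1.
move=> hx nx; have [i0 ix0 lx] := lead_exists (x0 x nx).
have [n] := ubnP (mu i0); elim: n x i0 hx nx ix0 lx => // n IH x i0 hx nx ix0 lx.
rewrite ltnS => le_n.
pose bad (j : bip) := [&& size j.1 == size i0.1, size j.2 == size i0.2 & p \in j.1].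
pose z := \sum_(j <- msupp (coord x) | bad j) (coord x)@_j *: subst_u j.
pose z' := \sum_(j <- msupp (coord x) | bad j) (coord x)@_j *: base j.
have Nz : N0 z.
  by apply: (subspace_sum _ sN0.1) => j _; apply: (subspaceZ _ sN0.1); exact: subst_u_N0.
have hz : homog k z.
  apply: (subspace_sum_seq (sVs _)) => j jx /and3P[_ _ pj]; apply: (subspaceZ _ (sVs _)).
  by rewrite -(eqP (hx j jx)); apply: subst_u_homog pj; exact: coord_bipartition jx.
have lz : Vs (late 1 0 (size i0.1) (size i0.2)) (z - z').
  rewrite /z /z' -sumrB; apply: (subspace_sum_seq (sVs _)) => j jx /and3P[/eqP <- /eqP <- pj].
  rewrite -scalerBr; apply: (subspaceZ _ (sVs _)).
  by apply: subst_u_lead pj; exact: coord_bipartition jx.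
have cz' j : (coord z')@_j = if bad j then (coord x)@_j else 0.
  have e := @coord_comb K c h hW (coord x) bad j (@coord_bipartition K c h hW x).
  apply: (etrans _ e); congr ((coord _)@_ _).
  by apply: eq_bigr => t _; rewrite pbwE.
pose y := x - z; have hy : homog k y := subspaceB (sVs _) hx hz.
have Nxy : N0 (x - y) by rewrite subKr.
have ny : ~ N0 y by move=> /(subspaceD sN0.1 Nz); rewrite addrC subrK.
have cy i : size i.1 = size i0.1 -> size i.2 = size i0.2 ->
    (coord y)@_i = if p \in i.1 then 0 else (coord x)@_i.
  move=> i1 i2; have e : (coord (z - z'))@_i = 0.
    by apply: (Vs_coord0 lz); rewrite /late i1 i2; lia.
  have ez : (coord z)@_i = (coord z')@_i.
    by move: e; rewrite vcoordB mcoeffB => /eqP; rewrite subr_eq0 => /eqP.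
  rewrite /y vcoordB mcoeffB ez cz' /bad i1 i2 !eqxx /=.
  by case: ifP => _; [exact: subrr|exact: subr0].
have ly : Vs (late 0 0 (size i0.1) (size i0.2)) y.
  apply: (subspaceB (sVs _) lx); rewrite -(subrK z' z); apply: (subspaceD (sVs _)).
    by apply: VsS lz => i _; exact: late_weak.
  apply: (subspace_sum_seq (sVs _)) => j jx /and3P[/eqP j1 /eqP j2 pj].
  apply: (subspaceZ _ (sVs _)); apply: Vs_base; first exact: coord_bipartition jx.
  by rewrite /late j1 j2; lia.
have [i1 iy li] := lead_exists (x0 y ny).
have ip := coord_bipartition iy.
have [/andP[/eqP e1 /eqP e2]|ne] :=
    boolP ((size i1.1 == size i0.1) && (size i1.2 == size i0.2)).
  exists y; split=> //; exists i1; split=> //.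
  rewrite has_criticalE; move: iy; rewrite -mcoeff_neq0 (cy _ e1 e2).
  by case: ifP => // _; rewrite eqxx.
have [s1 s2] := size_wti ip; have wi : wti i1 = k := eqP (hy i1 iy).
rewrite wi in s1 s2; have lt : (mu i1 < n)%N.
  apply: leq_trans le_n; move: (ly i1 iy) ne; rewrite /mu /late.
  move: (size i1.1) (size i1.2) (size i0.1) (size i0.2) s1 s2 => a1 b1 a0 b0 s1 s2.
  by rewrite !addn0 => /orP[lt_a|/andP[/eqP-> le_b]]; [nia|rewrite eqxx /=; lia].
have [y' [hy' Nyy' ex]] := IH y i1 hy ny iy li lt.
exists y'; split=> //; have := subspaceD sN0.1 Nxy Nyy'.
by rewrite addrA subrK.
Qed.

End SingularSubmodule.

(** * Subsingular vectors *)

Section Subsingular.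
Variables (K : fieldType) (c h hW : K).
Hypothesis char0 : [pchar K] =i pred0.
Local Notation bip := (seq nat * seq nat)%type.
Local Notation V := (verma c h hW).
Local Notation v := (verma_vector c h hW).
Local Notation coord := (@vcoord K c h hW).
Local Notation base i := (wact (wmono i) v).
Local Notation Vs := (@Vs K c h hW).
Local Notation sVs := (@Vs_subspace K c h hW).
Local Notation homog := (@homog K c h hW).
Local Notation radical := (@radical K c h hW).
Local Notation sR := (radical_submodule c h hW).
Local Notation crit := (critical c hW).
Local Notation gen u := (smallest (@submodule K V) [set u]).

Variable u' : nat -> V.
Hypothesis Hu' : forall p, crit p -> is_u' p (u' p).

Lemma iter_wact r g : iter r (act g) v = wact (nseq r g) v.
Proof.
elim: r => [|r IH]; first by rewrite wact_nil.
by rewrite iterS IH -wact_cons.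
Qed.

Lemma power_base r p : (0 < p)%N ->
  iter r (act (L_ (- p%:Z))) v = base ([::], nseq r p).
Proof. by move=> p0; rewrite iter_wact wmono_nseq. Qed.

(** For c = h_W = 0 the index p = 2 is critical, but L_1 maps any vector with
    lowest component W_(-2) v to a vector with lowest component 3 W_(-1) v. *)
Lemma parameters_neq0 : (c != 0) || (hW != 0).
Proof.
rewrite -negb_and; apply/negP => /andP[/eqP c0 /eqP w0].
have c2 : crit 2 by split=> //; rewrite c0 w0 !mulr0 addr0.
have [[_ _ su] _ Wu _] := Hu' c2; have [L1 _] := su 1%N isT.
set u := u' 2 in L1 Wu su; set R := u - act (W_ (- 2%:Z)) v.
have i2 : is_bipartition ([:: 2], [::]) by [].
have i1 : is_bipartition ([:: 1], [::]) by [].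
have hR : Vs (fun i => (1 < size i.1)%N && (i.2 == [::])) R.
  have h1 := u_shape c2 (Hu' c2); have h2 : Vs (fun i => i.2 == [::]) R.
    apply: (subspaceB (sVs _)).
      apply: (Wu (Vs (fun i => i.2 == [::]))); split; first exact: sVs.
      move=> _ [ms pms <-]; rewrite pbwE; have mp : is_bipartition (ms, [::]).
        by rewrite /is_bipartition pms.
      exact: (Vs_base mp).
    exact: (Vs_base i2).
  by move=> i ii; rewrite (h2 i ii) andbT; exact: h1 i ii.
have LR : Vs (moreW 1) (act (L_ 1%:Z) R).
  move: hR; apply: (Vs_op (f := act (L_ 1%:Z))) => i ip /andP[si /eqP i20] /=.
  have g1 : gram c hW 1 = 0 by rewrite gramE // c0 w0 !mulr0 addr0 mulr0.
  have := @posL_lead K c h hW 1 (wmono i) isT (wmono_neg ip).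
  rewrite g1 mulr0 scale0r subr0 => H; apply: VsS H => j _.
  rewrite /late /moreW nW_wmono // nL_wmono // i20 /=; lia.
have L2 : act (L_ 1%:Z) (act (W_ (- 2%:Z)) v) = 3%:R *: base ([:: 1], [::]).
  have cc : cocycle K 1%:Z (- 2%:Z) = 0 by rewrite /cocycle; case: eqP.
  rewrite actB (verma_pos c h hW (n := 1) isT).1 act0 add0r /bracketL cc scale0r addr0.
  reflexivity.
have : (coord (act (L_ 1%:Z) R))@_([:: 1], [::]) = - 3%:R.
  rewrite /R actD actN L1 L2 sub0r -scaleNr vcoordZ mcoeffZ (coordE_base c h hW _ i1).
  by rewrite eqxx mulr1.
rewrite (Vs_coord0 LR) // => /esym/eqP; rewrite oppr_eq0.
by rewrite (negPf (natr_neq0 char0 _)).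
Qed.

(** If the radical is larger than the submodule generated by u', the vector of
    minimal weight outside of it is subsingular. If no index is critical, the
    same argument applies to the zero submodule and shows that the radical
    vanishes. *)
Lemma radical_dichotomy :
  (exists p r u, [/\ crit p, (0 < r)%N, subsingular (u' p) u &
      is_lowest_component u (iter r (act (L_ (- p%:Z))) v)]) \/
  (forall x, radical x -> x = 0 \/ exists2 p, crit p & gen (u' p) x).
Proof.
have chW := parameters_neq0.
have [[p cp]|nc] := pselect (exists p, crit p); last first.
  right=> x Rx; left; apply: contrapT => x0.
  have H := @minimal_weight K c h hW char0 chW [set 0].
  have [|||||p [r [k [u [cp _ _ _ _]]]]] := H.
  - split; first split=> // a y z -> ->; first by rewrite /= scaler0 addr0.
    by move=> g y ->; rewrite /= act0.
  - by move=> _ ->; exact: sR.1.1.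
  - by move=> z i ->; rewrite vcoord0 msupp0 in_fset0.
  - move=> k y hy ny; exists y; split=> //; first by rewrite /= subrr.
    have [i iy li] := lead_exists ny; exists i; split=> //.
    by apply/negP => /asboolP[n _ cn]; apply: nc; exists n.
  - by move=> /(_ x Rx).
  by apply: nc; exists p.
have Hu := Hu' cp.
have [RN|nRN] := pselect (radical `<=` gen (u' p)).
  by right=> x /RN Nx; right; exists p.
left; have [p1 [r [k [u [cp1 r0 [hu nu] pos hmore]]]]] :=
  minimal_weight char0 chW (smallest_submodule _) (usub_radical char0 cp Hu)
    (usub_lead cp Hu) (usub_reduce char0 cp Hu chW) nRN.
have e := critical_uniq char0 chW cp1 cp; rewrite {p1 cp1}e in hmore.
have jp : is_bipartition ([::], nseq r p) := nseq_bipartition r cp.1.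
exists p, r, u; split=> //; last first.
  rewrite iter_wact; apply: lowest_intro.
  - rewrite -wmono_nseq => e; have := coordE_base c h hW ([::], nseq r p) jp.
    by rewrite e vcoord0 mcoeff0 eqxx => /esym/eqP; rewrite oner_eq0.
  - rewrite -wmono_nseq; exact: (Vs_base jp).
  - exact: hmore.
split; first by exists (h + k%:R); exact: homog_L0.
split.
- by apply/eqP => /proj_eq0.
- by exists (h + k%:R); rewrite /weight_space /= act_proj (homog_L0 hu) linearZ.
- by move=> n n0; rewrite !act_proj; split; apply/proj_eq0; have [] := pos n n0.
Qed.

(** Positive letters send u to the submodule generated by u', which lies in the
    radical, so u is in the radical by [radical_pos]. *)
Lemma subsingular_radical p r u : crit p -> (0 < r)%N -> subsingular (u' p) u ->
  is_lowest_component u (iter r (act (L_ (- p%:Z))) v) ->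
  [/\ radical u, homog (r * p) u & Vs (moreW 0) (u - wact (nseq r (L_ (- p%:Z))) v)].
Proof.
move=> cp r0 [[lam wu] [_ _ su]] /lowest_coord[s [_ _ cE]].
have p0 : (0 < p)%N := cp.1; set j : bip := ([::], nseq r p).
have jp : is_bipartition j := nseq_bipartition r p0.
have b1 i : (coord (iter r (act (L_ (- p%:Z))) v))@_i = (j == i)%:R.
  by rewrite power_base // coordE_base.
have s0 : s = 0%N.
  by have := cE j; rewrite b1 eqxx /=; case: eqP => // _ /eqP; rewrite oner_eq0.
have cj : (coord u)@_j = 1 by have := cE j; rewrite b1 eqxx s0 /= => <-.
have wj : wti j = (r * p)%N by rewrite /wti /= sumn_nseq add0n mulnC.
have hu : homog (r * p) u.
  apply: (homog_eig char0); rewrite [LHS]wu; congr (_ *: _).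
  have : (coord (act (L_ 0) u))@_j = (coord (lam *: u))@_j by rewrite [act _ _]wu.
  by rewrite coord_L0 vcoordZ mcoeffZ cj !mulr1 wj.
have posR n : (0 < n)%N -> radical (act (L_ n%:Z) u) /\ radical (act (W_ n%:Z) u).
  move=> n0; have [e1 e2] := su n n0; move: e1 e2; rewrite !act_proj.
  by move=> /proj_eq0 e1 /proj_eq0 e2; split; apply: (usub_radical char0 cp (Hu' cp)).
split; [|exact: hu|].
  apply: radical_pos; last exact: posR.
  by apply: (Vs_coord0 hu); rewrite eq_sym -lt0n muln_gt0 r0.
move=> i; rewrite -mcoeff_neq0 vcoordB mcoeffB -iter_wact cE s0 /moreW lt0n => nz.
by apply: contra nz => ->; rewrite subrr.
Qed.

End Subsingular.

(** * Tensor products *)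

Section TensorFacts.
Variables (K : fieldType) (A B : wmodule K).
Local Notation T := (tensor A B).

Definition ptensor (x : A) (y : B) : T := pure x y.

Lemma ptensor_linl k x x' y : ptensor (k *: x + x') y = k *: ptensor x y + ptensor x' y.
Proof. exact: pure_linear_l. Qed.
Lemma ptensor_linr k x y y' : ptensor x (k *: y + y') = k *: ptensor x y + ptensor x y'.
Proof. exact: pure_linear_r. Qed.

Lemma act_ptensor g x y :
  act g (ptensor x y) = ptensor (act g x) y + ptensor x (act g y).
Proof. exact: tensor_actE. Qed.

Lemma tensor_span (N : set T) : subspace N -> (forall x y, N (ptensor x y)) ->
  forall t, N t.
Proof.
move=> sN Np t; rewrite -[t]projVK; move: (repr t) => z.
rewrite (monalgE z) linear_sum; apply: (subspace_sum _ sN) => -[x y] _.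
by rewrite malgU_scale linearZ; apply: (subspaceZ _ sN); exact: Np.
Qed.

Section Contraction.
Variable phi : A -> K.
Hypothesis phi_lin : forall k x y, phi (k *: x + y) = k * phi x + phi y.

Definition contr0 (z : {malg K[(A * B)%type]}) : B := lext (fun p => phi p.1 *: p.2) z.

Lemma contr0_linear : linear contr0.
Proof. exact: lext_is_linear. Qed.

Lemma contr0_rel z : Defs.span (@tensor_relations K A B) z -> contr0 z = 0.
Proof.
have cD : contr0 = lext (fun p => phi p.1 *: p.2) :> (_ -> _) by [].
have cE k r s t : contr0 (r - k *: s - t) = contr0 r - k *: contr0 s - contr0 t.
  by rewrite cD !linearB linearZ.
have cU x y : contr0 << (x, y) >> = phi x *: y by rewrite /contr0 lextU.
move=> Sz; apply: (Sz [set z | contr0 z = 0]); split.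
  split=> [|k x y /= ex ey]; first by rewrite /= cD linear0.
  by rewrite /= contr0_linear ex ey scaler0 addr0.
move=> r [[k [x [x' [y ->]]]]|[k [x [y [y' ->]]]]] /=.
  by rewrite cE !cU phi_lin scalerDl -scalerA -addrA -opprD subrr.
by rewrite cE !cU scalerDr !scalerA mulrC -addrA -opprD subrr.
Qed.

Definition contr (t : T) : B := liftV contr0 t.

Lemma contr_linear : linear contr.
Proof. exact: (liftV_is_linear contr0_linear contr0_rel). Qed.

Lemma contr_ptensor x y : contr (ptensor x y) = phi x *: y.
Proof.
rewrite /contr /ptensor /pure (liftVE _ contr0_linear contr0_rel).
by rewrite /contr0 lextU.
Qed.

End Contraction.

Lemma ptensor0l y : ptensor 0 y = 0.
Proof. by have := ptensor_linl (-1) 0 0 y; rewrite scaler0 addr0 scaleN1r addNr. Qed.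
Lemma ptensor0r x : ptensor x 0 = 0.
Proof. by have := ptensor_linr (-1) x 0 0; rewrite scaler0 addr0 scaleN1r addNr. Qed.
Lemma ptensorZl k x y : ptensor (k *: x) y = k *: ptensor x y.
Proof. by have := ptensor_linl k x 0 y; rewrite ptensor0l !addr0. Qed.
Lemma ptensorZr k x y : ptensor x (k *: y) = k *: ptensor x y.
Proof. by have := ptensor_linr k x y 0; rewrite ptensor0r !addr0. Qed.

End TensorFacts.

(** * Modules of the intermediate series *)

(** The common features of the three cases of V'_(alpha, beta, 0): a basis e_m
    indexed by [egood], which misses at most one integer. The vectors e_m for
    the other m are 0, so that the action keeps the same formula. The last
    field holds because the missing vector of V_(0, 0, 0) is v_0. *)
Record interm_basis_of (K : fieldType) (A : wmodule K) (a b : K) := IntermBasis {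
  evec : int -> A;
  ecoord : int -> A -> K;
  egood : pred int;
  ecoord_lin : forall m k x y, ecoord m (k *: x + y) = k * ecoord m x + ecoord m y;
  ecoordE : forall m m', egood m' -> ecoord m (evec m') = (m == m')%:R;
  evec_bad : forall m, ~~ egood m -> evec m = 0;
  evec_span : forall N : set A, subspace N -> (forall m, N (evec m)) -> forall x, N x;
  egood_pos : forall m : int, 0 < m -> egood m;
  act_Levec : forall n m, egood m ->
    act (L_ n) (evec m) = - (m%:~R + a + b + n%:~R * b) *: evec (m + n);
  act_Winterm : forall n (x : A), act (W_ n) x = 0;
  act_Cinterm : forall x : A, act C_ x = 0;
  egood_neq0 : b = 0 -> forall m, egood m -> m%:~R + a != 0 }.

Section IntermediateBases.
Variable K : fieldType.
Hypothesis char0 : [pchar K] =i pred0.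

Lemma intr_inj0 (n : int) : n%:~R = 0 :> K -> n = 0.
Proof.
have H (m : nat) : m%:R = 0 :> K -> m = 0%N.
  by move/eqP; rewrite ((pcharf0P K).1 char0) => /eqP.
case: n => m; first by move=> /H ->.
by rewrite NegzE mulrNz => /eqP; rewrite oppr_eq0 => /eqP /H.
Qed.

Lemma interm_act_L (a b : K) n m (x := << m >> : interm a b) :
  act (L_ n) x = - (m%:~R + a + b + n%:~R * b) *: << m + n >>.
Proof. by rewrite /x /act /= interm_actU /= malgU_scale. Qed.

Lemma interm_act0 (a b : K) g (x : interm a b) :
  (forall n, g <> L_ n) -> act g x = 0.
Proof.
move=> gL; rewrite /act /= /interm_act /lext big1 // => m _.
by case: g gL => [n /(_ n)//|n|] _; rewrite scaler0.
Qed.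

Lemma malg_span (N : set {malg K[int]}) : subspace N -> (forall m, N << m >>) ->
  forall x, N x.
Proof.
move=> sN Ne x; rewrite (monalgE x); apply: (subspace_sum _ sN) => m _.
by rewrite malgU_scale; apply: (subspaceZ _ sN).
Qed.

Definition interm_basis_gen (a b : K) : (b = 0 -> forall m : int, m%:~R + a != 0) ->
  interm_basis_of (interm a b) a b.
Proof.
move=> hb; refine (@IntermBasis K (interm a b) a b (fun m => << m >>)
  (fun m x => (x : {malg K[int]})@_m) predT _ _ _ _ _ _ _ _ _) => //.
- by move=> m k x y; rewrite mcoeffD mcoeffZ.
- by move=> m m' _; rewrite mcoeffU eq_sym.
- exact: malg_span.
- by move=> n m _; exact: interm_act_L.
- by move=> n x; apply: interm_act0.
- by move=> x; apply: interm_act0.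
- by move=> b0 m _; exact: hb.
Defined.

Definition interm_basis_quot :
  interm_basis_of (quot_module (interm0_submodule K)) 0 0.
Proof.
pose sN := interm0_submodule K; pose M := interm (0 : K) 0.
pose f m (z : M) : K^o := if m == 0 then 0 else (z : {malg K[int]})@_m.
have fl m : linear (f m).
  move=> k x y; rewrite /f; case: eqP => _; first by rewrite scaler0 addr0.
  by rewrite mcoeffD mcoeffZ.
have f0 m z : interm0_sub z -> f m z = 0.
  move=> [t _ <-]; rewrite /f; case: eqP => // m0.
  by rewrite mcoeffZ mcoeffU eq_sym; case: eqP => // _; rewrite mulr0.
have p0 : proj sN << 0 >> = 0 by apply/projV0; exists 1; rewrite ?scale1r.
refine (@IntermBasis K (quot_module sN) 0 0 (fun m => proj sN << m >>)
  (fun m => liftV (f m)) (fun m => m != 0) _ _ _ _ _ _ _ _ _).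
- move=> m k x y; exact: (liftV_is_linear (fl m) (f0 m)).
- move=> m m' m'0; rewrite (liftVE _ (fl m) (f0 m)) /f mcoeffU (eq_sym m' m).
  case: (m =P 0) => [m0|_]; last by [].
  by rewrite m0 eq_sym (negPf m'0).
- by move=> m /negPn /eqP ->.
- move=> N sN' Ne x; rewrite -[x]projVK.
  suff : forall z : M, N (proj sN z) by apply.
  apply: malg_span Ne; split=> [|k y z Ny Nz].
    by rewrite /= /proj linear0; exact: sN'.1.
  by rewrite /= /proj linearP; exact: sN'.2.
- by move=> m m0; lia.
- move=> n m _; rewrite [LHS]qactE; transitivity (proj sN (- (m%:~R + 0 + 0 + n%:~R * 0) *: << m + n >>)).
    by congr (projV _ _); exact: interm_act_L.
  exact: linearZ.
- move=> n x; rewrite -[x]projVK [LHS]qactE; apply: (projV0 _ _).2.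
  by rewrite interm_act0 //; exact: sN.1.1.
- move=> x; rewrite -[x]projVK [LHS]qactE; apply: (projV0 _ _).2.
  by rewrite interm_act0 //; exact: sN.1.1.
- by move=> _ m m0; rewrite addr0; apply: contra m0 => /eqP /intr_inj0 ->.
Defined.

Definition interm_basis_sub :
  interm_basis_of (sub_module (interm1_submodule K)) 0 1.
Proof.
pose sN := interm1_submodule K; pose M := interm (0 : K) 1.
pose b m : M := if m == -1 then 0 else << m >>.
have bN m : b m \in subspace_pred sN.1.
  apply/asboolP; rewrite /b /interm1_sub /=; case: eqP => [_|/eqP m1]; first exact: mcoeff0.
  by rewrite mcoeffU (negPf m1).
pose e m : sub_module sN := Sub (b m) (bN m).
have eE m : inclV (e m) = b m by [].
refine (@IntermBasis K (sub_module sN) 0 1 e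
  (fun m x => (inclV x : {malg K[int]})@_m) (fun m => m != -1) _ _ _ _ _ _ _ _ _).
- by move=> m k x y; rewrite inclV_is_linear mcoeffD mcoeffZ.
- by move=> m m' m'1; rewrite eE /b (negPf m'1) mcoeffU eq_sym.
- by move=> m /negPn /eqP ->; apply: inclV_inj; rewrite eE /b eqxx linear0.
- move=> N sN' Ne x; have x1 : (inclV x : {malg K[int]})@_(-1) = 0 := inclVP x.
  have -> : x = \sum_(m <- msupp (inclV x : {malg K[int]})) (inclV x : {malg K[int]})@_m *: e m.
    apply: inclV_inj; rewrite linear_sum /= {1}[inclV x]monalgE.
    rewrite big_seq [RHS]big_seq; apply: eq_bigr => m mx; rewrite linearZ /= eE malgU_scale /b.
    by case: eqP => // m1; rewrite m1 -mcoeff_neq0 x1 eqxx in mx.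
  by apply: (subspace_sum _ sN') => m _; apply: (subspaceZ _ sN').
- by move=> m m0; lia.
- move=> n m m1; apply: inclV_inj; rewrite [LHS]sactE linearZ /= !eE /b (negPf m1).
  rewrite interm_act_L; case: eqP => // mn.
  have -> : - (m%:~R + 0 + 1 + n%:~R * 1) = 0 :> K.
    by rewrite addr0 mulr1 addrAC -intrD mn addNr oppr0.
  by rewrite !scale0r.
- by move=> n x; apply: inclV_inj; rewrite [LHS]sactE interm_act0 // linear0.
- by move=> x; apply: inclV_inj; rewrite [LHS]sactE interm_act0 // linear0.
- by move=> /eqP; rewrite oner_eq0.
Defined.

Lemma interm'_basis (alpha beta : K) : exists a b,
  inhabited (interm_basis_of (interm' alpha beta) a b).
Proof.
pose a := if `[< exists k : int, alpha = k%:~R >] then 0 else alpha.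
have -> : interm' alpha beta =
  if (a == 0) && (beta == 0) then quot_module (interm0_submodule K)
  else if (a == 0) && (beta == 1) then sub_module (interm1_submodule K)
  else interm a beta by [].
case: ifP => [_|ab0]; first by exists 0, 0; constructor; exact: interm_basis_quot.
case: ifP => [_|ab1]; first by exists 0, 1; constructor; exact: interm_basis_sub.
exists a, beta; constructor; apply: interm_basis_gen => b0 m.
move: ab0; rewrite b0 eqxx andbT => /negP a0; apply/negP => /eqP e; apply: a0.
have [int_a|na] := pselect (exists k : int, alpha = k%:~R).
  by rewrite /a asboolT.
exfalso; apply: (na); exists (- m); rewrite mulrNz.
by move: e; rewrite /a asboolF // addrC => /eqP; rewrite addr_eq0 => /eqP.
Qed.

End IntermediateBases.

Lemma linear_eq_subspace (K : fieldType) (V W : lmodType K) (f g : V -> W) :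
  linear f -> linear g -> subspace [set x | f x = g x].
Proof.
move=> lf lg.
have z (F : V -> W) : linear F -> F 0 = 0.
  by move=> lF; have := lF (-1) 0 0; rewrite scaler0 addr0 scaleN1r addNr.
split=> [|k x y /= ex ey]; first by rewrite /= !z.
by rewrite lf lg ex ey.
Qed.

Lemma linear_kernel_subspace (K : fieldType) (V W : lmodType K) (f : V -> W) :
  linear f -> subspace [set x | f x = 0].
Proof.
move=> lf; apply: (linear_eq_subspace lf (g := fun=> 0)) => k x y.
by rewrite scaler0 addr0.
Qed.

Lemma preim_subspace (K : fieldType) (V W : lmodType K) (f : V -> W) (N : set W) :
  linear f -> subspace N -> subspace [set x | N (f x)].
Proof.
move=> lf [N0 Nl]; split=> [|k x y Nx Ny] /=; last by rewrite lf; exact: Nl.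
have -> : f 0 = 0 by have := lf (-1) 0 0; rewrite scaler0 addr0 scaleN1r addNr.
exact: N0.
Qed.

(** * Components of a tensor *)

Section Tensor.
Variables (K : fieldType) (A B : wmodule K) (a b : K) (I : interm_basis_of A a b).

Local Notation T := (tensor A B).
Local Notation e := (evec I).
Local Notation good := (egood I).
Local Notation "x ** y" := (ptensor x y : T) (at level 40).

Definition tcomp (m : int) : T -> B := contr (ecoord I m).

Lemma tcomp_linear m : linear (tcomp m).
Proof. exact: (contr_linear (@ecoord_lin _ _ _ _ I m)). Qed.
HB.instance Definition _ m := GRing.isLinear.Build K T B _ (tcomp m) (tcomp_linear m).

Lemma tcompD m x y : tcomp m (x + y) = tcomp m x + tcomp m y.
Proof. exact: linearD. Qed.
Lemma tcompZ m k x : tcomp m (k *: x) = k *: tcomp m x.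
Proof. exact: linearZ. Qed.

Lemma tcomp_ptensor m m' y : good m' -> tcomp m (e m' ** y) = (m == m')%:R *: y.
Proof.
by move=> gm; rewrite /tcomp (contr_ptensor (@ecoord_lin _ _ _ _ I m)) (ecoordE _ gm).
Qed.

Lemma tcomp_ptensor0 m m' y : m != m' -> tcomp m (e m' ** y) = 0.
Proof.
move=> mm; have [gm|gm] := boolP (good m').
  by rewrite (tcomp_ptensor _ _ gm) (negPf mm) scale0r.
by rewrite (evec_bad gm) ptensor0l linear0.
Qed.

Lemma tcomp_ptensor_eq m y : good m -> tcomp m (e m ** y) = y.
Proof. by move=> gm; rewrite (tcomp_ptensor _ _ gm) eqxx scale1r. Qed.

Lemma evec_tensor_span (N : set T) : subspace N -> (forall m y, good m -> N (e m ** y)) ->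
  forall t, N t.
Proof.
move=> sN Ne; apply: (tensor_span sN) => x y.
apply: (evec_span (i := I) (N := [set x | N (x ** y)])) => [|m].
  split=> [|k z t Nz Nt]; first by rewrite /= ptensor0l; exact: sN.1.
  by rewrite /= ptensor_linl; exact: sN.2.
have [gm|gm] := boolP (good m); first exact: Ne.
by rewrite /= (evec_bad gm) ptensor0l; exact: sN.1.
Qed.

Lemma tcomp_bad m t : ~~ good m -> tcomp m t = 0.
Proof.
move=> gm; apply: (evec_tensor_span (N := [set t | tcomp m t = 0])) => [|m' y gm'].
  exact: lker_subspace.
by apply: tcomp_ptensor0; apply: contraNN gm => /eqP->.
Qed.

(** The quantification over all long enough lists makes the expansion stable
    under linear combinations. *)
Lemma expansion t : exists D : nat, forall s, uniq s ->
  (forall m : int, (`|m| <= D)%N -> m \in s) -> t = \sum_(m <- s) e m ** tcomp m t.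
Proof.
pose N : set T := [set t | exists D : nat, forall s, uniq s ->
  (forall m : int, (`|m| <= D)%N -> m \in s) -> t = \sum_(m <- s) e m ** tcomp m t].
apply: (evec_tensor_span (N := N)) => [|m y gm].
  split=> [|k x y [D1 H1] [D2 H2]].
    exists 0%N => s _ _; rewrite big1 // => m _; by rewrite linear0 ptensor0r.
  exists (D1 + D2)%N => s us Hs.
  have E1 := H1 s us (fun m mD => Hs m (leq_trans mD (leq_addr _ _))).
  have E2 := H2 s us (fun m mD => Hs m (leq_trans mD (leq_addl _ _))).
  rewrite {1}E1 {1}E2 scaler_sumr -big_split /=; apply: eq_bigr => m _.
  by rewrite tcomp_linear ptensor_linr.
exists `|m|%N => s us Hs; have ms := Hs m (leqnn _).
rewrite (bigD1_seq m) //= (tcomp_ptensor_eq _ gm) big1 ?addr0 // => m' mm.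
by rewrite tcomp_ptensor0 // ptensor0r.
Qed.

Definition irange (D : nat) : seq int := [seq i%:Z - D%:Z | i <- iota 0 (D + D).+1].

Lemma irange_uniq D : uniq (irange D).
Proof. by rewrite map_inj_uniq ?iota_uniq // => i j; lia. Qed.

Lemma mem_irange D (m : int) : (m \in irange D) = (`|m| <= D)%N.
Proof.
apply/mapP/idP => [[i ir em]|mD]; first by move: ir; rewrite mem_iota; lia.
by exists `|(m + D%:Z)%R|%N; [rewrite mem_iota; lia|lia].
Qed.

Lemma range_expansion t : exists D, t = \sum_(m <- irange D) e m ** tcomp m t.
Proof.
have [D H] := expansion t; exists D; apply: H (irange_uniq D) _ => m.
by rewrite mem_irange.
Qed.

Lemma nonzero_expansion t : t != 0 -> exists (s : seq int) (y : int -> B),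
  [/\ s != [::], uniq s, all good s, {in s, forall m, y m != 0} &
      t = \sum_(m <- s) e m ** y m].
Proof.
move=> t0; have [D E] := range_expansion t.
pose s := [seq m <- irange D | tcomp m t != 0].
have Es : t = \sum_(m <- s) e m ** tcomp m t.
  rewrite {1}E big_filter [RHS]big_mkcond; apply: eq_bigr => m _.
  by case: eqP => // ->; rewrite ptensor0r.
exists s, (tcomp^~ t); split=> //.
- by apply: contraNneq t0 => s0; rewrite Es s0 big_nil.
- exact: filter_uniq (irange_uniq D).
- apply/allP => m; rewrite mem_filter => /andP[cm _].
  by apply: contraNT cm => gm; rewrite tcomp_bad.
- by move=> m; rewrite mem_filter => /andP[].
Qed.

Lemma tcomp_L (n m : int) t : good m ->
  tcomp m (act (L_ n) t) = - ((m - n)%:~R + a + b + n%:~R * b) *: tcomp (m - n) t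
                          + act (L_ n) (tcomp m t).
Proof.
move=> gm; pose f (t : T) := - ((m - n)%:~R + a + b + n%:~R * b) *: tcomp (m - n) t + act (L_ n) (tcomp m t).
have lf : linear f.
  move=> k x y; rewrite /f !tcomp_linear act_linear scalerDr (scalerDr k) !scalerA.
  by rewrite (mulrC k); exact: addrACA.
have lc : linear (fun t => tcomp m (act (L_ n) t)).
  by move=> k x y; rewrite act_linear tcomp_linear.
apply: (evec_tensor_span (linear_eq_subspace lc lf)) => m' y gm'.
rewrite /= /f act_ptensor (act_Levec _ gm') ptensorZl tcompD tcompZ.
rewrite !(tcomp_ptensor _ _ gm'); congr (_ + _); last by case: eqP; rewrite ?scale1r // !scale0r act0.
have [mm|mm] := eqVneq m (m' + n).
  by rewrite mm in gm *; rewrite addrK eqxx (tcomp_ptensor_eq _ gm) scale1r.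
rewrite tcomp_ptensor0 // scaler0; have -> : m - n == m' = false by lia.
by rewrite scale0r scaler0.
Qed.

Lemma tcomp_W n m t : tcomp m (act (W_ n) t) = act (W_ n) (tcomp m t).
Proof.
apply: (evec_tensor_span (N := [set t | tcomp m (act (W_ n) t) = act (W_ n) (tcomp m t)])) => [|m' y gm'].
  exact: (eq_subspace (tcomp m \o act (W_ n)) (act (W_ n) \o tcomp m)).
rewrite /= act_ptensor (act_Winterm I) ptensor0l add0r !(tcomp_ptensor _ _ gm').
by rewrite actZ.
Qed.

Lemma tcomp_ext t : (forall m, tcomp m t = 0) -> t = 0.
Proof.
move=> ct; have [D ->] := range_expansion t.
by rewrite big1 // => m _; rewrite ct ptensor0r.
Qed.

Lemma tcomp_bounded t : exists D : nat, forall m : int, (D < `|m|)%N -> tcomp m t = 0.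
Proof.
have [D E] := range_expansion t; exists D => m mD.
rewrite {1}E linear_sum big_seq big1 // => m'; rewrite mem_irange => m'D.
by apply: tcomp_ptensor0; lia.
Qed.

End Tensor.

(** * Separation of components *)

Section Separation.
Variables (K : fieldType) (A B : wmodule K) (a b : K) (I : interm_basis_of A a b).
Hypothesis char0 : [pchar K] =i pred0.

Local Notation T := (tensor A B).
Local Notation e := (evec I).
Local Notation good := (egood I).
Local Notation "x ** y" := (ptensor x y : T) (at level 40).

Lemma eventually_neq0 (theta : K) : exists J : nat, forall m : int, J%:Z <= m ->
  m%:~R + theta != 0.
Proof.
have [[m0 e0]|ne] := pselect (exists m0 : int, m0%:~R + theta = 0); last first.
  by exists 0%N => m _; apply/eqP => em; apply: ne; exists m.
exists `|m0|.+1 => m mJ; apply/eqP => em.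
suff : m - m0 = 0 by lia.
by apply: (intr_inj0 char0); rewrite intrB; apply/eqP; rewrite subr_eq0; apply/eqP/(addIr theta); rewrite em e0.
Qed.

(** The coefficient of e_(m+n) in L_(n-k) L_k e_m. *)
Definition LL_coef (n k m : int) : K :=
  (m%:~R + a + b + k%:~R * b) * ((m + k)%:~R + a + b + (n - k)%:~R * b).

(** As a polynomial in k, [LL_coef] has second difference 2 b (1 - b). When b is 0
    or 1 the first difference is m + a, respectively m + n + a + 1: in the latter
    case the basis is rescaled by [om], so that in all cases L_k acts on the
    vectors om j e_j by a scalar of the form j + kap k up to sign. *)
Lemma separation_data : exists (om : int -> K) (kap : int -> K) (sg : int -> K) (x0 x1 x2 : K),
  [/\ forall j k : int, om j * (j%:~R + a + b + k%:~R * b) = om (j + k) * (j%:~R + kap k),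
      exists J : nat, forall j : int, J%:Z <= j -> om j != 0,
      forall m, good m -> sg m != 0 &
      forall n k m, x0 * LL_coef n k m + x1 * LL_coef n (k + 1) m + x2 * LL_coef n (k + 2) m =
         sg m * om (m + n)].
Proof.
have [b0|b0] := eqVneq b 0.
  exists (fun _ => 1), (fun _ => a), (fun m => m%:~R + a), (-1), 1, 0; split.
  - by move=> j k; rewrite b0 mulr0 !addr0.
  - by exists 0%N => j _; exact: oner_neq0.
  - by move=> m gm; exact: (egood_neq0 (i := I)).
  - by move=> n k m; rewrite /LL_coef b0 !(intrD, intrB) mulr1z; ring.
have [b1|b1] := eqVneq b 1.
  exists (fun j => j%:~R + (a + 1)), (fun _ => a + 1), (fun _ => 1), (-1), 1, 0; split.
  - by move=> j k; rewrite b1 !(intrD, intrB); ring.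
  - exact: eventually_neq0.
  - by move=> m _; exact: oner_neq0.
  - by move=> n k m; rewrite /LL_coef b1 !(intrD, intrB) mulr1z; ring.
exists (fun _ => 1), (fun k => a + b + k%:~R * b), (fun _ => 2%:R * b * (1 - b)), 1, (- 2%:R), 1; split.
- by move=> j k; rewrite !mul1r !addrA.
- by exists 0%N => j _; exact: oner_neq0.
- move=> m _; rewrite !mulf_neq0 //; last by rewrite subr_eq0 eq_sym.
  by rewrite ((pcharf0P K).1 char0).
- by move=> n k m; rewrite /LL_coef !(intrD, intrB) mulr1z; ring.
Qed.

Hypothesis B_nilp : forall y : B, exists D : nat, forall n : int, D%:Z <= n -> act (L_ n) y = 0.

Variable N : set T.
Hypothesis sN : submodule N.

Lemma seq_bound (Q : int -> nat -> Prop) (s : seq int) :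
  (forall m (D D' : nat), (D <= D')%N -> Q m D -> Q m D') ->
  (forall m, exists D, Q m D) -> exists D, forall m, m \in s -> Q m D.
Proof.
move=> Qmono QD; elim: s => [|m s [D IH]]; first by exists 0%N.
have [D' QD'] := QD m; exists (D + D')%N => m'; rewrite inE => /orP[/eqP->|/IH].
  exact: Qmono (leq_addl _ _) QD'.
exact: Qmono (leq_addr _ _).
Qed.

Lemma sum_bound (s : seq int) (y : int -> B) : exists D : nat, forall m, m \in s ->
  (forall n : int, D%:Z <= n -> act (L_ n) (y m) = 0 /\ 0 < m + n).
Proof.
apply: (seq_bound (Q := fun m D => forall n : int, D%:Z <= n -> act (L_ n) (y m) = 0 /\ 0 < m + n)).
  by move=> m D D' DD' H n nD; apply: H; lia.
move=> m; have [D H] := B_nilp (y m); exists (D + `|m|).+1 => n nD.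
by split; [apply: H; lia|lia].
Qed.

Lemma act_sum_L (s : seq int) (y : int -> B) (f : int -> int) (n : int) :
  (forall m, m \in s -> good (f m) /\ act (L_ n) (y m) = 0) ->
  act (L_ n) (\sum_(m <- s) e (f m) ** y m) =
  \sum_(m <- s) e (f m + n) ** (- ((f m)%:~R + a + b + n%:~R * b) *: y m).
Proof.
move=> H; rewrite act_sum big_seq [RHS]big_seq; apply: eq_bigr => m ms.
have [gm ym] := H m ms.
by rewrite act_ptensor ym ptensor0r addr0 (act_Levec _ gm) ptensorZl -ptensorZr.
Qed.

Lemma ptensor_lin3 x y x0 x1 x2 k0 k1 k2 :
  x0 *: (x ** (k0 *: y)) + x1 *: (x ** (k1 *: y)) + x2 *: (x ** (k2 *: y)) =
  x ** ((x0 * k0 + x1 * k1 + x2 * k2) *: y) :> T.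
Proof. by rewrite !ptensorZr !scalerA -!scalerDl. Qed.

(** For n large the letters L_(n-k) and L_k kill the y m and act on the first
    factor only. *)
Lemma separate_first (s : seq int) (y : int -> B) : all good s ->
  N (\sum_(m <- s) e m ** y m) ->
  forall (om sg : int -> K) x0 x1 x2,
  (forall n k m, x0 * LL_coef n k m + x1 * LL_coef n (k + 1) m + x2 * LL_coef n (k + 2) m =
         sg m * om (m + n)) ->
  exists R : nat, forall r : int, R%:Z <= r ->
    N (\sum_(m <- s) e (m + r) ** ((om (m + r) * sg m) *: y m)).
Proof.
move=> /allP gs Ny om sg x0 x1 x2 Hx; have [D HD] := sum_bound s y.
exists (D + D + 4)%N => r rR.
have two (k : int) : D%:Z <= k -> D%:Z <= r - k ->
    N (\sum_(m <- s) e (m + r) ** (LL_coef r k m *: y m)).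
  move=> kD rkD; have : N (act (L_ (r - k)) (act (L_ k) (\sum_(m <- s) e m ** y m))).
    by apply: sN.2; exact: sN.2.
  rewrite (act_sum_L (f := id)); last first.
    by move=> m ms; split; [exact: gs|have [] := HD m ms k kD].
  rewrite (act_sum_L (f := fun m => m + k)); last first.
    move=> m ms; split; first by apply: (egood_pos I); have [] := HD m ms k kD.
    by rewrite actZ; have [-> _] := HD m ms _ rkD; rewrite scaler0.
  congr N; apply: eq_bigr => m _; rewrite -addrA (subrKC k) scalerA mulrNN.
  by rewrite mulrC.
have := subspaceD sN.1 (subspaceD sN.1 (subspaceZ x0 sN.1 (two D%:Z _ _))
  (subspaceZ x1 sN.1 (two (D%:Z + 1) _ _))) (subspaceZ x2 sN.1 (two (D%:Z + 2) _ _)).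
move=> /(_ _ _ _ _ _ _) => H; have := H; rewrite !scaler_sumr -!big_split /=.
under eq_bigr => m _ do rewrite ptensor_lin3 Hx mulrC.
apply; lia.
Qed.

(** L_k maps the shift by n to the shift by r = n + k with coefficients
    m + constant, where the constant does not depend on m: subtracting a
    multiple of the shift by r gives the coefficients m - m0. *)
Lemma separate_step (s : seq int) (y : int -> B) (om kap : int -> K) (R : nat) :
  (forall j k : int, om j * (j%:~R + a + b + k%:~R * b) = om (j + k) * (j%:~R + kap k)) ->
  (forall r : int, R%:Z <= r -> N (\sum_(m <- s) e (m + r) ** (om (m + r) *: y m))) ->
  forall m0 : int, exists R' : nat, forall r : int, R'%:Z <= r ->
    N (\sum_(m <- s) e (m + r) ** (om (m + r) *: ((m - m0)%:~R *: y m))).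
Proof.
move=> Hom HN m0; have [D HD] := sum_bound s y.
exists (D + R + D)%N => r rR; pose n : int := r - D%:Z.
have nR : R%:Z <= n by rewrite /n; lia.
have nD : D%:Z <= n by rewrite /n; lia.
have := sN.2 (L_ D) _ (HN n nR).
rewrite (act_sum_L (f := fun m => m + n)); last first.
  move=> m ms; split; first by apply: (egood_pos I); have [] := HD m ms n nD.
  by rewrite actZ; have [-> _] := HD m ms D%:Z (lexx _); rewrite scaler0.
have nDr : n + D%:Z = r by rewrite /n subrK.
move=> N1; have N2 := HN r _; have {}N2 := N2 ltac:(lia).
have := sN.1.2 (- (n%:~R + kap D%:Z + m0%:~R)) _ _ N2 (subspaceN sN.1 N1).
rewrite -sumrN scaler_sumr -big_split /=; congr N; apply: eq_bigr => m _.
rewrite -(addrA m n) nDr -ptensorZr -[- (_ ** _)]scaleN1r -ptensorZr -[X in X + _]scale1r -ptensor_linr.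
congr (_ ** _); rewrite scale1r !scalerA -scalerDl; congr (_ *: _).
have := Hom (m + n) D%:Z; rewrite -(addrA m n) nDr => HH.
rewrite mulN1r mulNr opprK [X in _ + X]mulrC HH.
by rewrite intrB intrD; ring.
Qed.

(** [separate_step] at the first index of s makes the list shorter. *)
Lemma separate (s : seq int) (y : int -> B) (om kap : int -> K) (R : nat) :
  s != [::] -> uniq s -> {in s, forall m, y m != 0} ->
  (forall j k : int, om j * (j%:~R + a + b + k%:~R * b) = om (j + k) * (j%:~R + kap k)) ->
  (forall r : int, R%:Z <= r -> N (\sum_(m <- s) e (m + r) ** (om (m + r) *: y m))) ->
  exists2 y0, y0 != 0 & exists J : nat, forall j : int, J%:Z <= j -> N (e j ** (om j *: y0)).
Proof.
move=> s0 us ys Hom; elim: s y R s0 us ys => // m0 [|m1 s] IH y R _ us ys HN.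
  exists (y m0); first by apply: ys; rewrite inE.
  exists (R + `|m0|)%N => j jR; have := HN (j - m0) ltac:(lia).
  by rewrite big_seq1 addrC subrK.
have [R' HR'] := separate_step Hom HN m0.
apply: (IH (fun m => (m - m0)%:~R *: y m) R') => //.
- by move: us => /= /andP[].
- move=> m ms; rewrite scaler_eq0 negb_or ys ?andbT; last by rewrite inE ms orbT.
  apply/eqP => /(intr_inj0 char0) /eqP; rewrite subr_eq0 => /eqP mm.
  by move: us; rewrite /= -mm ms.
move=> r rR; have := HR' r rR; rewrite big_cons subrr scale0r scaler0 ptensor0r add0r.
exact.
Qed.

Hypothesis B_irr : forall Y : set B, submodule Y -> (exists2 y, Y y & y != 0) -> forall y, Y y.

(** The vectors y such that N contains e_j (x) y for j large form a submodule of
    B, which is nonzero by [separate]. *)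
Lemma nonzero_submodule y : (exists2 t, N t & t != 0) ->
  exists J : nat, forall j : int, J%:Z <= j -> N (e j ** y).
Proof.
move=> [t Nt t0].
pose Y : set B := [set y | exists J : nat, forall j : int, J%:Z <= j -> N (e j ** y)].
suff : Y y by [].
apply: (B_irr (Y := Y)); last first.
  have [s [z [s0 us gs zs et]]] := nonzero_expansion I t0.
  have [om [kap [sg [x0 [x1 [x2 [Hom [J HJ] Hsg Hx]]]]]]] := separation_data.
  rewrite et in Nt; have [R HR] := separate_first gs Nt Hx.
  have [||y0 y00 [J' HJ']] := @separate s (fun m => sg m *: z m) om kap R s0 us _ Hom.
  - by move=> m ms; rewrite scaler_eq0 negb_or zs // Hsg //; exact: (allP gs).
  - by move=> r rR; under eq_bigr => m _ do rewrite scalerA; exact: HR.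
  exists y0 => //; exists (J + J')%N => j jJ.
  have oj : om j != 0 by apply: HJ; lia.
  have := subspaceZ (om j)^-1 sN.1 (HJ' j ltac:(lia)).
  by rewrite ptensorZr scalerA mulVf // scale1r.
split.
  split=> [|k x z [J1 H1] [J2 H2]].
    by exists 0%N => j _; rewrite ptensor0r; exact: sN.1.1.
  exists (J1 + J2)%N => j jJ; rewrite ptensor_linr; apply: sN.1.2; [apply: H1|apply: H2]; lia.
move=> g x [J HJ]; pose d : int := if g is L_ n then n else 0.
exists (J + `|d|).+1 => j jJ.
have jg : good j by apply: (egood_pos I); lia.
have E : e j ** act g x = act g (e j ** x) - act g (e j) ** x.
  by rewrite act_ptensor addrC addKr.
rewrite E; apply: (subspaceB sN.1); first by apply: sN.2; apply: HJ; lia.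
case: g @d jJ {E} => [n|n|] d jJ.
- rewrite (act_Levec _ jg) ptensorZl; apply: (subspaceZ _ sN.1); apply: HJ; rewrite /d in jJ; lia.
- by rewrite (act_Winterm I) ptensor0l; exact: sN.1.1.
- by rewrite (act_Cinterm I) ptensor0l; exact: sN.1.1.
Qed.

End Separation.

Lemma gwt_L n : (0 < n)%N -> gwt (L_ (- n%:Z)) = n.
Proof. by move=> n0; rewrite /gwt /= ifT /=; lia. Qed.
Lemma gwt_W n : (0 < n)%N -> gwt (W_ (- n%:Z)) = n.
Proof. by move=> n0; rewrite /gwt /= ifT /=; lia. Qed.

(** * Highest weight modules *)

Section HighestWeight.
Variables (K : fieldType) (c h hW : K) (B : wmodule K) (vb : B).
Hypothesis char0 : [pchar K] =i pred0.
Hypothesis hv : highest c h hW vb.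
Hypothesis B_gen : forall N : set B, subspace N ->
  (forall w, all isneg w -> N (wact w vb)) -> forall y, N y.

Lemma locally_nilpotent (y : B) :
  exists D : nat, forall n : int, D%:Z <= n -> act (L_ n) y = 0.
Proof.
pose N : set B := [set y | exists D : nat, forall n : int, D%:Z <= n ->
  act (L_ n) y = 0 /\ act (W_ n) y = 0].
suff : N y by move=> [D H]; exists D => n nD; have [] := H n nD.
have sN : subspace N.
  split=> [|k x z [D1 H1] [D2 H2]]; first by exists 0%N => n _; rewrite !act0.
  exists (D1 + D2)%N => n nD.
  have [e1 e2] := H1 n ltac:(lia); have [e3 e4] := H2 n ltac:(lia).
  by rewrite !act_linear e1 e2 e3 e4 !scaler0 addr0.
apply: (B_gen sN) => w; elim: w => [_|g w IH /= /andP[ng nw]].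
  exists 1%N => n n1; rewrite wact_nil !hv /=; try by rewrite /isneg /=; case: ifP => //; lia.
  have -> : n < 0 = false by lia.
  have -> : n == 0 = false by lia.
  by rewrite !scale0r.
have [D HD] := IH nw; have [m m0 gE] := neg_letter ng.
exists (D + m).+1 => n nD; rewrite !wact_cons.
have [Ln Wn] := HD n ltac:(lia); have [Lnm Wnm] := HD (n + - m%:Z) ltac:(lia).
have cc : cocycle K n (- m%:Z) = 0 by rewrite /cocycle opprK; case: eqP => // ?; lia.
by case: gE => ->; split; rewrite actB ?Ln ?Wn act0 add0r /bracketL ?cc ?Lnm ?Wnm ?scaler0 ?scale0r ?addr0.
Qed.

(** The product of the L_0 - (h + i) for i < D; it kills any given vector when D
    is large. *)
Fixpoint weight_filter (D : nat) (y : B) : B :=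
  if D is D'.+1 then act (L_ 0) (weight_filter D' y) - (h + D'%:R) *: weight_filter D' y
  else y.

Lemma weight_filter_linear D : linear (weight_filter D).
Proof.
elim: D => // D IH k x y /=; rewrite IH act_linear scalerDr !scalerA.
by rewrite mulrC -scalerA opprD addrACA -scalerBr.
Qed.

Lemma weight_filter_eigen D mu (y : B) : act (L_ 0) y = mu *: y ->
  weight_filter D y = (\prod_(i < D) (mu - (h + i%:R))) *: y.
Proof.
move=> ey; elim: D => [|D IH]; first by rewrite big_ord0 scale1r.
rewrite /= IH actZ ey scalerA (mulrC _ mu) scalerA -scalerBl -mulrBl big_ord_recr /=.
by rewrite mulrC.
Qed.

Lemma weightE (y : B) mu : y != 0 -> act (L_ 0) y = mu *: y -> exists k : nat, mu = h + k%:R.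
Proof.
move=> y0 ey.
pose N : set B := [set y | exists D : nat, forall D', (D <= D')%N -> weight_filter D' y = 0].
have : N y.
  apply: (B_gen (N := N)) => [|w nw].
    split=> [|k x z [D1 H1] [D2 H2]].
      by exists 0%N => D _; have := weight_filter_linear D (-1) 0 0; rewrite scaler0 addr0 scaleN1r addNr.
    exists (D1 + D2)%N => D DD; rewrite weight_filter_linear H1 ?H2 ?scaler0 ?addr0 //; lia.
  exists (wt w).+1 => D DD.
  have L0 : act (L_ 0) vb = h *: vb by rewrite hv.
  rewrite (weight_filter_eigen D (act_L0 nw L0)).
  by rewrite (bigD1 (Ordinal DD)) //= subrr mul0r scale0r.
move=> [D /(_ D (leqnn D))]; rewrite (weight_filter_eigen D ey) => /eqP.
rewrite scaler_eq0 (negPf y0) orbF prodf_seq_eq0 => /hasP[i _ /=].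
by rewrite subr_eq0 => /eqP ->; exists i.
Qed.

(** * The chain of submodules generated by the e_i (x) v, i >= j *)

Section Chain.
Variables (A : wmodule K) (a b : K) (I : interm_basis_of A a b).
Hypothesis B_irr : forall Y : set B, submodule Y -> (exists2 y, Y y & y != 0) -> forall y, Y y.
Hypothesis vb0 : vb != 0.

Local Notation T := (tensor A B).
Local Notation e := (evec I).
Local Notation good := (egood I).
Local Notation "x ** y" := (ptensor x y : T) (at level 40).

Definition chain (j : int) : set T :=
  smallest (@submodule K T) [set e i ** vb | i in [set i : int | j <= i]].

Lemma chain_submodule j : submodule (chain j).
Proof. exact: smallest_submodule. Qed.

Lemma chain_mem j i : j <= i -> chain j (e i ** vb).
Proof. by move=> ji N [_]; apply; exists i. Qed.

Lemma chain_min j (N : set T) : submodule N -> (forall i, j <= i -> N (e i ** vb)) ->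
  chain j `<=` N.
Proof. by move=> sN Ne x; apply; split=> // _ [i ji <-]; exact: Ne. Qed.

Lemma chainS j k : j <= k -> chain k `<=` chain j.
Proof.
move=> jk; apply: chain_min (chain_submodule j) _ => i ki; apply: chain_mem.
exact: le_trans jk ki.
Qed.

Lemma chain_nonzero j : exists2 t, chain j t & t != 0.
Proof.
exists (e `|j|.+1 ** vb); first by apply: chain_mem; lia.
apply: contraNneq vb0 => e0.
have gj : good `|j|.+1 by apply: (egood_pos I); lia.
by rewrite -(tcomp_ptensor_eq (vb : B) gj) e0 linear0.
Qed.

(** A negative letter applied to e_i (x) y lowers i by at most its weight. *)
Lemma chain_word w i j : all isneg w -> j <= i - (wt w)%:Z -> chain j (e i ** wact w vb).
Proof.
have sC := chain_submodule j.
elim: w i => [|g w IH] i /=.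
  by rewrite wact_nil => _ ji; apply: chain_mem; rewrite /wt /= in ji; lia.
move=> /andP[ng nw]; rewrite wt_cons wact_cons => ji.
have H1 : chain j (e i ** wact w vb) by apply: IH nw _; lia.
have E : e i ** act g (wact w vb) = act g (e i ** wact w vb) - act g (e i) ** wact w vb.
  by rewrite act_ptensor addrC addKr.
rewrite E; apply: (subspaceB sC.1); first exact: sC.2.
have [gi|gi] := boolP (good i); last by rewrite (evec_bad gi) act0 ptensor0l; exact: sC.1.1.
have [n n0 [gE|gE]] := neg_letter ng; rewrite gE.
  rewrite (act_Levec _ gi) ptensorZl; apply: (subspaceZ _ sC.1); apply: IH nw _.
  by move: ji; rewrite gE gwt_L //; lia.
by rewrite (act_Winterm I) ptensor0l; exact: sC.1.1.
Qed.

(** Acting on the right factor only, the first letter W_(-m) does not lower the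
    index of the left factor: the weight of w alone is lost. *)
Lemma chain_Wword m w i j : (0 < m)%N -> all isneg w -> j <= i - (wt w)%:Z ->
  chain j (e i ** wact (W_ (- m%:Z) :: w) vb).
Proof.
move=> m0 nw ji; rewrite wact_cons.
have -> : e i ** act (W_ (- m%:Z)) (wact w vb) = act (W_ (- m%:Z)) (e i ** wact w vb).
  by rewrite act_ptensor (act_Winterm I) ptensor0l add0r.
by apply: (chain_submodule j).2; exact: chain_word.
Qed.

(** If L_(-p)^r v is a combination of words of the same weight starting with a W,
    then e_(j+rp) (x) L_(-p)^r v is in the (j+1)-st term of the chain. Moving the
    letters L_(-p) back to the left factor, where they act by nonzero scalars for
    j large, gives e_j (x) v. *)
Lemma chain_stationary p r : (0 < p)%N ->
  Defs.span [set z : B | exists m w, [/\ (0 < m)%N, all isneg w,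
     (m + wt w = r * p)%N & z = wact (W_ (- m%:Z) :: w) vb]]
    (wact (nseq r (L_ (- p%:Z))) vb) ->
  exists J : nat, forall j : int, J%:Z <= j -> chain j = chain J%:Z.
Proof.
move=> p0 HU; have [J HJ] := eventually_neq0 char0 (a + b - p%:R * b).
have nL k : all isneg (nseq k (L_ (- p%:Z))) by elim: k => //= k ->; rewrite isneg_L.
have wL k : wt (nseq k (L_ (- p%:Z))) = (k * p)%N.
  by elim: k => // k IH; rewrite wt_cons IH gwt_L.
have step j : J%:Z <= j -> chain (j + 1) (e j ** vb).
  move=> jJ; have sC := chain_submodule (j + 1).
  suff down s : (s <= r)%N -> chain (j + 1) (e (j + (s * p)%N%:Z) ** wact (nseq s (L_ (- p%:Z))) vb) ->
      chain (j + 1) (e j ** vb).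
    apply: (down r (leqnn r)).
    apply: (HU [set z | chain (j + 1) (e (j + (r * p)%N%:Z) ** z)]); split.
      split=> [|k x y Nx Ny]; first by rewrite /= ptensor0r; exact: sC.1.1.
      by rewrite /= ptensor_linr; exact: sC.1.2.
    by move=> _ [m [w [m0 nw mw ->]]]; apply: chain_Wword => //; lia.
  elim: s => [_|s IH sr H]; first by rewrite mul0n addr0 wact_nil.
  apply: IH; first exact: ltnW.
  set y := wact (nseq s _) vb; set i := j + (s.+1 * p)%N%:Z in H.
  have gi : good i by apply: (egood_pos I); rewrite /i; nia.
  have E : act (L_ (- p%:Z)) (e i) ** y = act (L_ (- p%:Z)) (e i ** y) - e i ** act (L_ (- p%:Z)) y.
    by rewrite act_ptensor addrK.
  have : chain (j + 1) (act (L_ (- p%:Z)) (e i) ** y).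
    rewrite E; apply: (subspaceB sC.1); last by rewrite -wact_cons.
    by apply: sC.2; apply: chain_word => //; rewrite wL /i mulSn; lia.
  rewrite (act_Levec _ gi) ptensorZl.
  have -> : i - p%:Z = j + (s * p)%N%:Z by rewrite /i mulSn; lia.
  move=> H2; have := subspaceZ (- (i%:~R + a + b + (- p%:Z)%:~R * b))^-1 sC.1 H2.
  rewrite scalerA mulVf ?scale1r // oppr_eq0.
  have -> : i%:~R + a + b + (- p%:Z)%:~R * b = i%:~R + (a + b - p%:R * b) :> K.
    by rewrite mulrNz -pmulrn mulNr !addrA.
  by apply: HJ; rewrite /i; lia.
exists J; suff H (n : nat) : chain J%:Z `<=` chain (J%:Z + n%:Z).
  move=> j jJ; apply/seteqP; split; first exact: chainS.
  by have := H `|j - J%:Z|%N; rewrite (_ : J%:Z + _ = j) //; lia.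
elim: n => [|n IH]; first by rewrite addr0.
apply: (subset_trans IH); apply: chain_min (chain_submodule _) _ => i ji.
have [->|ni] := eqVneq i (J%:Z + n%:Z); last by apply: chain_mem; lia.
rewrite (_ : J%:Z + n.+1%:Z = J%:Z + n%:Z + 1); last by lia.
by apply: step; lia.
Qed.

Lemma chain_nontrivial_sub (N : set T) : submodule N -> (exists2 t, N t & t != 0) ->
  exists J : nat, forall j : int, J%:Z <= j -> chain j `<=` N.
Proof.
move=> sN Nt; have [J HJ] := nonzero_submodule I char0 locally_nilpotent sN B_irr vb Nt.
exists J => j jJ; apply: chain_min sN _ => i ij; apply: HJ; exact: le_trans jJ ij.
Qed.

(** A nonzero submodule contains some term of the chain, hence all of them. *)
Lemma chain_irreducible (J : nat) :
  (forall j : int, J%:Z <= j -> chain j = chain J%:Z) -> irreducible_in (chain J%:Z).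
Proof.
move=> HJ; split; [exact: chain_submodule|exact: chain_nonzero|].
move=> N sN NC; have [N0|N0] := pselect (exists2 t, N t & t != 0); [right|left].
  apply/seteqP; split=> //; have [J' HJ'] := chain_nontrivial_sub sN N0.
  rewrite -(HJ (J + J')%N%:Z); last by lia.
  by apply: HJ'; lia.
apply/seteqP; split=> t; last by move=> ->; exact: sN.1.1.
by move=> Nt /=; apply: contrapT => /eqP t0; apply: N0; exists t.
Qed.

Lemma irreducible_stationary (N : set T) : irreducible_in N ->
  exists J : nat, forall j : int, J%:Z <= j -> chain j = N.
Proof.
move=> [sN N0 irr]; have [J HJ] := chain_nontrivial_sub sN N0; exists J => j jJ.
have [] := irr _ (chain_submodule j) (HJ j jJ) => // C0.
by have [t] := chain_nonzero j; rewrite C0 => -> /eqP.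
Qed.

Lemma span_bounded (s : seq T) : exists D : nat, forall t, Defs.span [set` s] t ->
  forall m : int, (D < `|m|)%N -> tcomp I m t = 0.
Proof.
have [D HD] : exists D : nat, forall t, t \in s -> forall m : int, (D < `|m|)%N -> tcomp I m t = 0.
  elim: s => [|t s [D IH]]; first by exists 0%N.
  have [D' HD'] := tcomp_bounded I t; exists (D + D')%N => t'; rewrite inE => /orP[/eqP->|ts] m mD.
    by apply: HD'; lia.
  by apply: (IH t' ts); lia.
exists D => t St m mD; apply: (St [set t | tcomp I m t = 0]); split; first exact: lker_subspace.
by move=> t' ts; exact: HD.
Qed.

(** A weight of the chain is h - (d + a + b) for an integer d, and its weight
    space contains e_(d+n) (x) W_(-n) v for all n large. *)
Lemma chain_infinite_dim j :
  (exists D : nat, forall k, (D <= k)%N -> act (W_ (- k%:Z)) vb != 0) ->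
  infinite_dim_weights (chain j).
Proof.
move=> [D HD] lam [x [Cx Lx] x0] [s Hs].
have [m cm] : exists m, tcomp I m x != 0.
  by apply: contrapT => H; move/eqP: x0; apply; apply: (tcomp_ext (I := I)) => m; apply: contrapT => /eqP cm; apply: H; exists m.
have gm : good m by apply: contraNT cm => gm; rewrite (tcomp_bad _ gm).
have [k kE] : exists k : nat, lam + (m%:~R + a + b) = h + k%:R.
  apply: (weightE cm); have := tcomp_L 0 x gm; rewrite [act _ x]Lx tcompZ subr0 mul0r addr0 => e0.
  by rewrite scalerDl e0 scaleNr addrC addNKr.
have [D' HD'] := span_bounded s.
(* The weight of x gives d = m - k. *)
pose n := (D + D' + `|m| + k + `|j|).+1%N; pose i : int := m - k%:Z + n%:Z.
have gi : good i by apply: (egood_pos I); rewrite /i /n; lia.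
have nn : isneg (W_ (- n%:Z)) by exact: isneg_W.
pose z : T := e i ** act (W_ (- n%:Z)) vb.
have zE : z = act (W_ (- n%:Z)) (e i ** vb).
  by rewrite /z act_ptensor (act_Winterm I) ptensor0l add0r.
have Cz : (chain j `&` weight_space lam) z.
  split; first by rewrite zE; apply: (chain_submodule j).2; apply: chain_mem; rewrite /i /n; lia.
  have L0 : act (L_ 0) vb = h *: vb by rewrite hv.
  have Ln : act (L_ 0) (act (W_ (- n%:Z)) vb) = (h + n%:R) *: act (W_ (- n%:Z)) vb.
    have nw : all isneg [:: W_ (- n%:Z)] by rewrite all_seq1.
    by have := act_L0 nw L0; rewrite wact1 wt_cons gwt_W // addn0.
  rewrite /weight_space /= /z act_ptensor (act_Levec _ gi) addr0 Ln ptensorZl ptensorZr -scalerDl.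
  congr (_ *: _); rewrite mul0r addr0.
  have -> : lam = h + k%:R - (m%:~R + a + b) by rewrite -kE addrK.
  by rewrite /i intrD intrB -!pmulrn; ring.
have : tcomp I i z = 0 by apply: HD'; [exact: Hs|rewrite /i /n; lia].
rewrite /z (tcomp_ptensor_eq _ gi) => /eqP; apply/negP; apply: HD; rewrite /n; lia.
Qed.

End Chain.
End HighestWeight.

Lemma subspace_unscale (K : fieldType) (M : lmodType K) (N : set M) k x :
  subspace N -> k != 0 -> N (k *: x) -> N x.
Proof.
by move=> sN k0 /(subspaceZ k^-1 sN); rewrite scalerA mulVf // scale1r.
Qed.

Lemma mem_span (K : fieldType) (M : lmodType K) (Z : set M) x : Z x -> Defs.span Z x.
Proof. by move=> Zx N [_]; apply. Qed.

(** * The quotient of the Verma module by its radical *)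

Section Final.
Variables (K : fieldType) (c h hW : K).
Hypothesis char0 : [pchar K] =i pred0.
Local Notation V := (verma c h hW).
Local Notation v := (verma_vector c h hW).
Local Notation radical := (@radical K c h hW).
Local Notation sR := (radical_submodule c h hW).
Local Notation base i := (wact (wmono i) v).
Local Notation Vs := (@Vs K c h hW).
Local Notation sVs := (@Vs_subspace K c h hW).

(** The irreducible quotient is given by a surjective morphism [pi] with kernel
    the radical. *)
Variables (B : wmodule K) (pi : V -> B).
Hypothesis pi_linear : linear pi.
Hypothesis act_pi : forall g x, act g (pi x) = pi (act g x).
Hypothesis pi_surj : forall y, exists x, y = pi x.
Hypothesis pi_eq0 : forall x, pi x = 0 <-> radical x.
Local Notation vb := (pi v).

Lemma pi0 : (pi 0 : B) = 0.
Proof. exact: ((pi_eq0 0).2 sR.1.1). Qed.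

Lemma piZ k x : (pi (k *: x) : B) = k *: (pi x : B).
Proof. by have := pi_linear k x 0; rewrite pi0 !addr0. Qed.

Lemma pi_comb (J : Type) (s : seq J) (k : J -> K) (x : J -> V) :
  (pi (\sum_(i <- s) k i *: x i) : B) = \sum_(i <- s) k i *: (pi (x i) : B).
Proof.
elim: s => [|i s IH]; first by rewrite !big_nil pi0.
by rewrite !big_cons pi_linear IH.
Qed.

Lemma wact_pi w x : wact w (pi x : B) = pi (wact w x).
Proof. by elim: w => // g w IH; rewrite !wact_cons IH act_pi. Qed.

Lemma quotient_highest : highest c h hW vb.
Proof.
move=> g ng; rewrite act_pi (verma_highest c h hW ng); exact: piZ.
Qed.

Lemma quotient_gen (N : set B) : subspace N ->
  (forall w, all isneg w -> N (wact w vb)) -> forall y, N y.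
Proof.
move=> sN Nw y; have [x ->] := pi_surj y.
apply: (base_ind (preim_subspace pi_linear sN)) => i ip.
by rewrite /= -wact_pi; apply: Nw; exact: wmono_neg.
Qed.

Lemma quotient_irreducible (Y : set B) : submodule Y ->
  (exists2 y, Y y & y != 0) -> forall y, Y y.
Proof.
move=> sY [y Yy y0]; have sP : submodule [set x | Y (pi x)].
  split=> [|g x Yx]; last by rewrite /= -act_pi; exact: sY.2.
  exact: (preim_subspace pi_linear sY.1).
suff Pv : Y vb by move=> z; have [x ->] := pi_surj z; exact: (verma_ind sP Pv x).
apply: contrapT => Pv; have PR := proper_radical char0 sP Pv.
have [x ex] := pi_surj y; move/eqP: y0; apply; rewrite ex; apply/pi_eq0.
by apply: PR; rewrite /= -ex.
Qed.

Lemma quotient_vector_neq0 : vb != 0.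
Proof. by apply/eqP => /pi_eq0; exact: radicalNv. Qed.

(** L_n W_(-n) v = [gram n] v. *)
Lemma quotient_W_neq0 k : (0 < k)%N -> ~ critical c hW k -> act (W_ (- k%:Z)) vb != 0.
Proof.
move=> k0 nc; apply/eqP; rewrite act_pi => /pi_eq0 R1.
have := sR.2 (L_ k%:Z) _ R1.
have -> : act (L_ k%:Z) (act (W_ (- k%:Z)) v) = gram c hW k *: v.
  have [Lv _] := verma_pos c h hW k0.
  rewrite actB Lv act0 add0r /bracketL subrr opprK.
  rewrite (verma_highest c h hW (isT : ~~ isneg (W_ 0))).
  by rewrite (verma_highest c h hW (isT : ~~ isneg C_)) /= !scalerA -scalerDl.
move=> R2; apply: (@radicalNv K c h hW).
have g0 : gram c hW k != 0 by apply/eqP => /(gram_eq0 c hW char0 k0).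
exact: (subspace_unscale sR.1 g0 R2).
Qed.

Variables (A : wmodule K) (a b : K) (I : interm_basis_of A a b).
Local Notation T := (tensor A B).
Local Notation e := (evec I).
Local Notation good := (egood I).
Local Notation "x ** y" := (ptensor x y : T) (at level 40).
Local Notation chain := (@chain K B vb A a b I).

(** * From a subsingular vector to an irreducible submodule *)

(** In the quotient u = 0, and u - L_(-p)^r v involves only monomials that start
    with a W. *)
Lemma power_in_Wwords p r u : (0 < p)%N -> radical u -> homog (r * p) u ->
  Vs (moreW 0) (u - wact (nseq r (L_ (- p%:Z))) v) ->
  Defs.span [set z : B | exists m w, [/\ (0 < m)%N, all isneg w,
     (m + wt w = r * p)%N & z = wact (W_ (- m%:Z) :: w) vb]]
    (wact (nseq r (L_ (- p%:Z))) vb).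
Proof.
move=> p0 Ru hu mu; set S := Defs.span _; have sS : subspace S := span_subspace _.
set y := wact _ v in mu; set x := u - y.
have hx : Vs (fun i => (0 < size i.1)%N && (wti i == (r * p)%N)) x.
  have hy : homog (r * p) y.
    rewrite /y -wmono_nseq => i.
    rewrite (coord_base c h hW (nseq_bipartition r p0)) => /(fsubsetP msuppU_le).
    rewrite in_fset1 => /eqP->; by rewrite /wti /= sumn_nseq add0n mulnC.
  have h2 : homog (r * p) x by exact: (subspaceB (sVs _) hu hy).
  by move=> i ix; rewrite [X in X && _](mu i ix) (h2 i ix).
rewrite wact_pi -/y; have -> : (pi y : B) = - pi x.
  have -> : y = - x + u by rewrite /x opprB subrK.
  rewrite -[- x]scaleN1r pi_linear (pi_eq0 u).2 // addr0; exact: scaleN1r.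
apply: (subspaceN sS); rewrite -(coordK x) /pact /lext.
rewrite pi_comb; apply: (subspace_sum_seq sS) => i ix _; apply: (subspaceZ _ sS).
rewrite -wact_pi; have ip := coord_bipartition ix.
have /andP[] := hx i ix; case: i ip {ix} => [[|m ms] ns] // ip _ wi.
have wE : wmono (m :: ms, ns) = W_ (- m%:Z) :: wmono (ms, ns) by [].
have m0 : (0 < m)%N by move: ip; rewrite /is_bipartition /is_partition /= => /andP[/and3P[]].
have /= := wmono_neg ip; rewrite wE /= => /andP[_ nw].
apply: mem_span; exists m, (wmono (ms, ns)); split=> //.
by have := wt_wmono ip; rewrite (eqP wi) wE wt_cons gwt_W.
Qed.

(** * Copies of the Verma module in the tensor product *)

(** As V is free of rank one over U(L_-), there is a U(L_-)-linear map sending v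
    to e_i (x) v. *)
Definition vcopy (i : int) (x : V) : T := pact (e i ** vb) (vcoord x).

Lemma vcopy_linear i : linear (vcopy i).
Proof. by move=> k x y; rewrite /vcopy vcoordD vcoordZ pactD pactZ. Qed.

Lemma vcopy0 i : vcopy i 0 = 0.
Proof. by rewrite /vcopy vcoord0 pact0. Qed.

Lemma vcopy_word i w : all isneg w -> vcopy i (wact w v) = wact w (e i ** vb).
Proof. by move=> nw; rewrite /vcopy coord_wact -wact_tau //; left. Qed.

Lemma vcopy_v i : vcopy i v = e i ** vb.
Proof. exact: (vcopy_word i (isT : all isneg [::])). Qed.

Lemma vcopy_act i g x : isneg g -> vcopy i (act g x) = act g (vcopy i x).
Proof.
move=> ng; have l1 : linear (fun x => vcopy i (act g x)).
  by move=> k y z; rewrite act_linear vcopy_linear.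
have l2 : linear (fun x => act g (vcopy i x)).
  by move=> k y z; rewrite vcopy_linear act_linear.
apply: (base_ind (linear_eq_subspace l1 l2)) => j jp.
have nj := wmono_neg jp; rewrite /= (vcopy_word i nj) -!wact_cons vcopy_word //.
by rewrite /= ng.
Qed.

Lemma vcopy_wact i w x : all isneg w -> vcopy i (wact w x) = wact w (vcopy i x).
Proof.
elim: w => [_|g w IH /= /andP[ng nw]]; first by rewrite !wact_nil.
by rewrite !wact_cons (vcopy_act _ _ ng) (IH nw).
Qed.

(** A negative word lowers the index of the left factor or acts on the right
    factor. *)
Lemma tcomp_word i w : good i -> all isneg w ->
  tcomp I i (wact w (e i ** vb)) = wact w vb /\
  forall m, i < m -> tcomp I m (wact w (e i ** vb)) = 0.
Proof.
move=> gi; elim: w => [_|g w IH /= /andP[ng nw]].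
  rewrite !wact_nil; split; first exact: tcomp_ptensor_eq.
  by move=> m im; apply: tcomp_ptensor0; rewrite gt_eqF.
have [IH1 IH2] := IH nw; rewrite !wact_cons.
have [n n0 [gE|gE]] := neg_letter ng; rewrite gE; split.
- rewrite (tcomp_L _ _ gi) IH2 ?scaler0 ?add0r ?IH1 //; lia.
- move=> m im; have [gm|gm] := boolP (good m); last exact: tcomp_bad.
  rewrite (tcomp_L _ _ gm) IH2; last by lia.
  by rewrite IH2 // act0 scaler0 addr0.
- by rewrite tcomp_W IH1.
- by move=> m im; rewrite tcomp_W IH2 // act0.
Qed.

Lemma tcomp_Phi i x : good i -> tcomp I i (vcopy i x) = pi x.
Proof.
move=> gi; have l1 : linear (fun x => tcomp I i (vcopy i x)).
  by move=> k y z; rewrite vcopy_linear tcomp_linear.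
apply: (base_ind (linear_eq_subspace l1 pi_linear)) => j jp.
have nj := wmono_neg jp; rewrite /= (vcopy_word i nj) -wact_pi.
by have [] := tcomp_word gi nj.
Qed.

Lemma tcomp_Phi_gt i m x : good i -> i < m -> tcomp I m (vcopy i x) = 0.
Proof.
move=> gi im; have l1 : linear (fun x => tcomp I m (vcopy i x)).
  by move=> k y z; rewrite vcopy_linear tcomp_linear.
apply: (base_ind (linear_kernel_subspace l1)) => j jp.
have nj := wmono_neg jp; rewrite /= (vcopy_word i nj).
by have [_] := tcomp_word gi nj; apply.
Qed.

(** Presentations that may be extended by zeros can be added termwise. *)
Definition copies (j : int) : set T := [set z | exists (D : nat) (x : nat -> V),
  forall D', (D <= D')%N -> z = \sum_(k < D') vcopy (j + k%:Z) (x k)].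

Lemma copies_subspace j : subspace (copies j).
Proof.
split; first by exists 0%N, (fun _ => 0) => D _; rewrite big1 // => k _; exact: vcopy0.
move=> k y z [D1 [x1 H1]] [D2 [x2 H2]]; exists (D1 + D2)%N, (fun n => k *: x1 n + x2 n) => D DD.
rewrite (H1 D) ?(H2 D); [|lia|lia].
by rewrite scaler_sumr -big_split /=; apply: eq_bigr => n _; rewrite vcopy_linear.
Qed.

Lemma copies_Phi j i x : j <= i -> copies j (vcopy i x).
Proof.
move=> ji; pose k := `|i - j|%N; exists k.+1, (fun n => if n == k then x else 0) => D DD.
rewrite (bigD1 (Ordinal DD)) //= eqxx big1 ?addr0; last first.
  by move=> n nk; rewrite ifF ?vcopy0 //; apply: negbTE; apply: contra nk => /eqP nk; apply/eqP/val_inj.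
have -> : j + k%:Z = i by rewrite /k; lia.
by [].
Qed.

Lemma copies_ind j (N : set T) : subspace N ->
  (forall i w, j <= i -> all isneg w -> N (wact w (e i ** vb))) -> copies j `<=` N.
Proof.
move=> sN Nw z [D [x /(_ D (leqnn D)) ->]]; apply: (subspace_sum _ sN) => k _.
apply: (base_ind (preim_subspace (vcopy_linear (j + k%:Z)) sN)) => i ip.
have ni := wmono_neg ip; rewrite /= vcopy_word //; apply: Nw => //; lia.
Qed.

(** A nonnegative letter can be moved through a negative word; at e_i (x) v it
    increases i. *)
Lemma copies_submodule j : submodule (copies j).
Proof.
have sC := copies_subspace j; split; first exact: sC.
have neg g z : isneg g -> copies j z -> copies j (act g z).
  move=> ng; apply: (copies_ind (preim_subspace (act_linear g) sC)) => i w ji nw.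
  rewrite /= -(vcopy_word i nw) -vcopy_act //; exact: copies_Phi.
move=> g; apply: (copies_ind (preim_subspace (act_linear g) sC)) => i w ji.
elim: w g => [|x w IH] g /=; last first.
  move=> /andP[nx nw]; rewrite wact_cons actB; apply: (subspaceD sC).
    by apply: neg => //; exact: IH.
  by apply: (subspace_bracketL _ _ sC) => g'; exact: IH.
move=> _; rewrite wact_nil; have [ng|ng] := boolP (isneg g).
  by apply: neg => //; rewrite -vcopy_v; exact: copies_Phi.
rewrite act_ptensor; apply: (subspaceD sC); last first.
  rewrite (quotient_highest ng) ptensorZr; apply: (subspaceZ _ sC).
  by rewrite -vcopy_v; exact: copies_Phi.
have [gi|gi] := boolP (good i); last by rewrite (evec_bad gi) act0 ptensor0l; exact: sC.1.
case: g ng => [n|n|] ng.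
- rewrite (act_Levec _ gi) ptensorZl -vcopy_v; apply: (subspaceZ _ sC); apply: copies_Phi.
  by move: ng; rewrite /isneg /=; case: ifP => // n0 _; lia.
- by rewrite (act_Winterm I) ptensor0l; exact: sC.1.
- by rewrite (act_Cinterm I) ptensor0l; exact: sC.1.
Qed.

Lemma chain_copies j : chain j `<=` copies j.
Proof.
apply: chain_min (copies_submodule j) _ => i ji.
by rewrite -vcopy_v; exact: copies_Phi.
Qed.

(** The W act on the right factor only. *)
Lemma vcopy_W_span i x : W_span x -> vcopy i x = e i ** pi x.
Proof.
have lr : linear (fun x => e i ** pi x) by move=> k y z; rewrite pi_linear ptensor_linr.
move=> Wx; apply: (Wx [set x | vcopy i x = e i ** pi x]); split.
  exact: (linear_eq_subspace (vcopy_linear i) lr).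
move=> _ [ms pms <-] /=; rewrite pbwE.
have ip : is_bipartition (ms, [::]) by rewrite /is_bipartition /= pms.
rewrite (vcopy_word i (wmono_neg ip)) -wact_pi /wmono cats0.
elim: ms {pms ip} => [|m ms IH]; first by rewrite !wact_nil.
by rewrite /= !wact_cons IH act_ptensor (act_Winterm I) ptensor0l add0r.
Qed.

(** u' is a combination of words in the W and vanishes in the quotient, so it
    maps to e_i (x) u' = 0. *)
Lemma vcopy_radical i (u' : nat -> V) (Hu' : forall p, critical c hW p -> is_u' p (u' p)) x :
  (x = 0 \/ exists2 p, critical c hW p & smallest (@submodule K V) [set u' p] x) ->
  vcopy i x = 0.
Proof.
move=> [->|[p cp]]; first exact: vcopy0.
move=> /(usub_negspan cp (Hu' p cp)); apply: (negspan_ind (linear_kernel_subspace (vcopy_linear i))).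
move=> w nw; rewrite /= (vcopy_wact _ _ nw); have [_ _ Wu _] := Hu' p cp.
rewrite (vcopy_W_span i Wu) (pi_eq0 _).2 ?ptensor0r ?wact0 //.
by apply: (usub_radical char0 cp (Hu' p cp)) => N [_]; apply.
Qed.

(** Suppose that e_j (x) v is a sum of copies with indices in j + 1, ..., j + D.
    The component of index j + D shows that the last term comes from the radical,
    hence vanishes; by induction on D, e_j (x) v = 0. *)
Lemma chain_strict (j : int) : 0 < j ->
  (forall i x, radical x -> vcopy i x = 0) -> ~ chain (j + 1) (e j ** vb).
Proof.
move=> j0 PR /chain_copies[D [x /(_ D (leqnn D))]].
have gj (i : int) : j <= i -> good i by move=> ji; apply: (egood_pos I); lia.
elim: D => [|D IH E].
  rewrite big_ord0 => e0; have := quotient_vector_neq0.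
  by rewrite -(tcomp_ptensor_eq vb (gj j (lexx j))) e0 linear0 eqxx.
apply: IH; rewrite E big_ord_recr /= [vcopy _ (x D)]PR ?addr0 //.
have gD : good (j + 1 + D%:Z) by apply: gj; lia.
apply/pi_eq0; rewrite -(tcomp_Phi (x D) gD).
have := congr1 (tcomp I (j + 1 + D%:Z)) E; rewrite big_ord_recr /= tcompD linear_sum /=.
rewrite tcomp_ptensor0; last by lia.
rewrite big1 ?add0r => [|k _]; first by move=> ->.
by apply: tcomp_Phi_gt; [apply: gj; lia|have := ltn_ord k; lia].
Qed.

End Final.

(** * The criterion *)

Section MainTheorem.
Variables (K : fieldType) (c h hW : K).
Hypothesis char0 : [pchar K] =i pred0.
Local Notation V := (verma c h hW).
Local Notation v := (verma_vector c h hW).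
Local Notation Lq := (irreducible_quotient V).
Local Notation sk := (svalP (irreducible_kernel V)).

Lemma irreducible_quotient_eq0 x : proj sk x = 0 <-> radical x.
Proof. by rewrite -(kernelE char0); exact: proj_eq0. Qed.

Variable u' : nat -> V.
Hypothesis Hu' : forall p, critical c hW p -> is_u' p (u' p).
Variables (A : wmodule K) (a b : K) (I : interm_basis_of A a b).

Local Notation subsingular_power := (exists (p r : nat) (u : V),
  [/\ critical c hW p, (0 < r)%N, subsingular (u' p) u &
      is_lowest_component u (iter r (act (L_ (- p%:Z))) v)]).

Let pl : linear (proj sk) := @proj_linear K V _ sk.
Let pa := @act_proj K V _ sk.
Let ps := @proj_surj K V _ sk.
Let p0 := irreducible_quotient_eq0.
Let hv := quotient_highest pl pa p0.
Let hg := quotient_gen pl pa ps.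
Let hi := quotient_irreducible char0 pl pa ps p0.
Let hn := quotient_vector_neq0 p0.

(** An irreducible submodule contains a term of the chain, so it is the limit of
    the chain, which is then stationary. *)
Theorem subsingular_iff :
  (exists N : set (tensor A Lq), irreducible_in N /\ infinite_dim_weights N)
  <-> subsingular_power.
Proof.
split=> [[N [irrN _]]|[p [r [u [cp r0 su lu]]]]].
  have [//|RN] := radical_dichotomy char0 Hu'; exfalso.
  have [J HJ] := irreducible_stationary char0 hv hg I hi hn irrN.
  pose j : int := J.+1%:Z.
  have j0 : 0 < j by rewrite /j; lia.
  apply: (chain_strict pl pa p0 j0 (I := I)) => [i x /RN Rx|].
    exact: (vcopy_radical char0 pl pa p0 I i Hu' Rx).
  rewrite (HJ (j + 1)) -?(HJ j); last 2 first.
  - by rewrite /j; lia.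
  - by rewrite /j; lia.
  exact: chain_mem.
have [Ru hu mu] := subsingular_radical char0 Hu' cp r0 su lu.
have HU := power_in_Wwords pl pa p0 cp.1 Ru hu mu.
have [J HJ] := chain_stationary char0 I hn cp.1 HU.
exists (chain (proj sk v) I J%:Z); split.
  exact: (chain_irreducible char0 hv hg hi hn HJ).
refine (chain_infinite_dim hv hg hn _).
have chW := parameters_neq0 char0 Hu'.
exists p.+1 => k pk; apply: (quotient_W_neq0 char0 pa p0); first by lia.
by move=> ck; have e := critical_uniq char0 chW cp ck; rewrite e ltnn in pk.
Qed.

End MainTheorem.

Theorem corollary34 (R : realType) (c h hW alpha beta : R[i])
    (u' : nat -> verma c h hW)
    (Hu' : forall p : nat, critical c hW p -> is_u' p (u' p)) :
  (exists N : set (tensor (interm' alpha beta)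
                          (irreducible_quotient (verma c h hW))),
     irreducible_in N /\ infinite_dim_weights N)
  <->
  (exists (p r : nat) (u : verma c h hW),
     [/\ critical c hW p, (0 < r)%N, subsingular (u' p) u &
         is_lowest_component u
           (iter r (act (L_ (- p%:Z))) (verma_vector c h hW))]).
Proof.
have char0 : [pchar R[i]] =i pred0 by exact: pchar_num.
have [a [b [I]]] := interm'_basis char0 alpha beta.
exact: (subsingular_iff char0 Hu' I).
Qed.
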